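(* Let $P,Q$ be probability measures on $\mathbb{R}^d$ with compact supports $\Omega,\Omega'$. Assume: (1) $c$ is Lipschitz on $\Omega\times\Omega'$ with constant $L>0$; (2) $\phi$ satisfies the standing regularization assumption (see context) and, in addition, $\psi\in\mathcal{C}^{1,1}_{loc}(\mathbb{R})$ with $\psi''\in L^\infty_{loc}(\mathbb{R})$ non-decreasing (a monotone measurable representative of the a.e. second derivative $\psi''$ is fixed); (3) $\Omega$ is (bounded and) convex and $P$ admits a Lebesgue density $\rho$ with $0<\lambda_P\le\rho(x)\le\Lambda_P<\infty$ for $x\in\Omega$. Let $(\delta_\psi,t_\psi)$ be a pair as in the standing regularization assumption such that $\psi''(t_\psi-\delta_\psi)>0$, and let $\gamma:\mathbb{N}\times(0,\infty)\to(0,\infty)$ be such that for every $n\in\mathbb{N}$ and $\varepsilon\in(0,\infty)$, $$\mathbb{P}\Bigl(\max_j\frac1n\sum_i\pi^{(1)}_{i,j}\le\gamma(n,\varepsilon)\Bigr)=1\quad\text{and}\quad\mathbb{P}\Bigl(\max_i\frac1n\sum_j\pi^{(1)}_{i,j}\le\gamma(n,\varepsilon)\Bigr)=1,$$ where $\pi^{(1)}_{i,j}=\psi''\Bigl(\frac{\widehat f(X_i)+\widehat g(Y_j)-c(X_i,Y_j)}{\varepsilon}+\frac{\delta_\psi}{4}\Bigr)$. For every fixed $u>\max(d,2)$ there exist constants $C$ and $n_0\in\mathbb{N}$ (independent of $n$ and $\varepsilon$) such that for all $n\ge n_0$ and $\varepsilon\in(0,1]$, $$\mathbb{E}\Bigl[\int\bigl((\widehat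 f-f_\varepsilon)\oplus(\widehat g-g_\varepsilon)\bigr)^2d(\widehat P\otimes\widehat Q)\Bigr]\le\frac{2^8\max\Bigl(\frac{2^6(5\|c\|_\infty+\varepsilon\phi'(1))^2}{\delta_\psi^2},1\Bigr)}{(\beta_{n,\varepsilon})^2}\,\frac{\mathrm{Var}_{P\otimes Q}[\rho_\varepsilon]}{n}$$ $$\qquad+\frac{8(5\|c\|_\infty+\varepsilon\phi'(1))^2}{n}\Biggl(\frac1{\varepsilon^u}+\frac{C}{\bigl(\min_{x\in\Omega}P(\mathbb{B}_{\frac{\delta_\psi\varepsilon}{8L}}(x))\bigr)^2}+\frac{C}{\bigl(\min_{y\in\Omega'}Q(\mathbb{B}_{\frac{\delta_\psi\varepsilon}{8L}}(y))\bigr)^2}\Biggr),$$ where $$\beta_{n,\varepsilon}=\min\Biggl(\frac{4\alpha_{n,\varepsilon}\,\psi''(t_\psi-\delta_\psi)\min_{x\in\Omega}P(\mathbb{B}_{\frac{\delta_\psi\varepsilon}{8L}}(x))}{\psi''(t_\psi-\delta_\psi)\min_{x\in\Omega}P(\mathbb{B}_{\frac{\delta_\psi\varepsilon}{8L}}(x))+8\gamma(n,\varepsilon)},\ \frac12\psi''(t_\psi-\delta_\psi)\min_{x\in\Omega}P(\mathbb{B}_{\frac{\delta_\psi\varepsilon}{8L}}(x))\Biggr)$$ and $$\alpha_{n,\varepsilon}=\frac{\lambda_P^2\,\psi''(t_\psi-\delta_\psi)^2\,\min_{y\in\Omega'}Q(\mathbb{B}_{\frac{\delta_\psi\varepsi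lon}{8L}}(y))}{8\Lambda_P^2\,\gamma(n,\varepsilon)\,\Bigl\lceil\frac{16L\,\mathrm{diam}(\Omega)}{\delta_\psi\varepsilon}\Bigr\rceil^{d+2}}.$$
   Context: Standing regularization assumption: $\phi:[0,\infty)\to\mathbb{R}$ is strictly convex with $\phi(x)/x\to\infty$ as $x\to\infty$; its conjugate $\psi(y)=\sup_{x\ge0}\{xy-\phi(x)\}$ belongs to $\mathcal{C}^1(\mathbb{R})$, satisfies $\psi'(x)\to\infty$ as $x\to\infty$, and there exist $t_\psi>0$, $\delta_\psi>0$ with $\psi'(t_\psi)=1$ and $\psi$ strictly convex on $[t_\psi-\delta_\psi,\infty)$. (Then $\phi$ is differentiable on $[1,\infty)$ and $\phi'(1)=t_\psi$.) Regularized problem with marginals $(\mu,\nu)$: $\inf_{\pi\in\Pi(\mu,\nu)}\int c\,d\pi+\varepsilon\int\phi\bigl(\frac{d\pi}{d(\mu\otimes\nu)}\bigr)d(\mu\otimes\nu)$, where $\Pi(\mu,\nu)$ is the set of couplings (value $+\infty$ if $\pi\not\ll\mu\otimes\nu$). $\rho_\varepsilon=\frac{d\pi_\varepsilon}{d(P\otimes Q)}$ is the density of its unique optimizer $\pi_\varepsilon$ for $(P,Q)$. Sampling: $X_1,\dots,X_n,Y_1,\dots,Y_n$ are independent with $X_i\sim P$, $Y_j\sim Q$; $\widehat P=\frac1n\sum_i\delta_{X_i}$, $\widehat Q=\frac1n\sum_j\delta_{Y_j}$. Potentials for $(\mu,\nu)$: bounded measurable $f:\Omega\to\mathbb{R}$,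 $g:\Omega'\to\mathbb{R}$ with $$\int\psi'\Bigl(\tfrac{f(x)+g(y)-c(x,y)}{\varepsilon}\Bigr)d\nu(y)=1\ \ \forall x\in\Omega,\qquad \int\psi'\Bigl(\tfrac{f(x)+g(y)-c(x,y)}{\varepsilon}\Bigr)d\mu(x)=1\ \ \forall y\in\Omega',$$ normalized by $\int f\,d\mu=0$. $(f_\varepsilon,g_\varepsilon)$ are the potentials for $(P,Q)$ and $(\widehat f,\widehat g)$ is a fixed measurable (in the sample) choice of potentials for $(\widehat P,\widehat Q)$. Notation: $(u\oplus v)(x,y)=u(x)+v(y)$; $\mathbb{B}_r(x)$ is the open Euclidean ball; $\|c\|_\infty=\sup_{\Omega\times\Omega'}|c|$. *)

(* Defs.v *)
From HB Require Import structures.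
From mathcomp Require Import all_boot all_order all_algebra.
From mathcomp Require Import all_classical all_reals all_analysis.

Set Implicit Arguments.
Unset Strict Implicit.
Unset Printing Implicit Defensive.

Import Order.TTheory GRing.Theory Num.Theory.
Import numFieldNormedType.Exports.

Local Open Scope classical_set_scope.
Local Open Scope ring_scope.

(* The sigma-algebra on 'rV[R]_d generated by the coordinates;
   [measurable_rVE] shows that it is the Borel sigma-algebra. *)
Definition rV_display : measure_display. Proof. exact: default_measure_display. Qed.

Definition rV_cylinders (R : realType) (d : nat) : set (set 'rV[R]_d) :=
  [set C | exists i : 'I_d, exists2 B : set R,
     measurable B & C = [set x : 'rV[R]_d | B (x 0 i)]].

Section rV_measurable.
Context (R : realType) (d : nat).

Let rV_meas : set (set 'rV[R]_d) := <<s @rV_cylinders R d >>.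

Let rV_meas0 : rV_meas set0. Proof. exact: sigma_algebra0. Qed.

Let rV_measC A : rV_meas A -> rV_meas (~` A).
Proof. exact: sigma_algebraC. Qed.

Let rV_meas_bigcup (F : _^nat) : (forall i, rV_meas (F i)) ->
  rV_meas (\bigcup_i (F i)).
Proof. exact: sigma_algebra_bigcup. Qed.

HB.instance Definition _ := @isMeasurable.Build rV_display
  'rV[R]_d rV_meas rV_meas0 rV_measC rV_meas_bigcup.

End rV_measurable.

Section rV_theory.
Context (R : realType) (d : nat).

Lemma measurable_coord (i : 'I_d) :
  measurable_fun [set: 'rV[R]_d] (fun x => x 0 i).
Proof.
move=> _ B mB; rewrite setTI; apply: sub_sigma_algebra.
by exists i, B.
Qed.

Lemma measurable_fun_rV d' (T : measurableType d') (f : T -> 'rV[R]_d) :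
  (forall i, measurable_fun setT (fun t => f t 0 i)) -> measurable_fun setT f.
Proof.
move=> mf; apply: (@measurability _ _ _ _ _ f (@rV_cylinders R d)) => //.
move=> _ [C [i [B mB ->]] <-]; rewrite setTI.
by rewrite -[X in measurable X]setTI; exact: mf.
Qed.

Lemma open_measurable_rV (A : set 'rV[R]_d) : open A -> measurable A.
Proof.
move=> oA.
pose box (p : 'rV[rat]_d * nat) : set 'rV[R]_d :=
  [set x | forall i, `|x 0 i - ratr (p.1 0 i)| < p.2.+1%:R^-1].
have mbox p : measurable (box p).
  have -> : box p = \bigcap_(i in [set: 'I_d])
      [set x : 'rV[R]_d | `|x 0 i - ratr (p.1 0 i)| < p.2.+1%:R^-1].
    by apply/seteqP; split=> x /= xp i; [move=> _|]; exact: xp.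
  apply: fin_bigcap_measurable => // i _.
  have := @measurable_coord i measurableT
    `](ratr (p.1 0 i) - p.2.+1%:R^-1), (ratr (p.1 0 i) + p.2.+1%:R^-1)[%classic
    (measurable_itv _).
  rewrite setTI; congr (measurable _).
  by apply/seteqP; split=> x /=; rewrite in_itv/= ltr_distl.
pose D := [set p | box p `<=` A].
have -> : A = \bigcup_(p in D) box p.
  apply/seteqP; split=> [x Ax|x [p pA]]; last exact: pA.
  have /nbhs_ballP[e /= e0 xeA] : nbhs x A by exact: open_nbhs_nbhs.
  pose k := Num.trunc (2 / e).
  have ke : 2 * k.+1%:R^-1 < e.
    by rewrite ltr_pdivrMr// mulrC -ltr_pdivrMr// truncnS_gt.
  have /choice[q xq] (i : 'I_d) :
      exists q : rat, `|x 0 i - ratr q| < k.+1%:R^-1.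
    have [|q] := @rat_in_itvoo R (x 0 i - k.+1%:R^-1) (x 0 i + k.+1%:R^-1).
      by rewrite ltrD2l gtrN// invr_gt0.
    by rewrite in_itv/= => qx; exists q; rewrite ltr_distlC.
  exists (\row_i q i, k) => [y|i]/=; last by rewrite mxE.
  move=> yq; apply: xeA; split=> // i j; rewrite (ord1 i) /ball/=.
  apply: lt_trans ke; rewrite mulrC mulr_natr.
  have := yq j; rewrite /= mxE distrC => yqj.
  by rewrite (le_lt_trans (ler_distD (ratr (q j)) _ _))// mulr2n ltrD.
rewrite bigcup_mkcond; apply: countable_bigcupT_measurable => //.
by move=> p; case: ifP.
Qed.

Lemma measurable_rVE :
  measurable = <<s @open 'rV[R]_d >> :> set (set 'rV[R]_d).
Proof.
apply/seteqP; split; last first.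
  apply: smallest_sub; first exact: sigma_algebra_measurable.
  exact: open_measurable_rV.
apply: smallest_sub; first exact: smallest_sigma_algebra.
move=> _ [i [B mB ->]].
pose T := g_sigma_algebraType (@open 'rV[R]_d).
have mi : measurable_fun [set: T] (fun x : T => (x : 'rV[R]_d) 0 i).
  apply: (measurability _ (measurable_realfun.RGenOInfty.measurableE R)) => // _ [_ [x ->] <-].
  rewrite setTI; apply: sub_sigma_algebra.
  apply: open_comp; last exact: interval_open.
  by move=> ? _; exact: coord_continuous.
by have := mi measurableT B mB; rewrite setTI.
Qed.

End rV_theory.

Section lebesgue_rV.
Context (R : realType).

Definition consrV (d : nat) (p : 'rV[R]_d * measurableTypeR R) : 'rV[R]_d.+1 :=
  \row_i (if unlift ord0 i is Some j then p.1 0 j else p.2).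

Lemma measurable_consrV d : measurable_fun setT (@consrV d).
Proof.
apply: measurable_fun_rV => i.
case: (unliftP ord0 i) => [j|] ->.
  rewrite (_ : (fun _ => _) = (fun x : 'rV[R]_d => x 0 j) \o fst).
    by apply: measurableT_comp => //; exact: measurable_coord.
  by apply/funext => p; rewrite mxE liftK.
rewrite (_ : (fun _ => _) = snd); first exact: measurable_snd.
by apply/funext => p; rewrite mxE unlift_none.
Qed.

Section cons.
Context (d : nat) (m : {measure set 'rV[R]_d -> \bar R}).

Definition lebesgue_consrV : set 'rV[R]_d.+1 -> \bar R :=
  pushforward (m \x (@lebesgue_measure R))%E (@consrV d).

HB.instance Definition _ := Measure.copy lebesgue_consrV
  (measure_function_pushforward__canonical__measure_function_Measure
    (m \x (@lebesgue_measure R))%E (measurable_consrV (d := d))).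

End cons.

(* d-dimensional Lebesgue measure, as an iterated product *)
Fixpoint lebesgue_rV (d : nat) : {measure set 'rV[R]_d -> \bar R} :=
  match d with
  | 0 => \d_(0 : 'rV[R]_0)
  | d.+1 => lebesgue_consrV (lebesgue_rV d)
  end.

Lemma lebesgue_rV_box d (B : 'I_d -> set R) :
  (forall i, measurable (B i)) ->
  lebesgue_rV d [set x | forall i, B i (x 0 i)] =
  (\prod_(i < d) lebesgue_measure (B i))%E.
Proof.
elim: d B => [|d IHd] B mB.
  rewrite big_ord0 /= diracE mem_set//.
  by case.
rewrite big_ord_recl muleC -IHd//= /lebesgue_consrV /pushforward.
have mB' : measurable [set x : 'rV[R]_d | forall i, B (lift ord0 i) (x 0 i)].
  rewrite (_ : [set _ | _] = \bigcap_(i in [set: 'I_d])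
      [set x : 'rV[R]_d | B (lift ord0 i) (x 0 i)]).
    apply: fin_bigcap_measurable => // i _.
    by rewrite -[X in measurable X]setTI; apply: measurable_coord.
  by apply/seteqP; split=> x /= xB i; [move=> _|]; exact: xB.
rewrite -product_measure1E; [|exact: mB'|exact: mB].
congr product_measure1; apply/seteqP; split=> -[v t] /=.
- move=> vtB; split=> [i|].
    by have := vtB (lift ord0 i); rewrite /consrV mxE liftK.
  by have := vtB ord0; rewrite /consrV mxE unlift_none.
- move=> [vB tB] i; rewrite /consrV mxE.
  by case: (unliftP ord0 i) => [j|] ->.
Qed.

End lebesgue_rV.

Section euclidean.
Context (R : realType) (d : nat).
Implicit Types (x y : 'rV[R]_d) (A : set 'rV[R]_d).

(* The library norm on matrices is the max norm. *)
Definition enorm x : R := Num.sqrt (\sum_(i < d) x 0 i ^+ 2).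

Definition eball x (r : R) : set 'rV[R]_d := [set y | enorm (y - x) < r].

Definition ediam A : R :=
  sup [set enorm (p.1 - p.2) | p in A `*` A].

(* The product of Euclidean spaces carries the Euclidean norm. *)
Definition lipschitz_cost (L : R) (A B : set 'rV[R]_d)
    (c : 'rV[R]_d -> 'rV[R]_d -> R) :=
  forall x x' y y', A x -> A x' -> B y -> B y' ->
    `|c x y - c x' y'| <=
    L * Num.sqrt (enorm (x - x') ^+ 2 + enorm (y - y') ^+ 2).

Definition msupport (mu : set 'rV[R]_d -> \bar R) : set 'rV[R]_d :=
  [set x | forall U, open U -> U x -> (0 < mu U)%E].

Definition min_ball_mass (mu : set 'rV[R]_d -> \bar R) A (r : R) : R :=
  inf [set fine (mu (eball x r)) | x in A].

Definition has_lebesgue_density (mu : set 'rV[R]_d -> \bar R)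
    (rho : 'rV[R]_d -> R) :=
  [/\ measurable_fun setT rho, (forall x, 0 <= rho x) &
    forall A, measurable A ->
      mu A = (\int[@lebesgue_rV R d]_(x in A) (rho x)%:E)%E].

End euclidean.

Definition strictly_convex_on (R : realType) (A : set R) (h : R -> R) :=
  forall x y t : R, A x -> A y -> x != y -> 0 < t < 1 ->
    h (t * x + (1 - t) * y) < t * h x + (1 - t) * h y.

Section regularization.
Context (R : realType).
Implicit Types (phi psi ddpsi : R -> R) (t delta : R).

(* [phi] is only relevant on [0, +oo[ *)
Definition conjugate phi (y : R) : R :=
  sup [set x * y - phi x | x in [set x : R | 0 <= x]].

Record regularizer phi t delta : Prop := {
  reg_convex : strictly_convex_on [set x | 0 <= x] phi ;
  reg_superlinear : phi x / x @[x --> +oo] --> +oo ;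
  reg_derivable : forall y : R, derivable (conjugate phi) y 1 ;
  reg_C1 : continuous (derive1 (conjugate phi)) ;
  reg_dconj : derive1 (conjugate phi) y @[y --> +oo] --> +oo ;
  reg_t_gt0 : 0 < t ;
  reg_delta_gt0 : 0 < delta ;
  reg_t : derive1 (conjugate phi) t = 1 ;
  reg_conj_convex :
    strictly_convex_on [set y | t - delta <= y] (conjugate phi) }.

(* [psi] is C^{1,1}_loc, and [ddpsi] is a nondecreasing, everywhere defined
   representative of its almost everywhere second derivative *)
Record C11loc_with psi ddpsi : Prop := {
  C11_lipschitz : forall M : R, exists K : R, forall x y : R,
    `|x| <= M -> `|y| <= M -> `|derive1 psi x - derive1 psi y| <= K * `|x - y| ;
  C11_deriv : {ae lebesgue_measure, forall x : R,
    is_derive x 1 (derive1 psi) (ddpsi x)} ;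
  C11_bounded : forall M : R, exists K : R,
    {ae lebesgue_measure, forall x : R, `|x| <= M -> `|ddpsi x| <= K} ;
  C11_monotone : {homo ddpsi : x y / x <= y} }.

End regularization.

Section transport.
Context (R : realType) (d : nat).
Local Notation E := 'rV[R]_d.
Implicit Types (P Q : probability E R) (c : E -> E -> R).

Definition sup_norm_on (A B : set E) c : R :=
  sup [set `|c p.1 p.2| | p in A `*` B].

Definition coupling P Q (pi : probability (E * E)%type R) :=
  (forall A, measurable A -> pi (A `*` setT) = P A) /\
  (forall B, measurable B -> pi (setT `*` B) = Q B).

Local Open Scope charge_scope.

Definition product_law P Q : probability (E * E)%type R := (P \x Q)%E.

Definition coupling_density P Q (pi : probability (E * E)%type R) : E * E -> R :=
  fine \o 'd (charge_of_finite_measure pi) '/d (product_law P Q).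

(* [c] is only meaningful on [A `*` B], which carries the couplings
   of [P] and [Q] when [A] and [B] are their supports *)
Definition rot_cost (A B : set E) c (phi : R -> R) (eps : R) P Q
    (pi : probability (E * E)%type R) : \bar R :=
  if `[< pi `<< product_law P Q >] then
    (\int[pi]_(z in A `*` B) (c z.1 z.2)%:E +
     eps%:E * \int[product_law P Q]_z (phi (coupling_density P Q pi z))%:E)%E
  else +oo%E.

Definition rot_optimizer (A B : set E) c phi eps P Q pi :=
  coupling P Q pi /\
  forall pi', coupling P Q pi' ->
    (rot_cost A B c phi eps P Q pi <= rot_cost A B c phi eps P Q pi')%E.

Record potentials (A B : set E) c (dpsi : R -> R) (eps : R)
    (mu nu : set E -> \bar R) (f g : E -> R) : Prop := {
  pot_measl : measurable_fun A f ;
  pot_measr : measurable_fun B g ;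
  pot_bndl : exists M : R, forall x, A x -> `|f x| <= M ;
  pot_bndr : exists M : R, forall y, B y -> `|g y| <= M ;
  pot_eql : forall x, A x ->
    (\int[nu]_(y in B) (dpsi ((f x + g y - c x y) / eps))%:E = 1)%E ;
  pot_eqr : forall y, B y ->
    (\int[mu]_(x in A) (dpsi ((f x + g y - c x y) / eps))%:E = 1)%E ;
  pot_norm : (\int[mu]_(x in A) (f x)%:E = 0)%E }.

Definition empirical n (s : n.-tuple E) : set E -> \bar R :=
  mscale (n%:R^-1)%:nng (msum (fun i => \d_(s`_i)) n).

HB.instance Definition _ n (s : n.-tuple E) := Measure.on (empirical s).

Lemma empirical_fin n (s : n.-tuple E) : fin_num_fun (empirical s).
Proof.
move=> U mU; rewrite /empirical /mscale/= /msum fin_numM//.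
by rewrite sum_fin_num; apply/allP => _ /mapP[i _ ->].
Qed.

HB.instance Definition _ n (s : n.-tuple E) :=
  Measure_isFinite.Build _ _ _ (empirical s) (@empirical_fin n s).

Definition samples_in n (A B : set E) : set (n.-tuple E * n.-tuple E) :=
  [set s | forall i, A (tnth s.1 i) /\ B (tnth s.2 i)].

(* Taking some [A i], [B j] to be [setT] gives the product rule for every
   finite subfamily of (X_0, X_1, ..., Y_0, Y_1, ...). *)
Definition independent_samples d' (W : measurableType d')
    (Pr : probability W R) P Q (X Y : nat -> {mfun W >-> E}) :=
  [/\ forall i A, measurable A -> Pr (X i @^-1` A) = P A,
      forall j B, measurable B -> Pr (Y j @^-1` B) = Q B &
      forall n (A B : nat -> set E),
        (forall i, measurable (A i)) -> (forall j, measurable (B j)) ->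
        (Pr [set w | forall i, (i < n)%N -> A i (X i w) /\ B i (Y i w)] =
         (\prod_(i < n) Pr (X i @^-1` A i)) *
         (\prod_(j < n) Pr (Y j @^-1` B j)))%E].

End transport.

(* Main.v *)
Require Import Defs.
From HB Require Import structures.
From mathcomp Require Import all_boot all_order all_algebra.
From mathcomp Require Import all_classical all_reals all_analysis.
From mathcomp Require Import ring lra measurable_realfun.

Set Implicit Arguments.
Unset Strict Implicit.
Unset Printing Implicit Defensive.

Import Order.TTheory GRing.Theory Num.Theory.
Import numFieldNormedType.Exports.

Local Open Scope classical_set_scope.
Local Open Scope ring_scope.

(* Since psi' is monotone, subtracting the optimality systems of the empirical
   and of the population potentials and testing with their difference (u, v)
   bounds a quadratic form sum_ij w_ij (u_i + v_j)^2 by the pairing of (u, v)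
   with the marginal defects, on the sample, of the population plan. These
   defects are averages of centred independent terms, whence the factor Var / n.

   The form is coercive. Its weights are bounded below where the empirical
   exponent exceeds t_psi - 3 delta_psi / 4. As exponents are Lipschitz, two
   neighbouring points X_i, X_i' have many such Y_j in common, so that the form
   controls u_i - u_i'; a Poincare inequality spreads this to all pairs. For P it
   is proved by cutting the segment from x to x' into K steps, the pair of
   consecutive points having a density controlled by the Jacobian K^-d. It passes
   to the sample as soon as the empirical frequencies of finitely many cells and
   balls, at scale r = delta_psi eps / (8 L), are within a third of their
   expectations. Otherwise the error is at most 4 kappa^2, and by Chebyshev's
   inequality this contributes kappa^2 / n times the sum of the inverse masses of
   these sets, which is O(eps^(-2d)) = O(mP^-2), up to mQ^-2. *)

(** * The conjugate of the regularizer *)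

(** The constants come from spending [delta] in quarters. Each row and each column of the empirical
    plan has an exponent at least [t], because its density has mean 1 there. Moving a point by [r]
    changes an exponent by at most [delta / 4]: one quarter pays for the step from a point [x i] to
    a neighbour, two for a ball of radius [2 r] around some [y j]. The last quarter serves to
    compare the two plans. Nothing places the population exponent where psi'' is at least
    [ddpsi (t - delta)]; it is only known to be within [2 kappa / eps], up to the cost, which
    cancels. The slope is therefore used on an initial fraction of the segment issued from the
    empirical exponent, monotonicity doing the rest; this fraction is the source of the maximum of
    [2^6 kappa^2 / delta^2] and 1.

    The variance appears only once the optimal density is identified with psi' of the population
    exponent. This is done by duality: up to a constant, the cost of a coupling is [eps] times the
    integral of its Fenchel-Young gap, and mixtures of the plan of the potentials with the product
    measure make that integral arbitrarily small. *)

Section real_analysis.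
Context {R : realType}.
Implicit Types F : R -> R.

Lemma derivable_approx F (a l : R) : is_derive a 1 F l -> forall e, 0 < e ->
  exists2 del, 0 < del &
    forall h, `|h| < del -> `|F (a + h) - F a - l * h| <= e * `|h|.
Proof.
move=> [dF Fl] e e0.
have cF : h^-1 *: (F (h *: 1 + a) - F a) @[h --> 0^'] --> l.
  by rewrite -Fl; exact: dF.
have /cvgrPdist_le/(_ e e0) := cF.
rewrite /dnbhs /within /= => /nbhs_ballP[del /= del0 H].
exists del => // h hdel.
have [->|h0] := eqVneq h 0; first by rewrite addr0 subrr mulr0 subrr normr0 mulr0.
have := H h; rewrite /ball /= sub0r normrN => /(_ hdel h0) H1.
have -> : F (a + h) - F a - l * h = - ((l - h^-1 *: (F (h *: 1 + a) - F a)) * h).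
  rewrite /GRing.scale /= mulr1 (addrC h a); field.
  by [].
by rewrite normrN normrM ler_wpM2r.
Qed.

Lemma derivable_is_derive F (a : R) : derivable F a 1 -> is_derive a 1 F (derive1 F a).
Proof. by move=> dF; rewrite derive1E; exact: derivableP. Qed.

(** If the slopes differed, [F] would pass below the line on one side of [a]. This reads a value of
    psi' off a case of equality in Fenchel's inequality. *)
Lemma is_derive_tangent_eq F (a l s : R) : is_derive a 1 F l ->
  (exists2 r, 0 < r & forall z, `|z - a| < r -> F a + s * (z - a) <= F z) -> s = l.
Proof.
move=> dF [r r0 Fs]; apply/eqP; rewrite -subr_eq0; apply/negPn/negP => sl.
have e0 : 0 < `|s - l| / 2 by rewrite divr_gt0// normr_gt0.
have [del del0 H] := derivable_approx dF e0.
pose m := Num.min r del / 2.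
have m0 : 0 < m by rewrite divr_gt0// lt_min r0.
have mr : m < r by rewrite /m ltr_pdivrMr// gt_min mulr_natr mulr2n ltrDl r0.
have mdel : m < del.
  by rewrite /m ltr_pdivrMr// gt_min mulr_natr mulr2n ltrDl del0 orbT.
have nm : `|m| = m by rewrite gtr0_norm.
have := H m; have := H (- m); rewrite normrN nm.
move=> /(_ mdel) + /(_ mdel).
have := Fs (a + m); have := Fs (a - m).
rewrite !(addrC a) !addrK normrN nm => /(_ mr) + /(_ mr).
rewrite !ler_norml => f1 f2 /andP[f3 f4] /andP[f5 f6].
have : (s - l) * m <= `|s - l| / 2 * m by lra.
have : - ((s - l) * m) <= `|s - l| / 2 * m by lra.
have : `|s - l| * m = `|(s - l) * m| by rewrite normrM nm.
have : 0 < `|s - l| * m by rewrite mulr_gt0 ?normr_gt0.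
by case: (ger0P ((s - l) * m)); lra.
Qed.

Lemma nondecreasing_is_derive_ge0 F (a l : R) : {homo F : x y / x <= y} ->
  is_derive a 1 F l -> 0 <= l.
Proof.
move=> F_nd dF; rewrite leNgt; apply/negP => l0.
have e0 : 0 < - l / 2 by lra.
have [del del0 H] := derivable_approx dF e0.
have := H (del / 2); rewrite gtr0_norm; last by lra.
have -> : del / 2 < del by lra.
move=> /(_ isT); rewrite ler_norml => /andP[_].
have : F a <= F (a + del / 2) by apply: F_nd; lra.
by nra.
Qed.

(** Convexity is assumed along the single segment from [y] to [z], so that the lemma applies to
    [phi], convex on the half-line only, as well as to its conjugate. *)
Lemma convex_tangent F (l y z : R) :
  (forall s, 0 < s < 1 -> F (y + s * (z - y)) <= F y + s * (F z - F y)) ->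
  is_derive y 1 F l -> F y + l * (z - y) <= F z.
Proof.
move=> cF dF; have [->|zy] := eqVneq z y; first by rewrite subrr mulr0 addr0.
rewrite leNgt; apply/negP => Fz.
have zy0 : 0 < `|z - y| by rewrite normr_gt0 subr_eq0.
set eta := (F y + l * (z - y) - F z).
have eta0 : 0 < eta by rewrite subr_gt0.
have e0 : 0 < eta / (2 * `|z - y|) by rewrite divr_gt0// mulr_gt0.
have [del del0 H] := derivable_approx dF e0.
pose s := Num.min (1 / 2) (del / (2 * `|z - y|)).
have s0 : 0 < s by rewrite lt_min !divr_gt0// mulr_gt0.
have s1 : s < 1 by rewrite /s gt_min; apply/orP; left; lra.
have sd : s * `|z - y| < del.
  apply: (@le_lt_trans _ _ (del / (2 * `|z - y|) * `|z - y|)).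
    by rewrite ler_wpM2r// ge_min lexx orbT.
  by rewrite invfM mulrA mulfVK ?gt_eqF//; lra.
have := H (s * (z - y)); rewrite normrM (gtr0_norm s0) => /(_ sd).
have -> : eta / (2 * `|z - y|) * (s * `|z - y|) = eta / 2 * s.
  by field; rewrite gt_eqF.
rewrite ler_norml => /andP[].
have := cF s; rewrite s0 s1 => /(_ isT).
have -> : F z = F y + l * (z - y) - eta by rewrite /eta; ring.
by nra.
Qed.

(* A null set of bad points is covered by an open set [U] of small measure;
   [F] grows at rate at least [h - eta] up to a loss bounded by the Lipschitz
   constant times the length of [U] already crossed. *)
Lemma lipschitz_ae_derive_ge F (l : R -> R) (a b K h : R) : a <= b ->
  (forall x y, a <= x -> x <= y -> y <= b -> `|F x - F y| <= K * `|x - y|) ->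
  {ae lebesgue_measure, forall x : R, is_derive x 1 F (l x)} ->
  (forall x, a <= x -> h <= l x) ->
  h * (b - a) <= F b - F a.
Proof.
move=> ab FK [N [mN N0 Nbad]] hl.
have K0 : 0 <= K \/ a = b.
  have [->|nab] := eqVneq a b; [by right|left].
  have ab' : a < b by rewrite lt_neqAle nab.
  have := FK a b (lexx a) ab (lexx b).
  have : 0 < `|a - b| by rewrite normr_gt0 subr_eq0.
  move: (normr_ge0 (F a - F b)) => ? ? ?.
  by rewrite -(@pmulr_lge0 _ `|a - b|)//; lra.
have [K0'|->] := K0; last by rewrite !subrr mulr0.
apply/ler_addgt0Pl => e0 e0_gt0.
(* The final loss is [eta] times [b - a], for the reduced rate, plus [eta] times [K + |h|], for the
   length of [U]; the 1 keeps [C] positive. *)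
pose C := (b - a) + (K + `|h|) + 1.
have C0 : 0 < C by rewrite /C; have := normr_ge0 h; lra.
pose eta := e0 / C.
have eta0 : 0 < eta by rewrite divr_gt0.
have [|U [oU NU Ueta]] := lebesgue_regularity_outer mN _ eta0.
  by apply: (@le_lt_trans _ _ 0%E); [rewrite le_eqVlt; apply/orP; left; apply/eqP; exact: N0|rewrite ltry].
have mU : measurable U by exact: measurable_realfun.open_measurable.
have {Ueta} Ueta : (lebesgue_measure U < eta%:E)%E.
  apply: le_lt_trans Ueta.
  rewrite -[X in (lebesgue_measure X <= _)%E](setDUK NU).
  rewrite (le_trans (measureU2 _ _ _))//; first exact: measurableD.
  by rewrite [X in (X + _)%E]N0 add0e.
pose g x := fine (lebesgue_measure (U `&` `]a, x]%classic)).
have mUx x : measurable (U `&` `]a, x]%classic) by exact: measurableI.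
have Ufin x : (lebesgue_measure (U `&` `]a, x]%classic) <= lebesgue_measure U)%E.
  by apply: le_measure => //; rewrite ?inE//; exact: measurableI.
have gE x : (g x)%:E = lebesgue_measure (U `&` `]a, x]%classic).
  rewrite /g fineK// ge0_fin_numE//.
  by apply: le_lt_trans (Ufin x) _; apply: lt_trans Ueta _; rewrite ltry.
have g0 x : 0 <= g x by rewrite -lee_fin gE.
have geta x : g x <= eta.
  by rewrite -lee_fin gE; apply: le_trans (Ufin x) (ltW Ueta).
have gnd x y : x <= y -> g x <= g y.
  move=> xy; rewrite -lee_fin !gE; apply: le_measure; rewrite ?inE.
  - exact: mUx.
  - exact: mUx.
  apply: setIS => z /=; rewrite !in_itv/= => /andP[-> zx]/=; exact: le_trans zx xy.
have gadd x y : a <= x -> x <= y -> (`]x, y]%classic `<=` U) ->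
    g x + (y - x) <= g y.
  move=> ax xy xyU.
  have := @lebesgue_measure_itv R `]x, y].
  rewrite /= lte_fin; case: ltP => [xy'|yx _]; last first.
    by have -> : y = x by [apply/eqP; rewrite eq_le xy yx]; rewrite subrr addr0.
  move=> lxy; rewrite -lee_fin EFinD !gE EFinB -lxy -measureU//.
  - apply: le_measure; rewrite ?inE; [apply: measurableU; [exact: mUx|exact: measurable_itv]|exact: mUx|].
    move=> z [[Uz]|xzy]/=; rewrite !in_itv/=.
      by move=> /andP[az zx]; split => //; rewrite az (le_trans zx xy).
    split; first exact: xyU.
    by move: xzy => /=; rewrite in_itv/= => /andP[xz ->]; rewrite (le_lt_trans ax xz).
  - exact: mUx.
  - rewrite -subset0 => z [[_]]/=; rewrite !in_itv/= => /andP[_ zx] /andP[xz _].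
    by have := lt_le_trans xz zx; rewrite ltxx.
(* Continuation argument: the estimate holds at [a], passes to the supremum by the Lipschitz bound,
   and extends to the right of every point; inside [U] because [g] grows there at unit rate, outside
   because [l s] is the derivative. *)
pose S := [set x | a <= x <= b /\
  (h - eta) * (x - a) - (K + `|h|) * g x <= F x - F a].
have Sa : S a.
  split; first by rewrite lexx ab.
  rewrite !subrr mulr0 sub0r oppr_le0 mulr_ge0//.
  by rewrite addr_ge0.
have hS : has_sup S.
  by split; [exists a | exists b => x [/andP[]]].
pose s := sup S.
have as_ : a <= s by apply: ub_le_sup => //; case: hS.
have sb : s <= b by apply: ge_sup => [|x [/andP[]//]]; exists a.
have Ss : S s.
  split; first by rewrite as_ sb.
  apply/ler_addgt0Pl => e e_0.
  pose e1 := e / (K + `|h - eta| + 1).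
  have D0 : 0 < K + `|h - eta| + 1 by have := normr_ge0 (h - eta); lra.
  have e1_0 : 0 < e1 by rewrite divr_gt0.
  have [x Sx xs] := sup_adherent e1_0 hS; rewrite -/s in xs.
  have xs' : x <= s by apply: ub_le_sup => //; case: hS.
  case: Sx => /andP[ax xb] Sx.
  have := FK x s ax xs' sb; rewrite (distrC x s) (ger0_norm (_ : 0 <= s - x)) ?subr_ge0//.
  rewrite ler_norml => /andP[_ F1].
  have gxs := gnd _ _ xs'.
  have : (h - eta) * (s - x) <= `|h - eta| * (s - x).
    by rewrite ler_wpM2r ?subr_ge0// ler_norm.
  have : (K + `|h|) * g x <= (K + `|h|) * g s.
    by rewrite ler_wpM2l// addr_ge0.
  have : (K + `|h - eta|) * (s - x) <= e.
    have : s - x <= e1 by lra.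
    rewrite /e1 ler_pdivlMr//; have : 0 <= s - x by lra.
    by nra.
  by nra.
have sbE : s = b.
  apply/eqP; rewrite eq_le sb/= leNgt; apply/negP => sltb.
  suff [x [sx xb Sx]] : exists x, [/\ s < x, x <= b &
      (h - eta) * (x - s) - (K + `|h|) * (g x - g s) <= F x - F s].
    have : S x.
      split; first by rewrite xb andbT (le_trans as_)// ltW.
      by case: Ss => _; nra.
    move=> /(ub_le_sup (proj2 hS)); rewrite -/s => /(lt_le_trans sx).
    by rewrite ltxx.
  have [Us|nUs] := pselect (U s).
    have /nbhs_ballP[del /= del0 sU] : nbhs s U by exact: open_nbhs_nbhs.
    pose x := Num.min b (s + del / 2).
    have sx : s < x by rewrite lt_min sltb; lra.
    exists x; split => //; first by rewrite ge_min lexx.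
    have xb : x <= b by rewrite ge_min lexx.
    have : g s + (x - s) <= g x.
      apply: gadd => //; first exact: ltW.
      move=> z /=; rewrite in_itv/= => /andP[sz zx]; apply: sU.
      rewrite /ball/= ltr0_norm; last by lra.
      have : x <= s + del / 2 by rewrite ge_min lexx orbT.
      by lra.
    have := FK s x as_ (ltW sx) xb; rewrite distrC (distrC s x).
    rewrite (gtr0_norm (_ : 0 < x - s)) ?subr_gt0// ler_norml => /andP[F1 _] gx.
    have : (K + `|h|) * (x - s) <= (K + `|h|) * (g x - g s).
      by rewrite ler_wpM2l ?addr_ge0//; lra.
    have : h * (x - s) <= `|h| * (x - s) by rewrite ler_wpM2r ?ler_norm//; lra.
    have : 0 <= eta * (x - s) by rewrite mulr_ge0 ?ltW//; lra.
    by nra.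
  have ds : is_derive s 1 F (l s).
    by apply: contrapT => nds; apply: nUs; apply: NU; apply: Nbad.
  have [del del0 H] := derivable_approx ds eta0.
  pose x := Num.min b (s + del / 2).
  have sx : s < x by rewrite lt_min sltb; lra.
  exists x; split => //; first by rewrite ge_min lexx.
  have xd : x <= s + del / 2 by rewrite ge_min lexx orbT.
  have := H (x - s); rewrite (gtr0_norm (_ : 0 < x - s)) ?subr_gt0//.
  rewrite addrCA subrr addr0 => /(_ _)/wrap[]; first by lra.
  rewrite ler_norml => /andP[F1 _].
  have := hl s as_ => hls.
  have : h * (x - s) <= l s * (x - s) by rewrite ler_wpM2r// subr_ge0 ltW.
  have : 0 <= (K + `|h|) * (g x - g s).
    by apply: mulr_ge0; [exact: addr_ge0|rewrite subr_ge0; apply: gnd; exact: ltW].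
  by nra.
case: Ss => _; rewrite sbE => H.
have : (K + `|h|) * g b <= (K + `|h|) * eta by rewrite ler_wpM2l ?addr_ge0.
have : eta * C = e0 by rewrite /eta mulfVK// gt_eqF.
rewrite /C.
by nra.
Qed.

End real_analysis.

Section conjugate.
Context {R : realType} (phi : R -> R) (t delta : R).
Hypothesis reg : regularizer phi t delta.
Local Notation psi := (conjugate phi).
Local Notation dpsi := (derive1 (conjugate phi)).

(** Beyond some [M], superlinearity makes the terms nonpositive. Before [M], convexity bounds [phi]
    from below by the line through its values at [M] and [M + 1]. *)
Lemma conjugate_has_sup y :
  has_sup [set x * y - phi x | x in [set x : R | 0 <= x]].
Proof.
split; first by exists (0 * y - phi 0), 0 => /=.
have /cvgryPge/(_ y) := reg_superlinear reg.
move=> /(pinfty_ex_gt (ltr0_real (ltrN10 R)))[M0 _].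
have /cvgryPge/(_ y) := reg_superlinear reg.
move=> [M1 [_ HM]] _.
pose M := Num.max 0 M1 + 1.
have M_0 : 0 < M by rewrite ltr_wpDl// le_max lexx.
have M_1 : M1 < M by rewrite ltr_pwDr// le_max lexx orbT.
pose B := M * `|y| + (M + 1) * `|phi M| + M * `|phi (M + 1)|.
exists B => _ [x /= x0 <-].
have B0 : 0 <= B by rewrite !addr_ge0// mulr_ge0//; lra.
have [Mx|xM] := ltP M x.
  have := HM x (lt_trans M_1 Mx) => /=.
  rewrite ler_pdivlMr; last by lra.
  by nra.
have [->|xM'] := eqVneq x M.
  have := ler_norm y; have := ler_norm (- phi M); rewrite normrN /B.
  by have := normr_ge0 (phi (M + 1)); have := normr_ge0 (phi M); nra.
have xltM : x < M by rewrite lt_neqAle xM' xM.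
have D0 : 0 < M + 1 - x by lra.
pose s := (M + 1 - x)^-1.
have s0 : 0 < s by rewrite invr_gt0.
have s1 : s < 1 by rewrite invf_lt1//; lra.
have M1_0 : 0 <= M + 1 by lra.
have xM1 : x != M + 1 by rewrite lt_eqF//; lra.
have s01 : 0 < s < 1 by rewrite s0.
have := reg_convex reg x0 M1_0 xM1 s01.
have -> : s * x + (1 - s) * (M + 1) = M.
  by rewrite /s; field; rewrite gt_eqF.
have -> : s * phi x + (1 - s) * phi (M + 1) = s * (phi x + (M - x) * phi (M + 1)).
  by rewrite /s; field; rewrite gt_eqF.
rewrite mulrC -ltr_pdivrMr// /s invrK => Hphi.
have n1 := ler_norm (- phi M); rewrite normrN in n1.
have n2 := ler_norm (phi (M + 1)).
have n3 := ler_norm y.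
have p1 := normr_ge0 (phi M); have p2 := normr_ge0 (phi (M + 1)).
have p3 := normr_ge0 y.
have H1 : x * y <= M * `|y|.
  by apply: (@le_trans _ _ (x * `|y|)); [rewrite ler_wpM2l|rewrite ler_wpM2r].
have H2 : - phi M * (M + 1 - x) <= (M + 1) * `|phi M|.
  apply: (@le_trans _ _ (`|phi M| * (M + 1 - x))); first by rewrite ler_wpM2r// ltW.
  by rewrite mulrC ler_wpM2r//; lra.
have H3 : (M - x) * phi (M + 1) <= M * `|phi (M + 1)|.
  apply: (@le_trans _ _ ((M - x) * `|phi (M + 1)|)); first by rewrite ler_wpM2l//; lra.
  by rewrite ler_wpM2r//; lra.
by rewrite /B; lra.
Qed.

Lemma conjugate_ge x y : 0 <= x -> x * y - phi x <= psi y.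
Proof.
move=> x0; apply: ub_le_sup; first by case: (conjugate_has_sup y).
by exists x.
Qed.

Lemma conjugate_le y M : (forall x, 0 <= x -> x * y - phi x <= M) -> psi y <= M.
Proof.
move=> H; apply: ge_sup; first by case: (conjugate_has_sup y).
by move=> _ [x x0 <-]; exact: H.
Qed.

Lemma conjugate_is_derive (y : R) : is_derive y 1 psi (dpsi y).
Proof. by apply: derivable_is_derive; exact: (@reg_derivable _ _ _ _ reg). Qed.

(** The affine function of slope [x] and intercept [- phi x] lies below the conjugate and touches it
    at [y]. *)
Lemma conjugate_slope x y : 0 <= x -> psi y <= x * y - phi x -> dpsi y = x.
Proof.
move=> x0 xy; apply/esym; apply: (is_derive_tangent_eq (conjugate_is_derive y)).
exists 1 => // z _; have := conjugate_ge z x0; nra.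
Qed.

Lemma conjugate_tangent y z : psi y + dpsi y * (z - y) <= psi z.
Proof.
apply: convex_tangent (conjugate_is_derive y) => s /andP[s0 s1].
apply: conjugate_le => x x0.
have := conjugate_ge y x0; have := conjugate_ge z x0.
by nra.
Qed.

Lemma dconj_nd : {homo dpsi : x y / x <= y}.
Proof.
move=> x y xy; have := conjugate_tangent x y; have := conjugate_tangent y x.
have [->//|xy'] := eqVneq x y.
have : 0 < y - x by rewrite subr_gt0 lt_neqAle xy'.
by move=> ? ? ?; nra.
Qed.

Lemma dconj_ge0 y : 0 <= dpsi y.
Proof.
have := conjugate_tangent y (y - 1).
have : psi (y - 1) <= psi y.
  apply: conjugate_le => x x0; apply: le_trans (conjugate_ge y x0).
  by nra.
by nra.
Qed.

(** With equal slopes at [a] and [b], the two tangents would put the conjugate at the midpoint on or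
    above the chord. *)
Lemma dconj_lt a b : t - delta <= a -> a < b -> dpsi a < dpsi b.
Proof.
move=> ta ab; rewrite lt_neqAle dconj_nd ?ltW// andbT; apply/eqP => dab.
have H : psi (2^-1 * a + (1 - 2^-1) * b) < 2^-1 * psi a + (1 - 2^-1) * psi b.
  apply: (reg_conj_convex reg) => //=; [by lra|by rewrite lt_eqF|by lra].
have := conjugate_tangent a (2^-1 * a + (1 - 2^-1) * b).
have := conjugate_tangent b (2^-1 * a + (1 - 2^-1) * b).
by rewrite dab; nra.
Qed.

Lemma dconj_ge1 y : 1 <= dpsi y -> t <= y.
Proof.
move=> y1; rewrite leNgt; apply/negP => yt.
have d0 := reg_delta_gt0 reg.
(* Strict monotonicity is known above [t - delta] only, so [y] is first raised to that level. *)
have : dpsi (Num.max y (t - delta)) < dpsi t.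
  apply: dconj_lt; first by rewrite le_max lexx orbT.
  by rewrite gt_max yt; lra.
rewrite (reg_t reg) => H.
have : dpsi y <= dpsi (Num.max y (t - delta)) by apply: dconj_nd; rewrite le_max lexx.
by lra.
Qed.

Lemma dconj_le1 y : dpsi y <= 1 -> y <= t.
Proof.
move=> y1; rewrite leNgt; apply/negP => yt.
have d0 := reg_delta_gt0 reg.
have : dpsi t < dpsi y by apply: dconj_lt => //; lra.
by rewrite (reg_t reg); lra.
Qed.

(* [phi] need not be differentiable at [1]; the derivative is then a junk value. *)
Lemma derive1_phi1_ge0 : 0 <= derive1 phi 1.
Proof.
have [dphi|ndphi] := pselect (derivable phi 1 1); last first.
  by rewrite derive1E /derive dvgP// /=.
have d1 := derivable_is_derive dphi; set s := derive1 phi 1 in d1 *.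
have H z : 0 <= z -> phi 1 + s * (z - 1) <= phi z.
  move=> z0; apply: convex_tangent d1 => c /andP[c0 c1].
  have [->|z1] := eqVneq z 1; first by rewrite subrr mulr0 addr0; lra.
  have c01 : 0 < c < 1 by rewrite c0.
  have := reg_convex reg z0 ler01 z1 c01.
  have -> : c * z + (1 - c) * 1 = 1 + c * (z - 1) by ring.
  by lra.
have := @conjugate_slope 1 s ler01.
move=> /(_ _)/wrap[].
  by apply: conjugate_le => x x0; have := H x x0; nra.
move=> ds; have := @dconj_ge1 s; rewrite ds => /(_ (lexx _)).
by have := reg_t_gt0 reg; lra.
Qed.

(** [p] is a subgradient of [phi] at [x]: the supremum of the slopes of the chords ending at [x],
    which exist since [x > 0] and are bounded by the slope of any chord starting at [x]. *)
Lemma fenchel_equality x : 0 < x -> exists p, phi x = x * p - psi p /\ dpsi p = x.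
Proof.
move=> x0.
pose S := [set (phi x - phi a) / (x - a) | a in [set a | 0 <= a < x]].
have Sle a b : 0 <= a < x -> x < b ->
    (phi x - phi a) / (x - a) <= (phi b - phi x) / (b - x).
  move=> /andP[a0 ax] xb.
  pose s := (b - x) / (b - a).
  have ba : 0 < b - a by lra.
  have b0 : 0 <= b by lra.
  have ab : a != b by rewrite lt_eqF//; lra.
  have s01 : 0 < s < 1.
    by rewrite divr_gt0//= ?ltr_pdivrMr//; lra.
  have := reg_convex reg a0 b0 ab s01.
  have -> : s * a + (1 - s) * b = x by rewrite /s; field; rewrite gt_eqF.
  have -> : s * phi a + (1 - s) * phi b = ((b - x) * phi a + (x - a) * phi b) / (b - a).
    by rewrite /s; field; rewrite gt_eqF.
  rewrite ltr_pdivlMr// => H.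
  rewrite ler_pdivrMr; last by lra.
  rewrite mulrAC ler_pdivlMr; last by lra.
  by nra.
have hS : has_sup S.
  split; first by exists ((phi x - phi 0) / (x - 0)), 0 => //=; rewrite lexx.
  exists ((phi (x + 1) - phi x) / (x + 1 - x)) => _ [a /= ax <-].
  by apply: Sle => //; lra.
pose p := sup S.
have sub z : 0 <= z -> phi x + p * (z - x) <= phi z.
  move=> z0; have [zx|xz|->] := ltgtP z x; last by rewrite subrr mulr0 addr0.
    have : (phi x - phi z) / (x - z) <= p.
      apply: ub_le_sup; first by case: hS.
      by exists z => //=; rewrite z0.
    rewrite ler_pdivrMr; last by lra.
    by nra.
  have : p <= (phi z - phi x) / (z - x).
    apply: ge_sup; first by case: hS.
    by move=> _ [a /= ax <-]; exact: Sle.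
  rewrite ler_pdivlMr; last by lra.
  by nra.
exists p; have e1 : psi p <= x * p - phi x.
  by apply: conjugate_le => z z0; have := sub z z0; nra.
split; last by apply: conjugate_slope => //; exact: ltW.
by have := conjugate_ge p (ltW x0); lra.
Qed.

(* Mixing the density [dpsi y] with [1] moves it inside the open half-line, where
   Fenchel's equality holds even if [phi] jumps at [0]. *)
Lemma fenchel_mix (s y : R) : 0 < s < 1 ->
  phi ((1 - s) * dpsi y + s) - ((1 - s) * dpsi y + s) * y + psi y
  <= s * `|1 - dpsi y| * `|t - y|.
Proof.
move=> /andP[s0 s1]; have dy0 := dconj_ge0 y.
set x := (1 - s) * dpsi y + s.
have x0 : 0 < x by rewrite /x; nra.
have [p [-> dp]] := fenchel_equality x0.
have := conjugate_tangent y p => H.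
apply: (@le_trans _ _ ((x - dpsi y) * (p - y))); first by nra.
have -> : x - dpsi y = s * (1 - dpsi y) by rewrite /x; ring.
rewrite -mulrA -mulrA; apply: ler_wpM2l; [exact: ltW|rewrite -normrM].
(* The mixture [x] lies between [dpsi y] and 1, so by monotonicity [p] lies between [y] and [t],
   which bounds [p - y] by [t - y]. *)
have [d1|d1|d1] := ltgtP (dpsi y) 1.
- have xy : dpsi y < x by rewrite /x; nra.
  have xt : x < 1 by rewrite /x; nra.
  have yp : y <= p by rewrite leNgt; apply/negP => /ltW/dconj_nd; lra.
  have pt : p <= t by apply: dconj_le1; lra.
  rewrite ger0_norm; last by apply: mulr_ge0; lra.
  by nra.
- have xy : x < dpsi y by rewrite /x; nra.
  have xt : 1 < x by rewrite /x; nra.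
  have yp : p <= y by rewrite leNgt; apply/negP => /ltW/dconj_nd; lra.
  have pt : t <= p by apply: dconj_ge1; lra.
  rewrite ger0_norm; last by apply: mulr_le0; lra.
  by nra.
- by rewrite d1 subrr !mul0r normr0.
Qed.

Section second_derivative.
Context (ddpsi : R -> R).
Hypothesis C11 : C11loc_with psi ddpsi.

(** [ddpsi] is a derivative only almost everywhere; some such point lies in [[x - 1, x]], and
    monotonicity carries the sign to [x]. *)
Lemma ddpsi_ge0 x : 0 <= ddpsi x.
Proof.
have [N [mN N0 Nbad]] := C11_deriv C11.
have [y [yx Ny]] : exists y, (x - 1 <= y <= x) /\ ~ N y.
  apply: contrapT => /forallNP H.
  have : `[x - 1, x]%classic `<=` N.
    move=> y /=; rewrite in_itv/= => yx; apply: contrapT => Ny; exact: (H y).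
  move=> /(le_measure lebesgue_measure) => /(_ (mem_set (measurable_itv _)) (mem_set mN)).
  rewrite [X in (_ <= X)%E]N0 [X in (X <= _)%E]lebesgue_measure_itv/= lte_fin ltrBlDr ltrDl ltr01.
  by rewrite -EFinD lee_fin; lra.
have dy : is_derive y 1 dpsi (ddpsi y).
  by apply: contrapT => nds; apply: Ny; apply: Nbad.
apply: le_trans (nondecreasing_is_derive_ge0 dconj_nd dy) _.
by apply: (C11_monotone C11); case/andP: yx.
Qed.

Lemma dconj_slope_ge a x y : a <= x -> a <= y ->
  ddpsi a * (x - y) ^+ 2 <= (dpsi x - dpsi y) * (x - y).
Proof.
wlog yx : x y / y <= x.
  move=> H ax ay; have [yx|/ltW xy] := leP y x; first exact: H.
  have := H y x xy ay ax; congr (_ <= _); ring.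
move=> ax ay; rewrite expr2 mulrA ler_wpM2r ?subr_ge0//.
have [K HK] := C11_lipschitz C11 (`|x| + `|y|).
apply: (@lipschitz_ae_derive_ge R dpsi ddpsi y x K (ddpsi a) yx).
- move=> u v yu uv vx; apply: HK.
    rewrite ler_norml; move: (ler_norm x) (ler_norm y) (ler_norm (- y)) (ler_norm (-x)).
    by rewrite !normrN => *; apply/andP; split; lra.
  rewrite ler_norml; move: (ler_norm x) (ler_norm y) (ler_norm (- y)) (ler_norm (-x)).
  by rewrite !normrN => *; apply/andP; split; lra.
- exact: C11_deriv C11.
- by move=> z yz; apply: (C11_monotone C11); exact: le_trans ay yz.
Qed.

(* A fraction [s] of the segment from [a] to [b] stays in the region where the
   slope is at least [ddpsi (t - delta)]. *)
Lemma dconj_slope_frac (a b s : R) : 0 < s -> s <= 1 ->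
  t - delta + s * `|a - b| <= a ->
  s * ddpsi (t - delta) * (a - b) ^+ 2 <= (dpsi a - dpsi b) * (a - b).
Proof.
move=> s0 s1 ha.
pose z := a - s * (a - b).
have az : t - delta <= a by apply: le_trans ha; rewrite lerDl mulr_ge0// ltW.
have zz : t - delta <= z.
  have : s * (a - b) <= s * `|a - b| by rewrite ler_wpM2l ?ler_norm// ltW.
  by rewrite /z; lra.
have := dconj_slope_ge az zz.
have -> : a - z = s * (a - b) by rewrite /z; ring.
rewrite exprMn mulrA expr2 => H.
have {H} H : ddpsi (t - delta) * s * (a - b) ^+ 2 <= (dpsi a - dpsi z) * (a - b).
  by rewrite -(ler_pM2l s0); lra.
apply: (@le_trans _ _ ((dpsi a - dpsi z) * (a - b))); first by lra.
have [ab|ba] := leP b a.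
  have : dpsi b <= dpsi z by apply: dconj_nd; rewrite /z; nra.
  by move=> ?; rewrite ler_wpM2r ?subr_ge0//; lra.
have : dpsi z <= dpsi b by apply: dconj_nd; rewrite /z; nra.
by move=> ?; apply: ler_wnM2r; lra.
Qed.

End second_derivative.
End conjugate.

(** * The discrete monotone system *)

Section finite_sums.
Context {R : realType}.

(** Cauchy-Schwarz, by Lagrange's identity. *)
Lemma sqr_sumr_le (I : finType) (a b : I -> R) :
  (\sum_i a i * b i) ^+ 2 <= (\sum_i a i ^+ 2) * (\sum_i b i ^+ 2).
Proof.
have H : 0 <= \sum_i \sum_j (a i * b j - a j * b i) ^+ 2.
  by apply: sumr_ge0 => i _; apply: sumr_ge0 => j _; exact: sqr_ge0.
suff E : \sum_i \sum_j (a i * b j - a j * b i) ^+ 2 =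
    2 * ((\sum_i a i ^+ 2) * (\sum_i b i ^+ 2) - (\sum_i a i * b i) ^+ 2) by lra.
have E1 : (\sum_i a i ^+ 2) * (\sum_i b i ^+ 2) = \sum_i \sum_j (a i ^+ 2 * b j ^+ 2).
  by rewrite mulr_suml; apply: eq_bigr => i _; rewrite mulr_sumr.
have E2 : (\sum_i a i ^+ 2) * (\sum_i b i ^+ 2) = \sum_i \sum_j (a j ^+ 2 * b i ^+ 2).
  by rewrite mulrC mulr_suml; apply: eq_bigr => i _; rewrite mulr_sumr;
     apply: eq_bigr => j _; rewrite mulrC.
have E3 : (\sum_i a i * b i) ^+ 2 = \sum_i \sum_j (a i * b i * (a j * b j)).
  by rewrite expr2 mulr_suml; apply: eq_bigr => i _; rewrite mulr_sumr.
rewrite mulrBr mulr_natl mulr2n {1}E1 E2 E3 -big_split/= mulr_sumr -sumrB.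
apply: eq_bigr => i _; rewrite -big_split/= mulr_sumr -sumrB.
by apply: eq_bigr => j _; ring.
Qed.

(* Lifts a Poincare-type inequality from functions of the cell [cell i] to
   arbitrary functions of [i], splitting [u] into its cell means and a rest. *)
Lemma poincare_blowup (I J : finType) (cell : J -> I) (q : I -> I -> R) (u : J -> R) :
  (forall k l, q k l = q l k) -> (forall k, 0 <= q k k) ->
  (forall w : I -> R,
    0 <= \sum_i \sum_j q (cell i) (cell j) * (w (cell i) - w (cell j)) ^+ 2) ->
  0 <= \sum_i \sum_j q (cell i) (cell j) * (u i - u j) ^+ 2.
Proof.
move=> qC q0 H.
pose m k := (\sum_(i | cell i == k) u i) / (\sum_(i | cell i == k) 1).
pose e i := u i - m (cell i).
(* The rest [e] is orthogonal to every function of the cell; an empty cell, where the mean is a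
   division by 0, contributes nothing. *)
have e0 F : \sum_i F (cell i) * e i = 0.
  rewrite (partition_big cell predT)//= big1// => k _.
  under eq_bigr => i /eqP -> do [].
  rewrite -mulr_sumr; apply/eqP; rewrite mulf_eq0; apply/orP; right.
  rewrite /e sumrB subr_eq0.
  under [X in _ == X]eq_bigr => i /eqP -> do rewrite -[m k]mulr1.
  rewrite -mulr_sumr /m.
  have [c0|c0] := eqVneq (\sum_(i | cell i == k) (1 : R)) 0; last by rewrite mulfVK.
  rewrite c0 mulr0 big1// => i ik.
  move: c0; rewrite (bigD1 i)//= => /eqP.
  rewrite gt_eqF// ltr_wpDr//.
  by apply: sumr_ge0.
(* Testing the hypothesis with the indicator of the cell of [i] bounds the row sum below by the
   number of indices in that cell times [q k k]. *)
have T0 i : 0 <= \sum_j q (cell i) (cell j).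
  set k := cell i.
  pose w l : R := (l == k)%:R.
  have := H w.
  pose c := \sum_j w (cell j).
  have c0 : 0 < c.
    rewrite /c (bigD1 i)//= {1}/w eqxx ltr_wpDr//; apply: sumr_ge0 => j _.
    by rewrite /w ler0n.
  have -> : \sum_i0 \sum_j q (cell i0) (cell j) * (w (cell i0) - w (cell j)) ^+ 2 =
     2 * (c * \sum_j q k (cell j) - c * c * q k k).
    transitivity (\sum_i0 \sum_j (w (cell i0) * q k (cell j) + w (cell j) * q k (cell i0)
        - 2 * (w (cell i0) * w (cell j) * q k k))).
      apply: eq_bigr => i0 _; apply: eq_bigr => j _; rewrite /w.
      case: eqVneq => [->|_]; case: eqVneq => [->|_] /=; rewrite ?(qC (cell i0) k); ring.
    under eq_bigr => i0 _ do rewrite sumrB big_split/= -mulr_sumr -mulr_suml.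
    rewrite sumrB big_split/= -!mulr_suml -mulr_sumr -/c.
    have -> : \sum_i0 \sum_i1 2 * (w (cell i0) * w (cell i1) * q k k) = 2 * (c * c * q k k).
      rewrite /c mulr_suml mulr_suml mulr_sumr; apply: eq_bigr => i0 _.
      by rewrite [w _ * _ as X in X * q k k]mulr_sumr mulr_suml mulr_sumr.
    by ring.
  by have := q0 k; nra.
(* The cross terms vanish by [e0]; what remains is the form of the cell means plus squares of the
   rest, weighted by the nonnegative row sums. *)
have -> : \sum_i \sum_j q (cell i) (cell j) * (u i - u j) ^+ 2 =
  \sum_i \sum_j q (cell i) (cell j) * (m (cell i) - m (cell j)) ^+ 2
  + 2 * \sum_i e i ^+ 2 * \sum_j q (cell i) (cell j).
  have -> : 2 * \sum_i e i ^+ 2 * \sum_j q (cell i) (cell j) =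
    \sum_i \sum_j q (cell i) (cell j) * (e i ^+ 2 + e j ^+ 2).
    transitivity (\sum_i \sum_j q (cell i) (cell j) * e i ^+ 2
                + \sum_i \sum_j q (cell i) (cell j) * e j ^+ 2); last first.
      rewrite -big_split/=; apply: eq_bigr => i _; rewrite -big_split/=.
      by apply: eq_bigr => j _; ring.
    rewrite [X in _ + X]exchange_big/=.
    under [X in _ = _ + X]eq_bigr => i _ do under eq_bigr => j _ do rewrite qC.
    rewrite -[RHS]mulr2n -[RHS]mulr_natl; congr (_ * _); apply: eq_bigr => i _.
    by rewrite mulr_sumr; apply: eq_bigr => j _; rewrite mulrC.
  apply/eqP; rewrite -subr_eq0 opprD addrA -!sumrB; apply/eqP.
  transitivity (2 * (\sum_j \sum_i (q (cell i) (cell j) * (m (cell i) - m (cell j))) * e i)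
    + 2 * (\sum_i \sum_j (q (cell i) (cell j) * (m (cell j) - m (cell i))) * e j)
    - 2 * \sum_i (\sum_j q (cell i) (cell j) * e j) * e i).
    rewrite [X in 2 * X + _ - _]exchange_big/= !mulr_sumr -big_split/= -!sumrB.
    apply: eq_bigr => i _; rewrite mulr_suml !mulr_sumr -big_split/= -!sumrB.
    by apply: eq_bigr => j _; rewrite /e; ring.
  have -> : \sum_j \sum_i (q (cell i) (cell j) * (m (cell i) - m (cell j))) * e i = 0.
    by apply: big1 => j _; rewrite (e0 (fun k => q k (cell j) * (m k - m (cell j)))).
  have -> : \sum_i \sum_j (q (cell i) (cell j) * (m (cell j) - m (cell i))) * e j = 0.
    by apply: big1 => i _; rewrite (e0 (fun k => q (cell i) k * (m k - m (cell i)))).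
  have -> : \sum_i (\sum_j q (cell i) (cell j) * e j) * e i = 0.
    by apply: big1 => i _; rewrite (e0 (q (cell i))) mul0r.
  by ring.
apply: addr_ge0; first exact: H.
apply: mulr_ge0 => //; apply: sumr_ge0 => i _.
by apply: mulr_ge0; rewrite ?sqr_ge0.
Qed.

(** * Coercivity of the weighted form *)

Section gap.
Context (n : nat) (w : 'I_n -> 'I_n -> R) (G b om C : R) (S : rel 'I_n).
Hypotheses (n0 : (0 < n)%N) (w0 : forall i j, 0 <= w i j).
Hypotheses (b0 : 0 < b) (om0 : 0 < om) (C0 : 0 <= C) (G0 : 0 <= G).
Hypothesis colG : forall j, \sum_i w i j <= G.
Hypothesis rowG : forall i, \sum_j w i j <= G.
Hypothesis col_om : forall j, om <= \sum_i w i j.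
Hypothesis overlap : forall i i', S i i' -> b <= \sum_j w i j * w i' j.
Hypothesis poincare : forall u : 'I_n -> R,
  \sum_i \sum_i' (u i - u i') ^+ 2 <=
  C * \sum_i \sum_(i' | S i i') (u i - u i') ^+ 2.

Let nR : 0 < n%:R :> R. Proof. by rewrite ltr0n. Qed.

(** [n] times the sum of two constants: that of [gap_left], and the one that [gap_right] gives once
    [gap_left] is inserted in it. The factor [n] comes from [sum_sqr_centered]. *)
Definition gap_const : R := C * G / b + n%:R / om * (2 + 2 * G * (C * G / (b * n%:R))).

(** For fixed [j], [u i - u i'] is the difference of [u i + v j] and [u i' + v j], so [v] drops out:
    the sum over pairs weighted by [w i j * w i' j] is twice a variance, at most [2 G] times the
    form in column [j]. Summing over [j] produces the overlaps. *)
Let gap_left (u v : 'I_n -> R) : \sum_i u i = 0 ->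
  \sum_i u i ^+ 2 <= C * G / (b * n%:R) * \sum_i \sum_j w i j * (u i + v j) ^+ 2.
Proof.
move=> u0.
have var : \sum_i \sum_i' (u i - u i') ^+ 2 = 2 * (n%:R * \sum_i u i ^+ 2).
  transitivity (\sum_i (n%:R * u i ^+ 2 + \sum_i' u i' ^+ 2 - 2 * u i * \sum_i' u i')).
    apply: eq_bigr => i _; rewrite mulr_sumr.
    rewrite -[n in n%:R * _](card_ord n) -sum1_card natr_sum mulr_suml -big_split -sumrB/=.
    by apply: eq_bigr => i' _; ring.
  rewrite u0 mulrC; under eq_bigr => i _ do rewrite mulr0 subr0.
  rewrite big_split/= -mulr_sumr sumr_const card_ord -mulr_natl; ring.
have colj j : \sum_i \sum_i' w i j * w i' j * (u i - u i') ^+ 2 <=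
    2 * (G * \sum_i w i j * (u i + v j) ^+ 2).
  set W := \sum_i w i j; set T := \sum_i w i j * (u i + v j) ^+ 2.
  set Z := \sum_i w i j * (u i + v j).
  have -> : \sum_i \sum_i' w i j * w i' j * (u i - u i') ^+ 2 = 2 * (W * T - Z ^+ 2).
    transitivity (\sum_i (w i j * (u i + v j) ^+ 2 * W + w i j * T
       - 2 * (w i j * (u i + v j) * Z))).
      apply: eq_bigr => i _; rewrite /W /T /Z !mulr_sumr -big_split -sumrB/=.
      by apply: eq_bigr => i' _; ring.
    by rewrite sumrB big_split/= -!mulr_sumr -!mulr_suml -/W -/T -/Z; ring.
  have T0 : 0 <= T by apply: sumr_ge0 => i _; rewrite mulr_ge0 ?sqr_ge0.
  have : W * T <= G * T by apply: ler_wpM2r => //; exact: colG.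
  by have := sqr_ge0 Z; lra.
set D := \sum_i \sum_j _.
have GD : \sum_i \sum_i' (\sum_j w i j * w i' j) * (u i - u i') ^+ 2 <= 2 * (G * D).
  have -> : 2 * (G * D) = \sum_j 2 * (G * \sum_i w i j * (u i + v j) ^+ 2).
    by rewrite /D exchange_big/= -!mulr_sumr.
  apply: le_trans (ler_sum _ (fun j _ => colj j)).
  rewrite [leRHS]exchange_big/=; apply: ler_sum => i _.
  rewrite [leRHS]exchange_big/=; apply: ler_sum => i' _.
  by rewrite mulr_suml.
have SD : b * \sum_i \sum_(i' | S i i') (u i - u i') ^+ 2 <= 2 * (G * D).
  apply: le_trans GD; rewrite mulr_sumr; apply: ler_sum => i _.
  rewrite mulr_sumr [leRHS](bigID (S i))/= -[leLHS]addr0; apply: lerD.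
    by apply: ler_sum => i' Sii; rewrite ler_wpM2r ?sqr_ge0// overlap.
  apply: sumr_ge0 => i' _; rewrite mulr_ge0 ?sqr_ge0//.
  by apply: sumr_ge0 => j _; rewrite mulr_ge0.
have := poincare u; rewrite var => Pu.
have -> : C * G / (b * n%:R) * D = C * (G * D) / (b * n%:R) by ring.
rewrite ler_pdivlMr ?mulr_gt0//.
have : C * (b * \sum_i \sum_(i' | S i i') (u i - u i') ^+ 2) <= C * (2 * (G * D)).
  by rewrite ler_wpM2l.
have : b * (2 * (n%:R * \sum_i u i ^+ 2)) <=
    b * (C * \sum_i \sum_(i' | S i i') (u i - u i') ^+ 2).
  by rewrite ler_wpM2l// ltW.
by lra.
Qed.

(** [v j] is [u i + v j] minus [u i]; the weights of column [j], of total at least [om], average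
    this over [i]. *)
Let gap_right (u v : 'I_n -> R) :
  om * \sum_j v j ^+ 2 <=
  2 * \sum_i \sum_j w i j * (u i + v j) ^+ 2 + 2 * G * \sum_i u i ^+ 2.
Proof.
apply: (@le_trans _ _ (\sum_i \sum_j w i j * v j ^+ 2)).
  rewrite exchange_big/= mulr_sumr; apply: ler_sum => j _.
  by rewrite -mulr_suml ler_wpM2r ?sqr_ge0.
apply: (@le_trans _ _ (\sum_i \sum_j (2 * (w i j * (u i + v j) ^+ 2)
    + 2 * (w i j * u i ^+ 2)))).
  apply: ler_sum => i _; apply: ler_sum => j _.
  rewrite -subr_ge0 (_ : _ - _ = w i j * (2 * u i + v j) ^+ 2); last by ring.
  by rewrite mulr_ge0 ?sqr_ge0.
under eq_bigr do rewrite big_split/= -!mulr_sumr.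
rewrite big_split/= -!mulr_sumr lerD2l -mulrA ler_wpM2l// mulr_sumr.
by apply: ler_sum => i _; rewrite -mulr_suml ler_wpM2r ?sqr_ge0.
Qed.

Lemma sum_sqr_centered (u v : 'I_n -> R) : \sum_i u i = 0 ->
  \sum_i \sum_j (u i + v j) ^+ 2 = n%:R * (\sum_i u i ^+ 2 + \sum_j v j ^+ 2).
Proof.
move=> u0.
transitivity (\sum_i (n%:R * u i ^+ 2 + 2 * u i * (\sum_j v j) + \sum_j v j ^+ 2)).
  apply: eq_bigr => i _; rewrite mulr_sumr.
  rewrite -[n in n%:R * _](card_ord n) -sum1_card natr_sum mulr_suml -!big_split/=.
  by apply: eq_bigr => j _; ring.
rewrite !big_split/= -mulr_suml -!mulr_sumr u0 mulr0 mul0r addr0 sumr_const card_ord.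
by rewrite -[X in _ + X]mulr_natl -mulrDr.
Qed.

Lemma gap_bound (u v : 'I_n -> R) : \sum_i u i = 0 ->
  \sum_i \sum_j (u i + v j) ^+ 2 <=
  gap_const * \sum_i \sum_j w i j * (u i + v j) ^+ 2.
Proof.
move=> u0; rewrite (sum_sqr_centered v u0).
have := gap_left v u0; have := gap_right u v.
set D := \sum_i \sum_j _; set U := \sum_i u i ^+ 2; set V := \sum_j _ ^+ 2.
set c := C * G / (b * n%:R) => VD UD.
have -> : gap_const * D = n%:R * (c * D + (2 * D + 2 * G * (c * D)) / om).
  by rewrite /gap_const /c; field; rewrite !gt_eqF.
rewrite ler_pM2l// lerD// ler_pdivlMr// mulrC.
apply: le_trans VD _; rewrite lerD2l.
by rewrite ler_wpM2l// mulr_ge0.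
Qed.

(* [theta] is the factor lost when a slope is bounded only on the initial
   fraction of a segment; [x] is the difference of the two plans. *)
Lemma monotone_gap_estimate (theta : R) (x : 'I_n -> 'I_n -> R) (u v : 'I_n -> R) :
  0 < theta ->
  (forall i j, theta * w i j * (u i + v j) ^+ 2 <= x i j * (u i + v j)) ->
  theta ^+ 2 * \sum_i \sum_j (u i + v j) ^+ 2 <=
  gap_const ^+ 2 / n%:R *
    (\sum_i (\sum_j x i j) ^+ 2 + \sum_j (\sum_i x i j) ^+ 2).
Proof.
move=> th0.
(* Only the sums [u i + v j] matter, so a constant can be moved from [u] to [v]. *)
wlog u0 : u v / \sum_i u i = 0.
  pose s := (\sum_i u i) / n%:R.
  move=> H xuv; have := H (fun i => u i - s) (fun j => v j + s).
  have E i j : u i - s + (v j + s) = u i + v j by ring.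
  have Es : \sum_(i < n) s = \sum_i u i.
    by rewrite sumr_const card_ord -[LHS]mulr_natr /s mulfVK// gt_eqF.
  rewrite sumrB Es subrr => /(_ erefl).
  under eq_bigr do under eq_bigr do rewrite E.
  by apply => i j; rewrite E.
move=> xuv.
have gb := gap_bound v u0.
set N := \sum_i \sum_j _ in gb *; set D := \sum_i \sum_j _ in gb.
set A := \sum_i _ ^+ 2; set B := \sum_j _ ^+ 2.
have N0 : 0 <= N by apply: sumr_ge0 => i _; apply: sumr_ge0 => j _; exact: sqr_ge0.
have D0 : 0 <= D.
  by apply: sumr_ge0 => i _; apply: sumr_ge0 => j _; rewrite mulr_ge0 ?sqr_ge0.
have A0 : 0 <= A by apply: sumr_ge0 => i _; exact: sqr_ge0.
have B0 : 0 <= B by apply: sumr_ge0 => i _; exact: sqr_ge0.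
have gc0 : 0 <= gap_const.
  have c0 : 0 <= C * G / (b * n%:R).
    by apply: divr_ge0; [exact: mulr_ge0|apply: mulr_ge0; exact: ltW].
  apply: addr_ge0; first by apply: divr_ge0; [exact: mulr_ge0|exact: ltW].
  apply: mulr_ge0; first by apply: divr_ge0; exact: ltW.
  by apply: addr_ge0 => //; apply: mulr_ge0 => //; exact: mulr_ge0.
pose P := \sum_i (\sum_j x i j) * u i; pose Q := \sum_j (\sum_i x i j) * v j.
have DPQ : theta * D <= P + Q.
  apply: (@le_trans _ _ (\sum_i \sum_j x i j * (u i + v j))).
    rewrite /D mulr_sumr; apply: ler_sum => i _; rewrite mulr_sumr.
    by apply: ler_sum => j _; rewrite mulrA.
  under eq_bigr do under eq_bigr do rewrite mulrDr.
  under eq_bigr do rewrite big_split/= -mulr_suml.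
  rewrite big_split/= lerD2l exchange_big/=.
  by under eq_bigr do rewrite -mulr_suml.
(* Cauchy-Schwarz for the pair of marginal defects against the pair [(u, v)], whose squared norm is
   [N / n] after centring. *)
have CS : (P + Q) ^+ 2 <= (A + B) * (N / n%:R).
  rewrite (_ : N / n%:R = \sum_i u i ^+ 2 + \sum_j v j ^+ 2); last first.
    by rewrite /N (sum_sqr_centered v u0) mulrC mulKf// gt_eqF.
  have := sqr_sumr_le (fun i => \sum_j x i j) u.
  have := sqr_sumr_le (fun j => \sum_i x i j) v.
  rewrite -/P -/Q -/A -/B.
  set U := \sum_i u i ^+ 2; set V := \sum_j v j ^+ 2 => hQ hP.
  have U0 : 0 <= U by apply: sumr_ge0 => i _; exact: sqr_ge0.
  have V0 : 0 <= V by apply: sumr_ge0 => i _; exact: sqr_ge0.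
  have PQ : P * Q <= (A * V + B * U) / 2.
    have PQ2 : (P * Q) ^+ 2 <= ((A * V + B * U) / 2) ^+ 2.
      rewrite exprMn; apply: (@le_trans _ _ ((A * U) * (B * V))).
        by apply: ler_pM => //; exact: sqr_ge0.
      have := sqr_ge0 (A * V - B * U); lra.
    have R0 : 0 <= (A * V + B * U) / 2.
      by apply: divr_ge0 => //; apply: addr_ge0; apply: mulr_ge0.
    rewrite leNgt; apply/negP => lt; have H := ltr_pM R0 R0 lt lt.
    by move: PQ2; rewrite !expr2 leNgt H.
  by lra.
have thN : theta * N <= gap_const * (P + Q).
  apply: (@le_trans _ _ (theta * (gap_const * D))); first by rewrite ler_wpM2l// ltW.
  by rewrite mulrCA ler_wpM2l.
have thN2 : (theta * N) ^+ 2 <= gap_const ^+ 2 * ((A + B) * (N / n%:R)).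
  apply: (@le_trans _ _ ((gap_const * (P + Q)) ^+ 2)).
    by rewrite ler_sqr ?nnegrE// ?(le_trans _ thN)// mulr_ge0// ltW.
  by rewrite exprMn ler_wpM2l// sqr_ge0.
(* [thN2] bounds the square of [N] by a multiple of [N]: divide by [N] when it is positive. *)
have [->|Nneq] := eqVneq N 0.
  by rewrite mulr0 mulr_ge0// ?addr_ge0// mulr_ge0 ?sqr_ge0// invr_ge0 ltW.
have Npos : 0 < N by rewrite lt_neqAle eq_sym Nneq.
rewrite -(ler_pM2r Npos).
have -> : gap_const ^+ 2 / n%:R * (A + B) * N = gap_const ^+ 2 * ((A + B) * (N / n%:R)) by ring.
by rewrite -mulrA -expr2 -exprMn.
Qed.

End gap.
End finite_sums.

(** * Lebesgue measure on row vectors *)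

Section euclidean_norm.
Context {R : realType} {d : nat}.
Implicit Types x y z : 'rV[R]_d.

Lemma enorm_ge0 x : 0 <= enorm x. Proof. exact: sqrtr_ge0. Qed.

Lemma enorm_sqr x : enorm x ^+ 2 = \sum_(i < d) x 0 i ^+ 2.
Proof. by rewrite sqr_sqrtr// sumr_ge0// => i _; exact: sqr_ge0. Qed.

Lemma enorm0 : enorm (0 : 'rV[R]_d) = 0.
Proof. by rewrite /enorm big1 ?sqrtr0// => i _; rewrite mxE expr0n. Qed.

Lemma enormZ (a : R) x : enorm (a *: x) = `|a| * enorm x.
Proof.
rewrite /enorm (eq_bigr (fun i => a ^+ 2 * x 0 i ^+ 2)); last first.
  by move=> i _; rewrite mxE exprMn.
by rewrite -mulr_sumr sqrtrM ?sqr_ge0// sqrtr_sqr.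
Qed.

Lemma enormN x : enorm (- x) = enorm x.
Proof. by rewrite -scaleN1r enormZ normrN1 mul1r. Qed.

Lemma enormB x y : enorm (x - y) = enorm (y - x).
Proof. by rewrite -enormN opprB. Qed.

Lemma enormD x y : enorm (x + y) <= enorm x + enorm y.
Proof.
have H0 : 0 <= enorm x + enorm y by rewrite addr_ge0 ?enorm_ge0.
rewrite -(@ler_pXn2r _ 2)// ?nnegrE ?enorm_ge0//.
rewrite sqrrD !enorm_sqr.
have -> : \sum_(i < d) (x + y) 0 i ^+ 2 =
    \sum_(i < d) x 0 i ^+ 2 + (\sum_(i < d) x 0 i * y 0 i) *+ 2 + \sum_(i < d) y 0 i ^+ 2.
  rewrite -sumrMnl -!big_split/=; apply: eq_bigr => i _.
  by rewrite mxE sqrrD.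
rewrite lerD2r lerD2l ler_pMn2r//.
apply: le_trans (ler_norm _) _.
rewrite -(@ler_pXn2r _ 2)// ?nnegrE ?mulr_ge0 ?enorm_ge0//.
by rewrite real_normK ?num_real// exprMn !enorm_sqr; exact: sqr_sumr_le.
Qed.

Lemma enorm_dist y x z : enorm (x - z) <= enorm (x - y) + enorm (y - z).
Proof. by rewrite -[x - z](subrKA y); exact: enormD. Qed.

Lemma coord_le_enorm x i : `|x 0 i| <= enorm x.
Proof.
rewrite -(@ler_pXn2r _ 2)// ?nnegrE ?enorm_ge0// real_normK ?num_real// enorm_sqr.
by rewrite (bigD1 i)//= lerDl sumr_ge0// => j _; exact: sqr_ge0.
Qed.

Lemma enorm_le_coord x (e : R) : 0 <= e -> (forall i, `|x 0 i| <= e) ->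
  enorm x <= d%:R * e.
Proof.
move=> e0 xe; have [d0|d0] := posnP d.
  rewrite /enorm big1 ?sqrtr0 ?mulr_ge0// => i _.
  by have := leq_ltn_trans (leq0n i) (ltn_ord i); rewrite [X in (_ < X)%N]d0.
have de : 0 <= d%:R * e by rewrite mulr_ge0.
rewrite -(@ler_pXn2r _ 2)// ?nnegrE ?enorm_ge0// enorm_sqr.
apply: (@le_trans _ _ (\sum_(i < d) e ^+ 2)).
  apply: ler_sum => i _; rewrite -real_normK ?num_real//.
  by rewrite ler_pXn2r ?nnegrE.
rewrite sumr_const card_ord -[leLHS]mulr_natl exprMn ler_wpM2r ?sqr_ge0//.
by rewrite expr2 ler_peMl// ?ler0n// ler1n.
Qed.

Lemma eball_open x r : open (eball x r).
Proof.
rewrite openE => y; rewrite /eball/= => yr.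
pose e := (r - enorm (y - x)) / (d%:R + 1).
have D0 : 0 < d%:R + 1 :> R by rewrite ltr_wpDl// ler0n.
have e0 : 0 < e by rewrite divr_gt0// subr_gt0.
apply/nbhs_ballP; exists e => //= z [_ yz].
apply: (@le_lt_trans _ _ (enorm (z - y) + enorm (y - x))); first exact: enorm_dist.
have : enorm (z - y) <= d%:R * e.
  apply: enorm_le_coord; first exact: ltW.
  by move=> i; have := yz ord0 i; rewrite /ball/= !mxE distrC => /ltW.
have : e * (d%:R + 1) = r - enorm (y - x) by rewrite mulfVK ?gt_eqF.
by move=> ? ?; nra.
Qed.

Lemma measurable_eball x r : measurable (eball x r).
Proof. by apply: open_measurable_rV; exact: eball_open. Qed.

Lemma eball_center x r : 0 < r -> eball x r x.
Proof. by rewrite /eball/= subrr enorm0. Qed.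

Lemma eball_sub_box x r :
  eball x r `<=` [set y : 'rV[R]_d | forall i, `](x 0 i - r), (x 0 i + r)[%classic (y 0 i)].
Proof.
move=> y; rewrite /eball/= => yr i; rewrite /= in_itv/= -ltr_distl.
by have := coord_le_enorm (y - x) i; rewrite !mxE => /le_lt_trans; exact.
Qed.

Lemma box_sub_eball x r (s : R) : (0 < d)%N -> 0 < s -> d%:R * s < r ->
  [set y : 'rV[R]_d | forall i, `](x 0 i - s), (x 0 i + s)[%classic (y 0 i)] `<=` eball x r.
Proof.
move=> d0 s0 sr y /= yx; rewrite /eball/=; apply: le_lt_trans sr.
apply: enorm_le_coord; first exact: ltW.
by move=> i; rewrite !mxE; have := yx i; rewrite /= in_itv/= -ltr_distl => /ltW.
Qed.

End euclidean_norm.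

Section lebesgue_measure_affine.
Context {R : realType}.

(** The image of Lebesgue measure, rescaled by [s], agrees with it on half-open intervals, hence
    everywhere by uniqueness. *)
Lemma lebesgue_measure_affine (s b : R) (A : set (measurableTypeR R)) :
  0 < s -> measurable A ->
  lebesgue_measure ((fun t => s * t + b) @^-1` A) = (s^-1%:E * lebesgue_measure A)%E.
Proof.
move=> s0 mA.
pose f : measurableTypeR R -> measurableTypeR R := fun t => s * t + b.
have mf : measurable_fun setT f by apply: measurable_funD => //; exact: measurable_funM.
pose m := mscale (NngNum (ltW s0))
  (measure_function_pushforward__canonical__measure_function_Measure
    (@lebesgue_measure R) mf).
have mE B : m B = (s%:E * lebesgue_measure (f @^-1` B))%E by [].
have : lebesgue_measure A = m A.
  apply: lebesgue_measure_unique => // _ [[u v] _ <-].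
  transitivity (s%:E * lebesgue_measure (f @^-1` `]u, v]))%E; last by [].
  have -> : f @^-1` `]u, v] = `](u - b) / s, (v - b) / s]%classic.
    apply/seteqP; split => t /=; rewrite !in_itv/= /f.
      by move=> /andP[h1 h2]; rewrite ltr_pdivrMr// ler_pdivlMr//; apply/andP; split; lra.
    by rewrite ltr_pdivrMr// ler_pdivlMr// => /andP[h1 h2]; apply/andP; split; lra.
  rewrite !lebesgue_measure_itv/= !lte_fin ltr_pM2r ?invr_gt0// ltrD2r.
  case: ifPn => _; last by rewrite mule0.
  by rewrite -EFinM; congr EFin; field; rewrite gt_eqF.
move=> ->; rewrite mE muleA -EFinM mulVf ?gt_eqF// mul1e.
by [].
Qed.

End lebesgue_measure_affine.

Section lebesgue_rV_affine.
Context {R : realType}.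

(** A name for the measure that can carry a sigma-finite instance, needed for the products below. *)
Definition leb d : set 'rV[R]_d -> \bar R := lebesgue_rV R d.
HB.instance Definition _ d := Measure.copy (@leb d) (lebesgue_rV R d).

Lemma leb_box d (x : 'rV[R]_d) (r : R) : 0 <= r ->
  leb [set y : 'rV[R]_d | forall i, `](x 0 i - r), (x 0 i + r)[%classic (y 0 i)] =
  ((2 * r) ^+ d)%:E.
Proof.
move=> r0; rewrite /leb (lebesgue_rV_box (B := fun i => `](x 0 i - r), (x 0 i + r)[%classic)).
  rewrite (eq_bigr (fun _ : 'I_d => (2 * r)%:E)); last first.
    move=> i _; rewrite lebesgue_measure_itv/= lte_fin.
    case: ltP => H; first by rewrite -EFinB; congr EFin; ring.
    by congr EFin; lra.
  by rewrite prodEFin prodr_const card_ord.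
by move=> i; exact: measurable_itv.
Qed.

Lemma measurable_box d (x : 'rV[R]_d) (r : R) :
  measurable [set y : 'rV[R]_d | forall i, `](x 0 i - r), (x 0 i + r)[%classic (y 0 i)].
Proof.
rewrite (_ : [set _ | _] = \bigcap_(i in [set: 'I_d])
    [set y : 'rV[R]_d | `](x 0 i - r), (x 0 i + r)[%classic (y 0 i)]).
  apply: fin_bigcap_measurable => // i _.
  by rewrite -[X in measurable X]setTI; apply: measurable_coord => //; exact: measurable_itv.
by apply/seteqP; split=> y /= yB i; [move=> _|]; exact: yB.
Qed.

Let leb_sigma_finite d : sigma_finite setT (@leb d).
Proof.
exists (fun k => [set y : 'rV[R]_d | forall i,
    `]((0 : 'rV[R]_d) 0 i - k%:R), ((0 : 'rV[R]_d) 0 i + k%:R)[%classic (y 0 i)]).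
  apply/esym/seteqP; split => // y _.
  exists (Num.truncn (enorm y)).+1 => // i /=.
  rewrite !mxE sub0r add0r in_itv/= -ltr_norml.
  by apply: le_lt_trans (coord_le_enorm y i) _; exact: truncnS_gt.
move=> k; split; first exact: measurable_box.
by rewrite leb_box// ltry.
Qed.

HB.instance Definition _ d :=
  Measure_isSigmaFinite.Build _ _ _ (@leb d) (@leb_sigma_finite d).

Lemma measurable_fun_affine d (s : R) (b : 'rV[R]_d) :
  measurable_fun setT (fun x : 'rV[R]_d => s *: x + b).
Proof.
apply: measurable_fun_rV => i; under eq_fun do rewrite !mxE.
apply: measurable_funD => //; apply: measurable_funM => //; exact: measurable_coord.
Qed.

Lemma measurable_preimage d1 d2 (T1 : measurableType d1) (T2 : measurableType d2)
    (f : T1 -> T2) A : measurable_fun setT f -> measurable A -> measurable (f @^-1` A).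
Proof. by move=> mf mA; rewrite -[X in measurable X]setTI; exact: mf. Qed.

(** Induction along [consrV]: the slices in the first coordinate give one factor [s^-1], the
    induction hypothesis for the remaining coordinates gives the others. *)
Lemma leb_affine d (s : R) (b : 'rV[R]_d) A : 0 < s -> measurable A ->
  leb ((fun x => s *: x + b) @^-1` A) = ((s^-1 ^+ d)%:E * leb A)%E.
Proof.
move=> s0; elim: d b A => [|d IH] b A mA.
  rewrite expr0 mul1e; congr (leb _); apply/seteqP; split => x /=.
    by rewrite (thinmx0 (_ + b)) (thinmx0 x).
  by rewrite (thinmx0 (_ + b)) (thinmx0 x).
pose b' : 'rV[R]_d := \row_i b 0 (lift ord0 i).
pose f : 'rV[R]_d -> 'rV[R]_d := fun v => s *: v + b'.
have mf : measurable_fun setT f by exact: measurable_fun_affine.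
have mA' : measurable (@consrV R d @^-1` A).
  by apply: measurable_preimage => //; exact: measurable_consrV.
pose G v := lebesgue_measure (xsection (@consrV R d @^-1` A) v).
have mG : measurable_fun setT G by exact: measurable_fun_xsection.
have lebE B : leb B = (\int[@leb d]_v lebesgue_measure (xsection (@consrV R d @^-1` B) v))%E.
  by [].
have cE v t : s *: consrV (v, t) + b = consrV (f v, s * t + b 0 ord0).
  apply/rowP => i; rewrite !mxE; case: (unliftP ord0 i) => [j|] ->.
    by rewrite !mxE.
  by [].
rewrite lebE (eq_integral (fun v => s^-1%:E * (G \o f) v)%E); last first.
  move=> v _; rewrite /G/= -(lebesgue_measure_affine (b 0 ord0))//; last first.
    exact: measurable_xsection.
  congr (lebesgue_measure _); apply/seteqP; split => t /=;
    rewrite /xsection/= !inE/= cE//.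
have sV0 : 0 <= s^-1 by rewrite invr_ge0 ltW.
rewrite ge0_integralZl//; last exact: (measurableT_comp mG mf).
rewrite exprS EFinM -muleA; congr (_ * _)%E.
transitivity (\int[measure_function_pushforward__canonical__measure_function_Measure
    (@leb d) mf]_v G v)%E.
  apply/esym; rewrite -[RHS]/(\int[@leb d]_(v in f @^-1` setT) (G \o f) v)%E.
  apply: ge0_integral_pushforward => // v _; exact: measure_ge0.
pose c := NngNum (exprn_ge0 d sV0).
transitivity (\int[mscale c (@leb d)]_v G v)%E.
  by apply: eq_measure_integral => B mB _; exact: IH.
rewrite ge0_integral_mscale//.
Qed.

Section shear.
Context (d : nat).
Local Notation E := 'rV[R]_d.
Local Notation leb2 := (@leb d \x @leb d)%E.

Lemma product_lebE2 (X : set (E * E)) : measurable X ->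
  leb2 X = (\int[@leb d]_y leb (ysection X y))%E.
Proof.
move=> mX; rewrite (@product_measure_unique _ _ _ _ _ (@leb d) (@leb d) (@leb d \x^ @leb d)%E)//.
by move=> A B mA mB; exact: product_measure2E.
Qed.

Lemma leb2_shear2 (s : R) (th : E -> E) (X : set (E * E)) : 0 < s -> measurable X ->
  leb2 ((fun z => (z.1, s *: z.2 + th z.1)) @^-1` X) = ((s^-1 ^+ d)%:E * leb2 X)%E.
Proof.
move=> s0 mX; rewrite /product_measure1.
have sV0 : 0 <= s^-1 ^+ d by rewrite exprn_ge0// invr_ge0 ltW.
rewrite -ge0_integralZl//.
- apply: eq_integral => x _ /=.
  transitivity (leb ((fun y => s *: y + th x) @^-1` xsection X x)).
    by congr (leb _); apply/seteqP; split => y /=; rewrite /xsection/= !inE.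
  by rewrite leb_affine//; exact: measurable_xsection.
- exact: measurable_fun_xsection.
Qed.

Lemma leb2_shear1 (th : E -> E) (X : set (E * E)) : measurable_fun setT th -> measurable X ->
  leb2 ((fun z => (z.1 + th z.2, z.2)) @^-1` X) = leb2 X.
Proof.
move=> mth mX.
have mS : measurable_fun setT (fun z : E * E => (z.1 + th z.2, z.2)).
  apply/measurable_fun_pairP; split => /=; last exact: measurable_snd.
  apply: measurable_fun_rV => i; under eq_fun do rewrite mxE.
  apply: measurable_funD; first exact: (measurableT_comp (measurable_coord i) measurable_fst).
  exact: (measurableT_comp (measurable_coord i) (measurableT_comp mth measurable_snd)).
rewrite !product_lebE2//; last exact: measurable_preimage.
apply: eq_integral => y _ /=.
transitivity (leb ((fun x => 1 *: x + th y) @^-1` ysection X y)).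
  by congr (leb _); apply/seteqP; split => x /=; rewrite /ysection/= !inE scale1r.
by rewrite leb_affine//; [rewrite invr1 expr1n mul1e|exact: measurable_ysection].
Qed.

(* The map (x, y) -> (x + a (y - x), x + b (y - x)) has Jacobian (b - a)^d. *)
Lemma leb2_segment (a b : R) (A B : set E) : a < b -> measurable A -> measurable B ->
  leb2 [set z | A (z.1 + a *: (z.2 - z.1)) /\ B (z.1 + b *: (z.2 - z.1))] =
  (((b - a)^-1 ^+ d)%:E * (leb A * leb B))%E.
Proof.
move=> ab mA mB.
(* The map is a composition of three maps that each move one of the two components; only the last
   one has a Jacobian other than 1. *)
pose s1 (z : E * E) := (z.1, 1 *: z.2 + - z.1).
pose s2 (z : E * E) := (z.1 + a *: z.2, z.2).
pose s3 (z : E * E) := (z.1, (b - a) *: z.2 + z.1).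
have -> : [set z | A (z.1 + a *: (z.2 - z.1)) /\ B (z.1 + b *: (z.2 - z.1))] =
    s1 @^-1` (s2 @^-1` (s3 @^-1` (A `*` B))).
  apply/seteqP; split => -[x y] /=; rewrite /s3 /s2 /s1/= scale1r;
  by rewrite (_ : (b - a) *: (y - x) + (x + a *: (y - x)) = x + b *: (y - x))//;
     rewrite scalerBl addrCA subrK.
have mAB : measurable (A `*` B) by exact: measurableX.
have m3 : measurable (s3 @^-1` (A `*` B)).
  apply: measurable_preimage => //; apply/measurable_fun_pairP; split => /=.
    exact: measurable_fst.
  apply: measurable_fun_rV => i; under eq_fun do rewrite !mxE.
  apply: measurable_funD.
    apply: measurable_funM => //.
    exact: (measurableT_comp (measurable_coord i) measurable_snd).
  exact: (measurableT_comp (measurable_coord i) measurable_fst).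
have ms : measurable_fun setT (fun y : E => a *: y).
  have := @measurable_fun_affine d a 0; congr (measurable_fun _ _).
  by apply/funext => x; rewrite addr0.
have m2 : measurable (s2 @^-1` (s3 @^-1` (A `*` B))).
  apply: measurable_preimage => //; apply/measurable_fun_pairP; split => /=; last exact: measurable_snd.
  apply: measurable_fun_rV => i; under eq_fun do rewrite !mxE.
  apply: measurable_funD; first exact: (measurableT_comp (measurable_coord i) measurable_fst).
  apply: measurable_funM => //.
  exact: (measurableT_comp (measurable_coord i) measurable_snd).
rewrite (leb2_shear2 (fun x => - x) ltr01 m2) invr1 expr1n mul1e.
rewrite (leb2_shear1 ms m3).
rewrite (@leb2_shear2 (b - a) id) ?subr_gt0//.
by congr (_ * _)%E; rewrite product_measure1E.
Qed.

End shear.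
End lebesgue_rV_affine.

(** * Supports, nets and cells *)

Section support.
Context {R : realType} {d : nat}.
Local Notation E := 'rV[R]_d.

Lemma compact_enorm_bounded (A : set E) : compact A ->
  exists2 M, 0 < M & forall x, A x -> enorm x <= M.
Proof.
move=> /compact_bounded[M0 [_ HM]].
pose M1 := Num.max 0 M0 + 1.
have M10 : 0 < M1 by rewrite ltr_wpDl// le_max lexx.
have M0M : M0 < M1 by rewrite ltr_pwDr// le_max lexx orbT.
exists (d%:R * (M1 + 1) + 1) => [|x Ax].
  by rewrite ltr_wpDl// mulr_ge0//; lra.
apply: (@le_trans _ _ (d%:R * (M1 + 1))); last by rewrite lerDl.
apply: enorm_le_coord => [|i]; first by lra.
have := HM _ M0M x Ax => xM.
have : ball (0 : E) (M1 + 1) x.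
  by rewrite -ball_normE/= sub0r normrN; apply: le_lt_trans xM _; lra.
by move=> [_ /(_ 0 i)]; rewrite /ball/= !mxE sub0r normrN => /ltW.
Qed.

Lemma enorm_le_ediam (A : set E) x y : compact A -> A x -> A y ->
  enorm (x - y) <= ediam A.
Proof.
move=> /compact_enorm_bounded[M M0 HM] Ax Ay; apply: ub_le_sup.
  exists (M + M) => _ [[a b] [/= Aa Ab] <-].
  by apply: le_trans (enormD a (- b)) _; rewrite enormN lerD// HM.
by exists (x, y).
Qed.

Definition rational_box (p : 'rV[rat]_d * nat) : set E :=
  [set x | forall i, `|x 0 i - ratr (p.1 0 i)| < p.2.+1%:R^-1].

Lemma measurable_rational_box p : measurable (rational_box p).
Proof.
rewrite (_ : rational_box p = [set x : E | forall i,
   `]((map_mx ratr p.1 : E) 0 i - p.2.+1%:R^-1),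
     ((map_mx ratr p.1 : E) 0 i + p.2.+1%:R^-1)[%classic (x 0 i)]).
  exact: measurable_box.
by apply/seteqP; split => x /= + i => /(_ i); rewrite !mxE /= in_itv/= ltr_distl.
Qed.

Lemma rational_box_basis (U : set E) x : open U -> U x -> exists p, rational_box p x /\ rational_box p `<=` U.
Proof.
move=> oU Ux.
have /nbhs_ballP[e /= e0 xeU] : nbhs x U by exact: open_nbhs_nbhs.
pose k := Num.trunc (2 / e).
have ke : 2 * k.+1%:R^-1 < e.
  by rewrite ltr_pdivrMr// mulrC -ltr_pdivrMr// truncnS_gt.
have /choice[q xq] (i : 'I_d) :
    exists q : rat, `|x 0 i - ratr q| < k.+1%:R^-1.
  have [|q] := @rat_in_itvoo R (x 0 i - k.+1%:R^-1) (x 0 i + k.+1%:R^-1).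
    by rewrite ltrD2l gtrN// invr_gt0.
  by rewrite in_itv/= => qx; exists q; rewrite ltr_distlC.
exists (\row_i q i, k); split => [i|y yq]; first by rewrite /= mxE.
apply: xeU; split=> // i j; rewrite (ord1 i) /ball/=.
apply: lt_trans ke; rewrite mulrC mulr_natr.
have := yq j; rewrite /= mxE distrC => yqj.
by rewrite (le_lt_trans (ler_distD (ratr (q j)) _ _))// mulr2n ltrD.
Qed.

Section probability.
Context (mu : probability E R).
Local Notation A := (msupport mu).

Lemma msupport_closedC : open (~` A).
Proof.
rewrite openE => x /=; rewrite /msupport/= => /existsNP[U].
move=> /not_implyP[oU] /not_implyP[Ux nU].
apply: (@filterS _ (nbhs x) _ U); last exact: open_nbhs_nbhs.
by move=> y Uy /(_ U oU Uy).
Qed.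

Lemma measurable_msupport : measurable A.
Proof.
rewrite -[A]setCK; apply: measurableC; apply: open_measurable_rV.
exact: msupport_closedC.
Qed.

(** A point off the support has a null neighbourhood, hence a null rational box around it, and there
    are countably many such boxes. *)
Lemma msupport_setC0 : mu (~` A) = 0%E.
Proof.
pose F n := if unpickle n is Some p then
   if mu (rational_box p) == 0%E then rational_box p else set0 else set0.
have sub : ~` A `<=` \bigcup_n F n.
  move=> x /=; rewrite /msupport/= => /existsNP[U].
  move=> /not_implyP[oU] /not_implyP[Ux nU].
  have [p [px pU]] := rational_box_basis oU Ux.
  exists (pickle p) => //; rewrite /F pickleK.
  have -> : mu (rational_box p) = 0%E.
    apply/eqP; rewrite eq_le measure_ge0 andbT.
    apply: (@le_trans _ _ (mu U)); last by rewrite leNgt; apply/negP.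
    by apply: le_measure; rewrite ?inE; [exact: measurable_rational_box|exact: open_measurable_rV|].
  by rewrite eqxx.
have neg : mu.-negligible (\bigcup_n F n).
  apply: negligible_bigcup => n; rewrite /F; case: unpickle => [p|]; last exact: negligible_set0.
  case: ifPn => [/eqP p0|_]; last exact: negligible_set0.
  by exists (rational_box p); split => //; exact: measurable_rational_box.
have := negligibleS sub neg; rewrite negligibleP//.
by apply: measurableC; exact: measurable_msupport.
Qed.

Lemma msupport1 : mu A = 1%E.
Proof.
have := probability_setC mu (measurableC measurable_msupport).
by rewrite setCK msupport_setC0 sube0.
Qed.

Lemma msupport_setI S : measurable S -> mu (S `&` A) = mu S.
Proof.
move=> mS; have mA := measurable_msupport.
rewrite -[in RHS](setIT S) -(setUv A) setIUr measureU//.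
- rewrite [X in (_ + X)%E](_ : _ = 0%E) ?adde0//.
  apply/eqP; rewrite eq_le measure_ge0 andbT -msupport_setC0.
  by apply: le_measure; rewrite ?inE; [apply: measurableI => //; exact: measurableC|exact: measurableC|].
- exact: measurableI.
- by apply: measurableI => //; exact: measurableC.
- by rewrite setIACA setICr setI0.
Qed.

Lemma msupport_neq0 : exists x, A x.
Proof.
apply: contrapT => /forallNP H; have := msupport1.
by rewrite (_ : A = set0) ?measure0; [move=> /esym/eqP; rewrite onee_eq0|rewrite -subset0].
Qed.

Lemma probability_fineK S : measurable S -> (fine (mu S))%:E = mu S.
Proof. by move=> mS; rewrite fineK// fin_num_measure. Qed.

Lemma le_min_ball_mass r x : A x -> ((min_ball_mass mu A r)%:E <= mu (eball x r))%E.
Proof.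
move=> Ax; rewrite -probability_fineK ?lee_fin; last exact: measurable_eball.
apply: ge_inf; last by exists x.
by exists 0 => _ [y _ <-]; exact: fine_ge0.
Qed.

End probability.
End support.

Section nets.
Context {R : realType} {d : nat} (d0 : (0 < d)%N).
Local Notation E := 'rV[R]_d.

Definition separated (A : set E) (rho : R) N (x : 'I_N -> E) :=
  (forall k, A (x k)) /\ (forall k l, k != l -> rho <= enorm (x k - x l)).

(** Packing by volume: the boxes of half-side [rho / (4 d)] around the points lie in balls of radius
    [rho / 2], so they are disjoint, and all are contained in the box of half-side [M + rho]. *)
Lemma separated_card (A : set E) (rho M : R) N (x : 'I_N -> E) : 0 < rho -> 0 < M ->
  (forall x, A x -> enorm x <= M) -> separated A rho x ->
  N%:R <= ((4 * d%:R * (M + rho)) / rho) ^+ d.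
Proof.
move=> rho0 M0 HM [Ax sep].
have dR : 0 < d%:R :> R by rewrite ltr0n.
pose s := rho / (4 * d%:R).
have s0 : 0 < s by rewrite divr_gt0// mulr_gt0.
pose F (k : 'I_N) := [set y : E | forall i, `](x k 0 i - s), (x k 0 i + s)[%classic (y 0 i)].
have mF k : measurable (F k) by exact: measurable_box.
have Fball k : F k `<=` eball (x k) (rho / 2).
  apply: box_sub_eball => //.
  have -> : d%:R * s = rho / 4 by rewrite /s; field; rewrite gt_eqF.
  by lra.
have tF : trivIset setT F.
  apply/trivIsetP => k l _ _ kl; rewrite -subset0 => y [/Fball + /Fball].
  rewrite /eball/= => yk yl; have := sep k l kl.
  have := enorm_dist y (x k) (x l); rewrite (enormB (x k) y); lra.
pose B := [set y : E | forall i,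
  `]((0 : E) 0 i - (M + rho)), ((0 : E) 0 i + (M + rho))[%classic (y 0 i)].
have sub : \big[setU/set0]_(k < N) F k `<=` B.
  rewrite -bigcup_seq; move=> y [k _]/Fball yk i /=.
  rewrite mxE sub0r add0r in_itv/= -ltr_norml.
  apply: le_lt_trans (coord_le_enorm y i) _.
  move: yk; rewrite /eball/= => yk; have := HM _ (Ax k).
  have := enorm_dist (x k) y 0; rewrite !subr0; lra.
have : (leb (\big[setU/set0]_(k < N) F k) <= leb B)%E.
  by apply: le_measure; rewrite ?inE//; [exact: bigsetU_measurable|exact: measurable_box].
rewrite measure_semi_additive_ord//; last exact: bigsetU_measurable.
rewrite (eq_bigr (fun=> ((2 * s) ^+ d)%:E)); last by move=> k _; exact: (leb_box (x k) (ltW s0)).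
have Mrho : 0 <= M + rho by lra.
rewrite [X in (_ <= X)%E](leb_box 0 Mrho).
rewrite sumEFin lee_fin sumr_const card_ord -[X in X <= _]mulr_natl => H.
have -> : 4 * d%:R * (M + rho) / rho = (2 * (M + rho)) / (2 * s).
  by rewrite /s; field; rewrite !gt_eqF.
by rewrite expr_div_n ler_pdivlMr//; apply: exprn_gt0; rewrite mulr_gt0.
Qed.

(** The packing bound gives a separated family of maximal size; a point it left uncovered could be
    added to it. *)
Lemma maximal_net (A : set E) (rho M : R) : 0 < rho -> 0 < M ->
  (forall x, A x -> enorm x <= M) -> 
  exists N (x : 'I_N -> E), [/\ separated A rho x,
    forall y, A y -> exists k, enorm (y - x k) < rho &
    N%:R <= ((4 * d%:R * (M + rho)) / rho) ^+ d].
Proof.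
move=> rho0 M0 HM.
pose P N := `[< exists x : 'I_N -> E, separated A rho x >].
have exP : exists N, P N.
  exists 0%N; apply/asboolP; exists (fun=> 0); split; by case.
have ubP N : P N -> (N <= Num.truncn (((4 * d%:R * (M + rho)) / rho) ^+ d))%N.
  move=> /asboolP[x sx]; rewrite -ltnS -(ltr_nat R).
  by apply: le_lt_trans (separated_card rho0 M0 HM sx) _; exact: truncnS_gt.
have [N /asboolP[x sx] maxN] := ex_maxnP exP ubP.
exists N, x; split => //; last exact: separated_card sx.
move=> y Ay; apply: contrapT => /forallNP ny.
have : P N.+1.
  apply/asboolP.
  exists (fun k => if unlift ord_max k is Some j then x j else y).
  case: sx => Ax sep; split => [k|k l].
    by case: unliftP => [j|] _.
  have ny' j : rho <= enorm (y - x j) by rewrite leNgt; apply/negP; exact: ny.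
  case: unliftP => [j|] ->; case: unliftP => [j'|] -> //.
  - move=> jj; apply: sep; apply: contra jj => /eqP ->; exact: eqxx.
  - by rewrite enormB.
  - by rewrite eqxx.
by move=> /maxN; rewrite ltnn.
Qed.

(** Every ball of radius [r] centred in the support contains one of finitely many balls of radius
    [r / 2], each of positive mass. *)
Lemma min_ball_mass_gt0 (mu : probability E R) (r : R) :
  compact (msupport mu) -> 0 < r -> 0 < min_ball_mass mu (msupport mu) r.
Proof.
move=> cA r0; have [M M0 HM] := compact_enorm_bounded cA.
have r20 : 0 < r / 2 by lra.
have [N [x [[Ax _] cov _]]] := maximal_net r20 M0 HM.
pose m := \big[Num.min/1]_(k < N) fine (mu (eball (x k) (r / 2))).
have m0 : 0 < m.
  rewrite /m; elim/big_ind: _ => // [a b a0 b0|k _]; first by rewrite lt_min a0.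
  rewrite -lte_fin probability_fineK; last exact: measurable_eball.
  by apply: (Ax k); [exact: eball_open|exact: eball_center].
apply: lt_le_trans m0 _; apply: lb_le_inf.
  by have [y Ay] := msupport_neq0 mu; exists (fine (mu (eball y r))), y.
move=> _ [y Ay <-]; have [k yk] := cov y Ay.
apply: (@le_trans _ _ (fine (mu (eball (x k) (r / 2))))).
  by rewrite /m (bigD1 k)//= ge_min lexx.
rewrite -lee_fin !probability_fineK; [|exact: measurable_eball..].
apply: le_measure; rewrite ?inE; [exact: measurable_eball..|].
move=> z; rewrite /eball/= => zk.
have := enorm_dist (x k) z y; rewrite (enormB (x k) y); lra.
Qed.

End nets.

Section weighted_indicators.
Context {d : measure_display} {T : measurableType d} {R : realType}.
Context (mu : {measure set T -> \bar R}).

Lemma integral_sum_indic (I : finType) (c : I -> R) (F : I -> set T) :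
  (forall i, 0 <= c i) -> (forall i, measurable (F i)) ->
  (\int[mu]_x (\sum_i c i * \1_(F i) x)%:E = \sum_i (c i)%:E * mu (F i))%E.
Proof.
move=> c0 mF.
under eq_integral do rewrite -sumEFin.
rewrite ge0_integral_sum//.
- apply: eq_bigr => i _; rewrite (eq_integral (fun x => (c i)%:E * (\1_(F i) x)%:E)%E)//.
  rewrite ge0_integralZl ?lee_fin//; first by rewrite integral_indic// setIT.
  by apply/measurable_EFinP; exact: measurable_indic.
- by move=> i; apply/measurable_EFinP; apply: measurable_funM => //; exact: measurable_indic.
- by move=> i x _; rewrite lee_fin mulr_ge0// indicE ler0n.
Qed.

(** Turns a pointwise comparison of weighted families of sets into one of their measures; the
    telescoping along segments is integrated in this form. *)
Lemma le_sum_indic (I J : finType) (c : I -> R) (F : I -> set T)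
    (e : J -> R) (G : J -> set T) :
  (forall i, 0 <= c i) -> (forall i, measurable (F i)) ->
  (forall j, 0 <= e j) -> (forall j, measurable (G j)) ->
  (forall x, \sum_i c i * \1_(F i) x <= \sum_j e j * \1_(G j) x) ->
  (\sum_i (c i)%:E * mu (F i) <= \sum_j (e j)%:E * mu (G j))%E.
Proof.
move=> c0 mF e0 mG H; rewrite -!integral_sum_indic//.
have mS (K : finType) (b : K -> R) (S : K -> set T) : (forall k, measurable (S k)) ->
    measurable_fun setT (fun x => (\sum_i b i * \1_(S i) x)%:E).
  move=> mSk; apply/measurable_EFinP; apply: measurable_sum => k.
  by apply: measurable_funM => //; exact: measurable_indic.
apply: ge0_le_integral => //.
- by move=> x _; rewrite lee_fin sumr_ge0// => i _; rewrite mulr_ge0// indicE ler0n.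
- exact: mS.
- exact: mS.
- by move=> x _; rewrite lee_fin.
Qed.

End weighted_indicators.

Section cells.
Context {d : measure_display} {T : measurableType d}.

(** A rule that only depends on which of finitely many sets contain the point selects a finite union
    of intersections, however the rule itself is chosen. *)
Lemma measurable_finite_code (I : finType) (S : I -> set T) (J : finType)
    (G : {ffun I -> bool} -> J) (j : J) :
  (forall i, measurable (S i)) ->
  measurable [set x | G [ffun i => `[< S i x >]] = j].
Proof.
move=> mS.
rewrite (_ : [set _ | _] = \big[setU/set0]_(b <- [seq b | b <- enum {ffun I -> bool} & G b == j])
    \bigcap_(i in [set: I]) (if b i then S i else ~` S i)).
  apply: bigsetU_measurable => b _; apply: fin_bigcap_measurable => // i _.
  by case: ifP => _ //; exact: measurableC.
rewrite -bigcup_seq; apply/seteqP; split => x /=.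
  move=> Gj; exists [ffun i => `[< S i x >]].
    by rewrite /= map_id mem_filter Gj eqxx mem_enum.
  by move=> i _; rewrite ffunE; case: ifPn => [/asboolP|/asboolPn].
move=> [b]; rewrite /= map_id mem_filter => /andP[/eqP <- _] H.
congr (G _); apply/ffunP => i; rewrite ffunE.
have := H i Logic.I; case: ifP => bi Sx; first by apply/asboolP.
by apply/asboolPn.
Qed.

End cells.

(** * Convex supports with bounded density: ball masses and the Poincare inequality *)

Section convex_density.
Context {R : realType} {d : nat} (d0 : (0 < d)%N).
Local Notation E := 'rV[R]_d.
Context (P : probability E R) (dens : E -> R) (lam Lam : R).
Local Notation A := (msupport P).
Hypothesis cA : compact A.
Hypothesis convA : convex_set A.
Hypothesis densP : has_lebesgue_density P dens.
Hypothesis lam0 : 0 < lam.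
Hypothesis dens_bnd : forall x, A x -> lam <= dens x <= Lam.

Let mA : measurable A. Proof. exact: measurable_msupport. Qed.

Lemma lam_le_Lam : lam <= Lam.
Proof. by have [x /dens_bnd/andP[]] := msupport_neq0 P; exact: le_trans. Qed.

Lemma Lam_gt0 : 0 < Lam. Proof. exact: lt_le_trans lam0 lam_le_Lam. Qed.

Lemma convex_segment x y (s : R) : A x -> A y -> 0 <= s <= 1 -> A (x + s *: (y - x)).
Proof.
move=> Ax Ay /andP[s0 s1].
have := convA (Itv01 s0 s1) (mem_set Ay) (mem_set Ax); rewrite inE.
congr (A _).
rewrite /conv/= /unstable.onem/= scalerBr addrCA scalerBl scale1r.
by congr (_ + _).
Qed.

Lemma density_le S : measurable S -> (P S <= Lam%:E * leb (S `&` A))%E.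
Proof.
move=> mS; case: densP => mdens dens0 PE.
rewrite -(msupport_setI P mS) PE; last exact: measurableI.
apply: (@le_trans _ _ (\int[@leb R d]_(x in S `&` A) (cst Lam%:E x))%E).
  apply: ge0_le_integral => //.
  - exact: measurableI.
  - by move=> x _; rewrite lee_fin.
  - by apply/measurable_EFinP; exact: measurable_funS mdens.
  - by move=> x [_ Ax]; rewrite lee_fin; case/andP: (dens_bnd Ax).
by rewrite integral_cst//; exact: measurableI.
Qed.

Lemma density_ge S : measurable S -> (lam%:E * leb (S `&` A) <= P S)%E.
Proof.
move=> mS; case: densP => mdens dens_0 PE.
rewrite -(msupport_setI P mS) PE; last exact: measurableI.
apply: (@le_trans _ _ (\int[@leb R d]_(x in S `&` A) (cst lam%:E x))%E).
  by rewrite integral_cst//; exact: measurableI.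
apply: ge0_le_integral => //.
- exact: measurableI.
- by move=> x _; rewrite lee_fin ltW.
- by apply/measurable_EFinP; exact: measurable_funS mdens.
- by move=> x [_ Ax]; rewrite lee_fin; case/andP: (dens_bnd Ax).
Qed.

Lemma leb_support_fin S : measurable S -> leb (S `&` A) \is a fin_num.
Proof.
move=> mS; rewrite ge0_fin_numE//.
have H := density_ge mS.
rewrite ltey; apply/eqP => E1; move: H; rewrite E1 gt0_muley ?lte_fin// leye_eq => /eqP.
by apply/eqP; rewrite lt_eqF// ltey_eq fin_num_measure.
Qed.

Lemma ball_mass_le x r : 0 <= r -> (P (eball x r) <= (Lam * (2 * r) ^+ d)%:E)%E.
Proof.
move=> r0; apply: le_trans (density_le (measurable_eball x r)) _.
rewrite EFinM lee_pmul2l ?lte_fin ?Lam_gt0//.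
rewrite -(leb_box x r0); apply: le_measure; rewrite ?inE.
- by apply: measurableI => //; exact: measurable_eball.
- exact: measurable_box.
- by move=> y [/eball_sub_box].
Qed.

(* By convexity the homothety of centre [x] and ratio [rho / D] maps the support
   into the ball. *)
Lemma ball_mass_ge x (rho D : R) : A x -> 0 < rho -> rho <= D -> ediam A < D ->
  ((lam / Lam * (rho / D) ^+ d)%:E <= P (eball x rho))%E.
Proof.
move=> Ax rho0 rhoD diamD.
have D0 : 0 < D by exact: lt_le_trans rhoD.
pose s := rho / D.
have s0 : 0 < s by rewrite divr_gt0.
have s1 : s <= 1 by rewrite ler_pdivrMr// mul1r.
pose T := fun y : E => s^-1 *: y + (x - s^-1 *: x).
have sub : T @^-1` A `<=` eball x rho `&` A.
  move=> y /= ATy.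
  have yE : y = x + s *: (T y - x).
    have -> : T y - x = s^-1 *: (y - x).
      by rewrite /T scalerBr -addrA; congr (_ + _); rewrite addrAC subrr add0r.
    by rewrite scalerA divff ?gt_eqF// scale1r addrC subrK.
  split.
    rewrite /eball/= {1}yE addrAC subrr add0r enormZ gtr0_norm//.
    rewrite /s mulrAC ltr_pdivrMr// ltr_pM2l//.
    exact: le_lt_trans (enorm_le_ediam cA ATy Ax) diamD.
  by rewrite yE; apply: convex_segment => //; rewrite (ltW s0).
have mT : measurable (T @^-1` A).
  by apply: measurable_preimage => //; exact: measurable_fun_affine.
have Pge : (lam%:E * leb (T @^-1` A) <= P (eball x rho))%E.
  apply: le_trans (density_ge (measurable_eball x rho)).
  rewrite lee_pmul2l ?lte_fin//; apply: le_measure; rewrite ?inE//.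
  by apply: measurableI => //; exact: measurable_eball.
apply: le_trans Pge; rewrite /T leb_affine ?invr_gt0// invrK -/s.
have LA : ((Lam^-1)%:E <= leb A)%E.
  have Lfin : leb A \is a fin_num by rewrite -(setTI A); exact: leb_support_fin.
  have := density_le measurableT; rewrite probability_setT setTI.
  rewrite -(fineK Lfin) -EFinM !lee_fin => H.
  by rewrite -[X in X <= _]mul1r ler_pdivrMr ?Lam_gt0// mulrC.
rewrite muleA -EFinM.
apply: (@le_trans _ _ ((lam * s ^+ d)%:E * (Lam^-1)%:E)%E).
  by rewrite -EFinM lee_fin /s; have -> : lam / Lam * (rho / D) ^+ d =
    lam * (rho / D) ^+ d * Lam^-1 by ring.
by rewrite lee_pmul2l// ?lte_fin ?mulr_gt0 ?exprn_gt0.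
Qed.

Section poincare.
Context (N : nat) (cell : E -> 'I_N).
Hypothesis mcell : forall k, measurable [set x | cell x = k].

Definition cell_mass k : R := fine (P [set x | cell x = k]).

(** Nearness is witnessed by points of the support, so that consecutive points of a walk inside the
    support certify it for their cells. *)
Definition near_cells (e : R) (k l : 'I_N) : bool :=
  `[< exists x y, [/\ A x, A y, cell x = k, cell y = l & enorm (x - y) <= e] >].

(* Walk from x to y in K equal steps; (x, y) -> (z_m, z_m+1) has Jacobian K^-d. *)
Let lebesgue_poincare (K : nat) (w : 'I_N -> R) : (0 < K)%N ->
  let a k := fine (leb ([set x | cell x = k] `&` A)) in
  \sum_k \sum_l a k * a l * (w k - w l) ^+ 2 <=
  K%:R ^+ (d + 2) *
    \sum_k \sum_(l | near_cells (ediam A / K%:R) k l) a k * a l * (w k - w l) ^+ 2.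
Proof.
move=> K0; set a := fun k => _; rewrite /=.
have KR : 0 < K%:R :> R by rewrite ltr0n.
pose ak k := [set x | cell x = k] `&` A.
have mak k : measurable (ak k) by exact: measurableI.
have aE k : (a k)%:E = leb (ak k).
  by rewrite /a fineK//; exact: leb_support_fin.
have a0 k : 0 <= a k by exact: fine_ge0.
pose near := near_cells (ediam A / K%:R).
pose z (m : nat) (p : E * E) := p.1 + (m%:R / K%:R) *: (p.2 - p.1).
pose F (kl : 'I_N * 'I_N) : set (E * E) := ak kl.1 `*` ak kl.2.
pose c (kl : 'I_N * 'I_N) := (w kl.1 - w kl.2) ^+ 2.
pose G (mkl : 'I_K * ('I_N * 'I_N)) : set (E * E) :=
  [set p | ak mkl.2.1 (z mkl.1 p) /\ ak mkl.2.2 (z mkl.1.+1 p)].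
(* The factor [K] is that of Cauchy-Schwarz over the [K] steps. Pairs of cells that are not near get
   weight 0, as no step of a walk in the support joins them. *)
pose e (mkl : 'I_K * ('I_N * 'I_N)) :=
  K%:R * (if near mkl.2.1 mkl.2.2 then c mkl.2 else 0).
have c0 kl : 0 <= c kl by exact: sqr_ge0.
have e0 m : 0 <= e m by rewrite /e mulr_ge0//; case: ifP.
have mG m : measurable (G m).
  have mz j : measurable_fun setT (z j).
    apply: measurable_fun_rV => i; under eq_fun do rewrite !mxE.
    have m1 := measurableT_comp (@measurable_coord R d i) (@measurable_fst _ _ E E).
    have m2 := measurableT_comp (@measurable_coord R d i) (@measurable_snd _ _ E E).
    apply: measurable_funD; first exact: m1.
    apply: measurable_funM => //; exact: measurable_funB m2 m1.
  rewrite (_ : G m = (z m.1 @^-1` ak m.2.1) `&` (z m.1.+1 @^-1` ak m.2.2))//.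
  by apply: measurableI; exact: measurable_preimage.
have leb2G m : (@leb R d \x @leb R d)%E (G m) =
    ((K%:R ^+ d) * (a m.2.1 * a m.2.2))%:E.
  have ltm : m.1%:R / K%:R < m.1.+1%:R / K%:R :> R.
    by rewrite ltr_pM2r ?invr_gt0// ltr_nat.
  have := leb2_segment ltm (mak m.2.1) (mak m.2.2).
  rewrite -mulrBl -natrB// subSnn mul1r invrK !EFinM !aE => <-.
  by [].
have leb2F kl : (@leb R d \x @leb R d)%E (F kl) = (a kl.1 * a kl.2)%:E.
  by rewrite product_measure1E// EFinM !aE.
have main p : \sum_kl c kl * \1_(F kl) p <= \sum_m e m * \1_(G m) p.
  have [[Ax Ay]|nA] := pselect (A p.1 /\ A p.2); last first.
    rewrite [leLHS]big1 => [|kl _].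
      by apply: sumr_ge0 => m _; rewrite mulr_ge0// indicE ler0n.
    rewrite indicE memNset ?mulr0// => -[[_ /= Ax] [_ /= Ay]]; exact: nA.
  have zA (m : nat) : (m <= K)%N -> A (z m p).
    move=> mK; apply: convex_segment => //; rewrite divr_ge0//=.
    by rewrite ler_pdivrMr// mul1r ler_nat.
  pose k_ m := cell (z m p).
  have -> : \sum_kl c kl * \1_(F kl) p = (w (k_ 0%N) - w (k_ K)) ^+ 2.
    have z0 : z 0%N p = p.1 by rewrite /z mul0r scale0r addr0.
    have zK : z K p = p.2 by rewrite /z divff ?gt_eqF// scale1r addrCA subrr addr0.
    rewrite (bigD1 (k_ 0%N, k_ K))//= big1 ?addr0.
      rewrite /k_ z0 zK indicE mem_set ?mulr1// /F/=; split; split => //=.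
    move=> [k l] /= kl; rewrite indicE memNset ?mulr0// => -[[/= h1 _] [/= h2 _]].
    by move: kl; rewrite /k_ z0 zK h1 h2 eqxx.
  have nearK (m : 'I_K) : near (k_ m) (k_ m.+1).
    apply/asboolP; exists (z m p), (z m.+1 p); split => //.
    - by apply: zA; exact: ltnW.
    - exact: zA.
    have -> : z m p - z m.+1 p = K%:R^-1 *: (p.1 - p.2).
      rewrite /z opprD addrACA subrr add0r -scalerBl -mulrBl.
      rewrite -natr1 opprD addrA subrr add0r mulN1r scaleNr -scalerN opprB.
      by [].
    rewrite enormZ gtr0_norm ?invr_gt0// mulrC ler_pM2r ?invr_gt0//.
    exact: enorm_le_ediam.
  have -> : \sum_m e m * \1_(G m) p = K%:R * \sum_(m < K) (w (k_ m) - w (k_ m.+1)) ^+ 2.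
    rewrite mulr_sumr -(pair_big xpredT xpredT (fun m kl => e (m, kl) * \1_(G (m, kl)) p))/=.
    apply: eq_bigr => m _; rewrite (bigD1 (k_ m, k_ m.+1))//= big1 ?addr0.
      rewrite /e/= nearK /c/= indicE mem_set ?mulr1// /G/=; split; split => //=.
        by apply: zA; exact: ltnW.
      exact: zA.
    move=> [k l] /= kl; rewrite indicE memNset ?mulr0// => -[[/= h1 _] [/= h2 _]].
    by move: kl; rewrite /k_ h1 h2 eqxx.
  have tele : w (k_ 0%N) - w (k_ K) = \sum_(m < K) (1 * (w (k_ m) - w (k_ m.+1))).
    under eq_bigr do rewrite mul1r.
    rewrite -(big_mkord xpredT (fun m => w (k_ m) - w (k_ m.+1))).
    rewrite -[LHS]opprB -(telescope_sumr (fun m => w (k_ m)) (leq0n K)) -sumrN.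
    by apply: eq_bigr => m _; rewrite opprB.
  rewrite tele; apply: le_trans (sqr_sumr_le _ _) _.
  by under eq_bigr do rewrite expr1n; rewrite sumr_const card_ord.
have mF kl : measurable (F kl) by exact: measurableX.
have := le_sum_indic (@leb R d \x @leb R d)%E c0 mF e0 mG main.
rewrite [X in (X <= _)%E -> _](eq_bigr (fun kl => (c kl * (a kl.1 * a kl.2))%:E)); last first.
  by move=> kl _; rewrite [RHS]EFinM; congr (_ * _)%E; exact: leb2F.
rewrite [X in (_ <= X)%E -> _](eq_bigr (fun m =>
    (e m * (K%:R ^+ d * (a m.2.1 * a m.2.2)))%:E)); last first.
  by move=> m _; rewrite [RHS]EFinM; congr (_ * _)%E; exact: leb2G.
rewrite !sumEFin lee_fin => H.
have -> : \sum_k \sum_l a k * a l * (w k - w l) ^+ 2 = \sum_kl c kl * (a kl.1 * a kl.2).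
  rewrite pair_big/=; apply: eq_bigr => kl _; exact: mulrC.
apply: le_trans H _.
rewrite -(pair_big xpredT xpredT (fun m kl => e (m, kl) * (K%:R ^+ d * (a kl.1 * a kl.2))))/=.
(* The measure of [G] does not depend on the step, so the sum over the steps is [K] equal terms.
   With the [K] of Cauchy-Schwarz and the Jacobian, the total is [K^(d + 2)]. *)
rewrite (eq_bigr (fun=> \sum_kl e (Ordinal K0, kl) * (K%:R ^+ d * (a kl.1 * a kl.2))))//.
rewrite sumr_const card_ord -[leLHS]mulr_natl.
rewrite addnC exprD expr2 -!mulrA ler_pM2l//.
rewrite mulr_sumr -(pair_big xpredT xpredT
  (fun k l => e (Ordinal K0, (k, l)) * (K%:R ^+ d * (a k * a l))))/=.
rewrite mulr_sumr; apply: ler_sum => k _.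
rewrite mulr_sumr mulr_sumr [leRHS]big_mkcond/=; apply: ler_sum => l _.
rewrite /e/= -/near; case: ifP => _; last by rewrite mulr0 mul0r.
by rewrite /c/=; rewrite le_eqVlt; apply/orP; left; apply/eqP; ring.
Qed.

(** Both sides are quadratic in the cell masses, so passing from volume to [P] costs [Lam^2] on one
    side and [lam^2] on the other. *)
Lemma cell_poincare (K : nat) (w : 'I_N -> R) : (0 < K)%N ->
  \sum_k \sum_l cell_mass k * cell_mass l * (w k - w l) ^+ 2 <=
  (Lam ^+ 2 / lam ^+ 2 * K%:R ^+ (d + 2)) *
    \sum_k \sum_(l | near_cells (ediam A / K%:R) k l)
      cell_mass k * cell_mass l * (w k - w l) ^+ 2.
Proof.
move=> K0; pose a k := fine (leb ([set x | cell x = k] `&` A)).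
have L0 := Lam_gt0.
have aE k : (a k)%:E = leb ([set x | cell x = k] `&` A).
  by rewrite /a fineK//; exact: leb_support_fin.
have pE k : (cell_mass k)%:E = P [set x | cell x = k] by exact: probability_fineK.
have a0 k : 0 <= a k by exact: fine_ge0.
have p0 k : 0 <= cell_mass k by exact: fine_ge0.
have pLe k : cell_mass k <= Lam * a k.
  by rewrite -lee_fin EFinM pE aE; exact: density_le.
have pGe k : lam * a k <= cell_mass k.
  by rewrite -lee_fin EFinM pE aE; exact: density_ge.
apply: (@le_trans _ _ (Lam ^+ 2 * \sum_k \sum_l a k * a l * (w k - w l) ^+ 2)).
  rewrite mulr_sumr; apply: ler_sum => k _; rewrite mulr_sumr; apply: ler_sum => l _.
  rewrite mulrA ler_wpM2r ?sqr_ge0//.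
  rewrite (_ : Lam ^+ 2 * (a k * a l) = (Lam * a k) * (Lam * a l)); last by ring.
  exact: ler_pM.
set X := \sum_k \sum_(l | near_cells _ k l) _.
have -> : Lam ^+ 2 / lam ^+ 2 * K%:R ^+ (d + 2) * X =
    Lam ^+ 2 * (K%:R ^+ (d + 2) * ((lam ^+ 2)^-1 * X)) by ring.
apply: ler_wpM2l; first exact: sqr_ge0.
apply: le_trans (lebesgue_poincare w K0) _.
apply: ler_wpM2l; first by rewrite exprn_ge0.
rewrite ler_pdivlMl ?exprn_gt0// /X.
rewrite mulr_sumr; apply: ler_sum => k _; rewrite mulr_sumr; apply: ler_sum => l _.
rewrite mulrA ler_wpM2r ?sqr_ge0//.
rewrite (_ : lam ^+ 2 * (a k * a l) = (lam * a k) * (lam * a l)); last by ring.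
by apply: ler_pM => //; rewrite mulr_ge0// ltW.
Qed.

End poincare.
End convex_density.

Section cell_partition.
Context {R : realType} {d : nat} (d0 : (0 < d)%N).
Local Notation E := 'rV[R]_d.

(* Every point goes to the ball of radius [rho] of the net containing it if there
   is one, and otherwise to a point of the net at distance less than [2 rho]. *)
Lemma exists_cells (A : set E) (rho M : R) : 0 < rho -> 0 < M ->
  (exists x, A x) -> (forall x, A x -> enorm x <= M) ->
  exists N (cell : E -> 'I_N), [/\
    forall k, measurable [set x | cell x = k],
    forall x y, A x -> A y -> cell x = cell y -> enorm (x - y) <= 4 * rho,
    forall k, exists2 x, A x & eball x rho `<=` [set y | cell y = k] &
    N%:R <= ((4 * d%:R * (M + 2 * rho)) / (2 * rho)) ^+ d].
Proof.
move=> rho0 M0 [x0 Ax0] HM.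
have rho20 : 0 < 2 * rho by lra.
have [N [x [[Ax sep] cov Nle]]] := maximal_net d0 rho20 M0 HM.
have [k0 _] := cov x0 Ax0.
pose S (i : 'I_N + 'I_N) : set E :=
  match i with inl k => eball (x k) rho | inr k => eball (x k) (2 * rho) end.
(* Small balls have priority, so each cell contains its own. The default [k0] is reached only off
   [A], which the balls of radius [2 rho] cover. *)
pose G (b : {ffun 'I_N + 'I_N -> bool}) : 'I_N :=
  if [pick k | b (inl k)] is Some k then k
  else if [pick k | b (inr k)] is Some k then k else k0.
pose code y : {ffun 'I_N + 'I_N -> bool} := [ffun i => `[< S i y >]].
exists N, (fun y => G (code y)); split => //.
- by move=> k; apply: measurable_finite_code => -[j|j]; exact: measurable_eball.
- have near y : A y -> enorm (y - x (G (code y))) <= 2 * rho.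
    move=> Ay; rewrite /G; case: pickP => [k|_].
      rewrite ffunE => /asboolP; rewrite /S /eball/= => yk; lra.
    case: pickP => [k|H]; first by rewrite ffunE => /asboolP; rewrite /S /eball/= => /ltW.
    by have [k yk] := cov y Ay; have := H k; rewrite ffunE => /asboolP.
  move=> y z Ay Az yz; have := near y Ay; have := near z Az; rewrite -yz.
  set c := x _ => zc yc; have := enorm_dist c y z; rewrite (enormB c z); lra.
- move=> k; exists (x k) => // y yk /=; rewrite /G; case: pickP => [l|H].
    rewrite ffunE => /asboolP; rewrite /S => yl.
    apply/eqP; apply: contraT => lk; have := sep l k lk.
    move: yl yk; rewrite /eball/= => yl yk.
    by have := enorm_dist y (x l) (x k); rewrite (enormB (x l) y); lra.
  by have := H k; rewrite ffunE => /asboolP.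
Qed.

End cell_partition.

(** * Second moments over independent samples *)

Section bounded_integrals.
Context {d : measure_display} {T : measurableType d} {R : realType}.
Context (mu : {measure set T -> \bar R}).

Lemma bounded_integrable (D : set T) (f : T -> R) (M : R) : measurable D ->
  (mu D < +oo)%E -> measurable_fun D f -> (forall x, D x -> `|f x| <= M) ->
  mu.-integrable D (EFin \o f).
Proof.
move=> mD muD mf fM; apply: measurable_bounded_integrable => //.
exists M; split; first exact: num_real.
by move=> N MN x Dx; apply: le_trans (fM x Dx) (ltW MN).
Qed.

End bounded_integrals.

Lemma probability_integrable {d : measure_display} {T : measurableType d} {R : realType}
    (P : probability T R) (f : T -> R) (M : R) :
  measurable_fun setT f -> (forall x, `|f x| <= M) -> P.-integrable setT (EFin \o f).
Proof.
move=> mf fM; apply: bounded_integrable => //.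
by apply: (@le_lt_trans _ _ 1%E); [exact: probability_le1|exact: ltry].
Qed.


Section samples.
Context {R : realType} {d : nat}.
Local Notation E := 'rV[R]_d.

(** Columns are then treated as rows, and deviations of the first sample as deviations of the
    second. *)
Lemma independent_samplesC d' (W : measurableType d') (Pr : probability W R)
    (P Q : probability E R) (X Y : nat -> {mfun W >-> E}) :
  independent_samples Pr P Q X Y -> independent_samples Pr Q P Y X.
Proof.
move=> [HX HY H]; split => // n A B mA mB.
rewrite muleC -H//; congr (Pr _).
by apply/seteqP; split => w /= + i => /(_ i) h /h [].
Qed.

Context {d' : measure_display} {W : measurableType d'} {Pr : probability W R}.
Context {P Q : probability E R} {X Y : nat -> {mfun W >-> E}}.
Hypothesis XY : independent_samples Pr P Q X Y.

Let prod_select n i (S : set E) (Z : nat -> {mfun W >-> E}) (F : nat -> set E) :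
  (i < n)%N -> (forall m, m != i -> F m = setT) ->
  (\prod_(m < n) Pr (Z m @^-1` F m) = Pr (Z i @^-1` F i))%E.
Proof.
move=> in_ FT; rewrite (bigD1 (Ordinal in_))//= big1 ?mule1// => m mi.
by rewrite FT// preimage_setT probability_setT.
Qed.

Lemma independent_rect3 i j k (A B C : set E) : j != k ->
  measurable A -> measurable B -> measurable C ->
  Pr [set w | A (X i w) /\ (B (Y j w) /\ C (Y k w))] = (P A * (Q B * Q C))%E.
Proof.
move=> jk mA mB mC; case: XY => PX PY H.
have kj : (k == j) = false by rewrite eq_sym (negbTE jk).
pose n := (maxn i (maxn j k)).+1.
have [in_ jn kn] : [/\ (i < n)%N, (j < n)%N & (k < n)%N].
  by rewrite /n !ltnS !leq_max !leqnn !orbT.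
pose FA m := if m == i then A else setT.
pose FB m := if m == j then B else if m == k then C else setT.
have mFA m : measurable (FA m) by rewrite /FA; case: ifP.
have mFB m : measurable (FB m) by rewrite /FB; case: ifP => //; case: ifP.
have := H n FA FB mFA mFB.
rewrite (_ : [set w | _] = [set w | A (X i w) /\ (B (Y j w) /\ C (Y k w))]); last first.
  apply/seteqP; split => w /=.
    move=> h; have := h i in_; have := h j jn; have := h k kn.
    by rewrite /FA /FB !eqxx kj => -[_ h1] [_ h2] [h3 _].
  move=> [h1 [h2 h3]] m mn; rewrite /FA /FB.
  split; first by case: (m =P i) => [->|].
  by case: (m =P j) => [->|_] //; case: (m =P k) => [->|].
move=> ->; rewrite (prod_select set0 X (F := FA) in_); last first.
  by move=> m mi; rewrite /FA (negbTE mi).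
rewrite PX// {1}/FA eqxx; congr (_ * _)%E.
rewrite (bigD1 (Ordinal jn))//= (bigD1 (Ordinal kn))//=; last by rewrite eq_sym.
rewrite big1 ?mule1; last first.
  move=> m /andP[mj mk]; rewrite /FB.
  have /negbTE -> : nat_of_ord m != j by apply: contra mj => /eqP mj; apply/eqP/val_inj.
  have /negbTE -> : nat_of_ord m != k by apply: contra mk => /eqP h; apply/eqP/val_inj.
  by rewrite preimage_setT probability_setT.
by rewrite !PY// /FB !eqxx kj.
Qed.

Lemma independent_law2 i j (S : set (E * E)) : measurable S ->
  Pr [set w | S (X i w, Y j w)] = (P \x Q)%E S.
Proof.
move=> mS.
have mf : measurable_fun setT (fun w => (X i w, Y j w)) by exact: measurable_fun_pair.
rewrite (@product_measure_unique _ _ _ _ _ P Q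
  (measure_function_pushforward__canonical__measure_function_Measure Pr mf))//.
(* The rule for three variables is used with a dummy index carrying the whole space. *)
move=> A B mA mB; have jk : j != j.+1 by rewrite neq_ltn ltnSn.
have := independent_rect3 i jk mA mB measurableT.
rewrite probability_setT mule1 => <-.
by congr (Pr _); apply/seteqP; split => w /= [h1]; [|case].
Qed.

Lemma independent_law3 i j k (S : set (E * (E * E))) : j != k -> measurable S ->
  Pr [set w | S (X i w, (Y j w, Y k w))] = (P \x product_law Q Q)%E S.
Proof.
move=> jk mS.
have mf : measurable_fun setT (fun w => (X i w, (Y j w, Y k w))).
  by apply: measurable_fun_pair => //; exact: measurable_fun_pair.
rewrite (@product_measure_unique _ _ _ _ _ P (product_law Q Q)
  (measure_function_pushforward__canonical__measure_function_Measure Pr mf))//.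
move=> A B mA mB.
have mg : measurable_fun setT (fun w => (Y j w, Y k w)) by exact: measurable_fun_pair.
have mXA : measurable (X i @^-1` A) by exact: measurable_preimage.
pose c := NngNum (fine_ge0 (measure_ge0 P A)).
have cE : (c%:num)%:E = P A by exact: probability_fineK.
(* Uniqueness of product measures is needed a second time: for fixed [A], this measure in [B] is
   compared with [P A] times the law of the pair. *)
pose m := measure_function_pushforward__canonical__measure_function_Measure
  (mrestr Pr mXA) mg.
have mE : m B = Pr [set w | A (X i w) /\ B (Y j w, Y k w)].
  by rewrite /m/= /pushforward /mrestr; congr (Pr _); apply/seteqP; split => w [].
transitivity (m B); first by rewrite mE.
rewrite -(@product_measure_unique _ _ _ _ _ (mscale c Q) Q m)//.
  rewrite [LHS]/product_measure1 ge0_integral_mscale//; first by rewrite cE.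
  exact: measurable_fun_xsection.
move=> B1 B2 mB1 mB2; rewrite /m/= /pushforward /mrestr.
transitivity (Pr [set w | A (X i w) /\ (B1 (Y j w) /\ B2 (Y k w))]).
  by congr (Pr _); apply/seteqP; split => w [].
by rewrite independent_rect3// /mscale cE muleA.
Qed.

Section second_moment.
Variables (q : E * E -> R) (M : R).
Hypothesis mq : measurable_fun setT q.
Hypothesis qM : forall z, `|q z| <= M.
Hypothesis q0 : forall x, (\int[Q]_y (q (x, y))%:E = 0)%E.

Let qM2 z z' : `|q z * q z'| <= M ^+ 2.
Proof. by rewrite normrM expr2 ler_pM. Qed.

Let mXY i j : measurable_fun setT (fun w => q (X i w, Y j w)).
Proof.
have mf : measurable_fun setT (fun w => (X i w, Y j w)) by exact: measurable_fun_pair.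
exact: (measurableT_comp mq mf).
Qed.

Let diag i j : (\int[Pr]_w (q (X i w, Y j w) * q (X i w, Y j w))%:E =
  \int[P \x Q]_z (q z ^+ 2)%:E)%E.
Proof.
have mf : measurable_fun setT (fun w => (X i w, Y j w)) by exact: measurable_fun_pair.
transitivity (\int[measure_function_pushforward__canonical__measure_function_Measure
    Pr mf]_z (q z ^+ 2)%:E)%E.
  apply/esym.
  transitivity (\int[Pr]_(w in (fun w => (X i w, Y j w)) @^-1` setT)
     ((fun z => (q z ^+ 2)%:E) \o (fun w => (X i w, Y j w))) w)%E.
    apply: ge0_integral_pushforward => //.
      by apply/measurable_EFinP; exact: measurable_funX.
    by move=> z _; rewrite lee_fin sqr_ge0.
  by rewrite preimage_setT; apply: eq_integral => w _ /=; rewrite expr2.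
by apply: eq_measure_integral => S mS _; exact: (independent_law2 i j mS).
Qed.

Let cross i j k : j != k ->
  (\int[Pr]_w (q (X i w, Y j w) * q (X i w, Y k w))%:E = 0)%E.
Proof.
move=> jk.
pose f w := (X i w, (Y j w, Y k w)).
have mf : measurable_fun setT f.
  by apply: measurable_fun_pair => //; exact: measurable_fun_pair.
pose F (z : E * (E * E)) := q (z.1, z.2.1) * q (z.1, z.2.2).
have mF : measurable_fun setT F.
  apply: measurable_funM; apply: (measurableT_comp mq);
    apply: measurable_fun_pair => //; exact: measurableT_comp.
have PT : (P \x product_law Q Q)%E setT = 1%E.
  transitivity (P setT * product_law Q Q setT)%E; last by rewrite !probability_setT mule1.
  by rewrite -setXTT; exact: (@product_measure1E _ _ _ _ _ P (product_law Q Q)).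
have QT : (Q \x Q)%E setT = 1%E by exact: (probability_setT (product_law Q Q)).
transitivity (\int[measure_function_pushforward__canonical__measure_function_Measure
    Pr mf]_z (F z)%:E)%E.
  apply/esym.
  transitivity (\int[Pr]_(w in f @^-1` setT) ((EFin \o F) \o f) w)%E.
    apply: integral_pushforward => //; first exact/measurable_EFinP.
    rewrite preimage_setT; apply: (@probability_integrable _ _ _ Pr (F \o f) (M ^+ 2)) => //.
    - exact: measurableT_comp mF mf.
    - by move=> w; exact: qM2.
  by rewrite preimage_setT.
transitivity (\int[P \x product_law Q Q]_z (F z)%:E)%E.
  by apply: eq_measure_integral => S mS _; exact: (independent_law3 i jk mS).
rewrite -(@integral12_prod_meas1 _ _ _ _ _ P (product_law Q Q)); last first.
  apply: (@bounded_integrable _ _ _ _ _ F (M ^+ 2)) => //.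
  - by rewrite [X in (X < _)%E]PT ltry.
  - by move=> z _; exact: qM2.
rewrite /fubini_F; apply: integral0_eq => x _.
have mqx : measurable_fun setT (fun y => q (x, y)) by exact: measurable_fun_pair2.
rewrite -integral12_prod_meas1; last first.
  apply: (@probability_integrable _ _ _ (product_law Q Q) (fun y => F (x, y)) (M ^+ 2)) => //.
  - exact: measurable_fun_pair2.
  - by move=> z; exact: qM2.
rewrite /fubini_F; apply: integral0_eq => y _.
rewrite (eq_integral (fun z => (q (x, y))%:E * (q (x, z))%:E)%E)//.
rewrite integralZl//; first by rewrite q0 mule0.
exact: (@probability_integrable _ _ _ Q (fun z => q (x, z)) M).
Qed.

(** The terms share [X i], but [q] is centred in its second variable for every value of the first:
    off-diagonal products integrate to 0, and [n] diagonal terms remain. *)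
Lemma second_moment n i :
  (\int[Pr]_w ((\sum_(j < n) q (X i w, Y j w)) ^+ 2)%:E =
   n%:R%:E * \int[P \x Q]_z (q z ^+ 2)%:E)%E.
Proof.
have intq j k : Pr.-integrable setT
    (EFin \o (fun w => q (X i w, Y j w) * q (X i w, Y k w))).
  apply: (@probability_integrable _ _ _ _ _ (M ^+ 2)) => //.
  exact: measurable_funM.
transitivity (\int[Pr]_w (\sum_(j < n) \sum_(k < n)
    (q (X i w, Y j w) * q (X i w, Y k w))%:E))%E.
  apply: eq_integral => w _; rewrite expr2 mulr_suml -sumEFin.
  by apply: eq_bigr => j _; rewrite mulr_sumr -sumEFin.
rewrite integral_sum//; last first.
  by move=> j; apply: integrable_sum => // k _; exact: intq.
rewrite (eq_bigr (fun=> \int[P \x Q]_z (q z ^+ 2)%:E)%E).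
  by rewrite sumr_const card_ord mule_natl.
move=> j _; rewrite integral_sum//; last by move=> k; exact: intq.
rewrite (bigD1 j)//= diag big1 ?adde0// => k kj; apply: cross.
by apply: contra kj => /eqP h; apply/eqP/val_inj.
Qed.

End second_moment.

(** [second_moment] for a kernel that ignores its first variable; the variance [p - p^2] is at most
    [p]. *)
Lemma deviation_second_moment n (S : set E) : measurable S ->
  (\int[Pr]_w ((\sum_(j < n) (\1_S (Y j w) - fine (Q S))) ^+ 2)%:E
   <= n%:R%:E * Q S)%E.
Proof.
move=> mS; set p := fine (Q S).
have pE : p%:E = Q S by exact: probability_fineK.
have p0 : 0 <= p by exact: fine_ge0.
have p1 : p <= 1 by rewrite -lee_fin pE probability_le1.
pose q (z : E * E) := \1_S z.2 - p.
have m1 : measurable_fun setT (\1_S : E -> R) by exact: measurable_indic.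
have mq : measurable_fun setT q.
  by apply: measurable_funB => //; exact: (measurableT_comp m1 measurable_snd).
have int1 : Q.-integrable setT (EFin \o (\1_S : E -> R)).
  apply: (@probability_integrable _ _ _ _ _ 1) => //.
  by move=> x; rewrite indicE ger0_norm; case: (_ \in _).
have intp : Q.-integrable setT (EFin \o (fun=> p)).
  apply: (@probability_integrable _ _ _ _ _ p) => //.
  by move=> x; rewrite ger0_norm.
rewrite (second_moment (q := q) (M := 2))//.
- apply: lee_wpmul2l; first by rewrite lee_fin ler0n.
  apply: (@le_trans _ _ (\int[P \x Q]_z ((1 - 2 * p) * \1_(setT `*` S) z + p ^+ 2)%:E)%E).
    rewrite le_eqVlt; apply/orP; left; apply/eqP; apply: eq_integral => z _.
    rewrite /q !indicE in_setX in_setT/=.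
    by case: (_ \in _) => /=; congr EFin; ring.
  have PQT : (P \x Q)%E setT = 1%E.
    exact: (probability_setT (product_law P Q)).
  have mSS : measurable ([set: E] `*` S) by exact: measurableX.
  have int2 : (P \x Q)%E.-integrable setT (EFin \o (fun z : E * E => (1 - 2 * p) * \1_(setT `*` S) z)).
    apply: (@probability_integrable _ _ _ (product_law P Q) _ (`|1 - 2 * p|)) => //.
    - by apply: measurable_funM => //; exact: measurable_indic.
    - move=> z; rewrite normrM indicE ler_piMr//.
      by rewrite ger0_norm; case: (_ \in _).
  have int3 : (P \x Q)%E.-integrable setT (EFin \o (fun _ : E * E => p ^+ 2)).
    apply: (@probability_integrable _ _ _ (product_law P Q) _ (p ^+ 2)) => //.
    by move=> x; rewrite ger0_norm// sqr_ge0.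
  rewrite (integralD (mu := (P \x Q)%E) measurableT int2 int3).
  rewrite (integral_cst _ measurableT) [X in (_ + _ * X)%E]PQT mule1.
  rewrite (eq_integral (fun z => (1 - 2 * p)%:E * (\1_(setT `*` S) z)%:E)%E)//.
  rewrite integralZl//; last first.
    apply: (@probability_integrable _ _ _ (product_law P Q) _ 1) => //.
    by move=> z; rewrite indicE ger0_norm; case: (_ \in _).
  have PSE : (P \x Q)%E (setT `*` S) = Q S.
    transitivity (P setT * Q S)%E; first exact: product_measure1E.
    by rewrite probability_setT mul1e.
  rewrite integral_indic// setIT [X in (_ * X + _)%E]PSE -pE.
  rewrite -EFinM -EFinD lee_fin; nra.
- move=> z; rewrite /q indicE; apply: le_trans (ler_normB _ _) _.
  have -> : 2 = 1 + 1 :> R by [].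
  by apply: lerD; rewrite ger0_norm//; case: (_ \in _).
- move=> x; rewrite /q/=.
  rewrite (integralB_EFin measurableT int1 intp) integral_indic// setIT.
  by rewrite integral_cst// [X in (_ - _ * X)%E](probability_setT Q) mule1 -[X in (X - _)%E]pE subee.
Qed.

End samples.

(** * Bounds on potentials *)

Section lipschitz_cost.
Context {R : realType} {d : nat}.
Local Notation E := 'rV[R]_d.
Context (A B : set E) (c : E -> E -> R) (L : R).
Hypotheses (mA : measurable A) (mB : measurable B).
Hypotheses (cA : compact A) (cB : compact B).
Hypothesis L0 : 0 < L.
Hypothesis c_lip : lipschitz_cost L A B c.

Lemma lipschitz_cost_l x x' y : A x -> A x' -> B y ->
  `|c x y - c x' y| <= L * enorm (x - x').
Proof.
move=> Ax Ax' By; have := c_lip Ax Ax' By By.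
by rewrite subrr enorm0 expr0n/= addr0 sqrtr_sqr (ger0_norm (enorm_ge0 _)).
Qed.

Lemma lipschitz_cost_r x y y' : A x -> B y -> B y' ->
  `|c x y - c x y'| <= L * enorm (y - y').
Proof.
move=> Ax By By'; have := c_lip Ax Ax By By'.
by rewrite subrr enorm0 expr0n/= add0r sqrtr_sqr (ger0_norm (enorm_ge0 _)).
Qed.

Lemma lipschitz_cost_dist x x' y y' : A x -> A x' -> B y -> B y' ->
  `|c x y - c x' y'| <= L * (enorm (x - x') + enorm (y - y')).
Proof.
move=> Ax Ax' By By'.
rewrite mulrDr -[X in `|X|](subrKA (c x' y)); apply: le_trans (ler_normD _ _) _.
by apply: lerD; [exact: lipschitz_cost_l|exact: lipschitz_cost_r].
Qed.

Lemma le_sup_norm x y : A x -> B y -> `|c x y| <= sup_norm_on A B c.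
Proof.
move=> Ax By; apply: ub_le_sup; last by exists (x, y).
have [M M0 HM] := compact_enorm_bounded cA.
have [M' M'0 HM'] := compact_enorm_bounded cB.
exists (`|c x y| + L * (M + M + (M' + M'))) => _ [[x' y'] [/= Ax' By'] <-].
have h := lipschitz_cost_dist Ax' Ax By' By.
have h1 := enormD x' (- x); have h2 := enormD y' (- y).
rewrite !enormN in h1 h2.
have h3 : `|c x' y'| <= `|c x y| + `|c x' y' - c x y|.
  by have := ler_normD (c x y) (c x' y' - c x y); rewrite [c x y + _]addrC subrK.
apply: le_trans h3 _; rewrite lerD2l; apply: le_trans h _.
rewrite ler_wpM2l ?(ltW L0)//.
have := HM x Ax; have := HM x' Ax'; have := HM' y By; have := HM' y' By'.
lra.
Qed.

(** [c] is controlled on the product of the supports only, so its sublevel sets are relatively open: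
    traces of countable unions of products of rational boxes. *)
Lemma measurable_cost : measurable_fun (A `*` B) (fun z => c z.1 z.2).
Proof.
have mAB : measurable (A `*` B) by exact: measurableX.
apply: (measurability _ (RGenInftyO.measurableE R)) => // _ [_ [a ->] <-].
pose box2 (p : ('rV[rat]_d * nat) * ('rV[rat]_d * nat)) : set (E * E) :=
  rational_box p.1 `*` rational_box p.2.
pose D := [set p | box2 p `&` (A `*` B) `<=` [set z | c z.1 z.2 < a]].
have -> : A `*` B `&` (fun z => c z.1 z.2) @^-1` `]-oo, a[ =
    (A `*` B) `&` \bigcup_(p in D) box2 p.
  apply/seteqP; split => -[x y].
    move=> [[/= Ax By]]; rewrite in_itv/= => ca; split => //.
    pose e := (a - c x y) / (2 * L).
    have e0 : 0 < e by rewrite divr_gt0 ?subr_gt0// mulr_gt0.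
    have [p [px pe]] := rational_box_basis (@eball_open _ _ x e) (@eball_center _ _ x e e0).
    have [q [qy qe]] := rational_box_basis (@eball_open _ _ y e) (@eball_center _ _ y e e0).
    exists (p, q) => //= -[x' y'] [[/= px' qy'] [/= Ax' By']].
    have x'e : enorm (x' - x) < e by exact: (pe _ px').
    have y'e : enorm (y' - y) < e by exact: (qe _ qy').
    have := lipschitz_cost_dist Ax' Ax By' By; rewrite ler_norml => /andP[_ h].
    have : L * (enorm (x' - x) + enorm (y' - y)) < L * (e + e).
      by rewrite ltr_pM2l//; lra.
    have -> : L * (e + e) = a - c x y by rewrite /e; field; rewrite gt_eqF.
    by lra.
  move=> [/= [Ax By] [p pD pxy]]; split => //; rewrite in_itv/=.
  by apply: (pD (x, y)).
apply: measurableI => //; rewrite bigcup_mkcond; apply: countable_bigcupT_measurable => //.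
move=> p; case: ifP => // _; apply: measurableX; exact: measurable_rational_box.
Qed.

End lipschitz_cost.

Section level.
Context {d : measure_display} {T : measurableType d} {R : realType}.
Context (nu : {measure set T -> \bar R}) (B : set T).
Hypotheses (mB : measurable B) (nuB : nu B = 1%E).

Let integrable1 (F : T -> R) : measurable_fun B F -> (forall y, B y -> 0 <= F y) ->
  (\int[nu]_(y in B) (F y)%:E = 1)%E -> nu.-integrable B (EFin \o F).
Proof.
move=> mF F0 F1; apply/integrableP; split; first exact/measurable_EFinP.
rewrite (eq_integral (fun y => (F y)%:E)) ?F1 ?ltry// => y /[!inE] By /=.
by rewrite ger0_norm// F0.
Qed.

Let integral_one : (\int[nu]_(y in B) ((cst 1 : T -> R) y)%:E = 1)%E.
Proof. by rewrite (eq_integral (cst 1%E))// integral_cst// mul1e. Qed.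

Let integrable_one : nu.-integrable B (EFin \o (cst 1 : T -> R)).
Proof. exact: integrable1. Qed.

Lemma eq_ae_integral_le (F G : T -> R) :
  nu.-integrable B (EFin \o F) -> nu.-integrable B (EFin \o G) ->
  {ae nu, forall y, B y -> F y <= G y} ->
  (\int[nu]_(y in B) (F y)%:E = \int[nu]_(y in B) (G y)%:E)%E ->
  {ae nu, forall y, B y -> F y = G y}.
Proof.
move=> iF iG FG FGE.
have mF : measurable_fun B (EFin \o F) by case/integrableP: iF.
have mG : measurable_fun B (EFin \o G) by case/integrableP: iG.
have mD : measurable_fun B (EFin \o (G \- F)).
  by apply/measurable_EFinP; apply: measurable_funB; exact/measurable_EFinP.
have I0 : (\int[nu]_(y in B) (G y - F y)%:E = 0)%E.
  rewrite (integralB_EFin mB iG iF) FGE subee//.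
  exact: (integrable_fin_num mB iG).
have : (\int[nu]_(y in B) `|(EFin \o (G \- F)%R) y| = 0)%E.
  rewrite -[RHS]I0; apply: ae_eq_integral => //.
  - by apply: measurableT_comp.
  - apply: filterS FG => y FG By /=; rewrite ger0_norm// subr_ge0; exact: FG.
move=> /(ae_eq_integral_abs nu mB mD).
by apply: filterS => y h By; have := h By => /= -[/eqP]; rewrite subr_eq0 => /eqP.
Qed.

Lemma exists_ge1 (F : T -> R) (N : T -> Prop) : measurable_fun B F ->
  (forall y, B y -> 0 <= F y) -> (\int[nu]_(y in B) (F y)%:E = 1)%E ->
  {ae nu, forall y, B y -> N y} -> exists y, [/\ B y, N y & 1 <= F y].
Proof.
move=> mF F0 F1 aeN; apply: contrapT => /forallNP H.
have Flt : {ae nu, forall y, B y -> F y < 1}.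
  apply: filterS aeN => y Ny By; rewrite ltNge; apply/negP => F1y.
  by apply: (H y); split => //; exact: Ny.
have Fle : {ae nu, forall y, B y -> F y <= (cst 1 : T -> R) y}.
  by apply: filterS Flt => y h By; exact: ltW (h By).
have Feq := eq_ae_integral_le (integrable1 mF F0 F1) integrable_one Fle
  (etrans F1 (esym integral_one)).
have : {ae nu, forall y, ~ B y}.
  by apply: filterS2 Flt Feq => y h1 h2 By; have := h1 By; rewrite h2// ltxx.
move=> nB; have : nu.-negligible B by apply: negligibleS nB => y By; exact.
rewrite negligibleP// => nB0; have /eqP := etrans (esym nuB) nB0.
by rewrite onee_eq0.
Qed.

Lemma exists_le1 (F : T -> R) : measurable_fun B F ->
  (forall y, B y -> 0 <= F y) -> (\int[nu]_(y in B) (F y)%:E = 1)%E ->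
  exists2 y, B y & F y <= 1.
Proof.
move=> mF F0 F1; apply: contrapT => H.
have Fgt y : B y -> 1 < F y.
  by move=> By; rewrite ltNge; apply/negP => h; apply: H; exists y.
have Fge : {ae nu, forall y, B y -> (cst 1 : T -> R) y <= F y}.
  by apply: nearW => y By; exact: ltW (Fgt y By).
have Feq := eq_ae_integral_le integrable_one (integrable1 mF F0 F1) Fge
  (etrans integral_one (esym F1)).
have : {ae nu, forall y, ~ B y}.
  by apply: filterS Feq => y h2 By; have := Fgt y By; rewrite -h2// ltxx.
move=> nB; have : nu.-negligible B by apply: negligibleS nB => y By; exact.
rewrite negligibleP// => nB0; have /eqP := etrans (esym nuB) nB0.
by rewrite onee_eq0.
Qed.

End level.

Section half_potential.
Context {R : realType} {d : nat}.
Local Notation E := 'rV[R]_d.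
Context (phi : R -> R) (t delta : R).
Hypothesis reg : regularizer phi t delta.
Local Notation dpsi := (derive1 (conjugate phi)).

Lemma measurable_dconj : measurable_fun [set: R] dpsi.
Proof. by apply: continuous_measurable_fun; exact: reg_C1 reg. Qed.

Context (A B : set E) (c : E -> E -> R) (eps : R) (nu : {measure set E -> \bar R}).
Context (f g : E -> R).
Hypotheses (mB : measurable B) (nuB : nu B = 1%E) (eps0 : 0 < eps).
Hypothesis mg : measurable_fun B g.
Hypothesis mc : forall x, A x -> measurable_fun B (c x).
Hypothesis pot : forall x, A x ->
  (\int[nu]_(y in B) (dpsi ((f x + g y - c x y) / eps))%:E = 1)%E.

Lemma measurable_half_plan x : A x ->
  measurable_fun B (fun y => dpsi ((f x + g y - c x y) / eps)).
Proof.
move=> Ax; apply: (measurableT_comp measurable_dconj).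
apply: measurable_funM => //; apply: measurable_funB; last exact: mc.
exact: measurable_funD.
Qed.

Lemma half_potential_ge x : A x -> exists2 y, B y & t <= (f x + g y - c x y) / eps.
Proof.
move=> Ax.
have [|y [By _ /(dconj_ge1 reg)]] := exists_ge1 mB nuB (measurable_half_plan Ax)
  (fun y _ => dconj_ge0 reg _) (pot Ax) (N := fun=> True); first exact: nearW.
by exists y.
Qed.

Lemma half_potential_le x : A x -> exists2 y, B y & (f x + g y - c x y) / eps <= t.
Proof.
move=> Ax.
have [y By /(dconj_le1 reg)] := exists_le1 mB nuB (measurable_half_plan Ax)
  (fun y _ => dconj_ge0 reg _) (pot Ax).
by exists y.
Qed.

(** Otherwise the exponent at [x] would exceed that at [x'] on all of [B]. The two densities,
    ordered and both of integral 1, would agree almost everywhere, in particular at a point where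
    they are at least 1; the exponent at [x'] is at least [t] there, where psi' increases strictly.
    Lipschitz and oscillation bounds both follow. *)
Lemma half_potential_shift x x' (m : R) : A x -> A x' ->
  (forall y, B y -> c x y <= c x' y + m) -> f x <= f x' + m.
Proof.
move=> Ax Ax' cm; rewrite leNgt; apply/negP => fm.
have xi_lt y : B y -> (f x' + g y - c x' y) / eps < (f x + g y - c x y) / eps.
  by move=> By; rewrite ltr_pM2r ?invr_gt0//; have := cm y By; lra.
pose F := fun x y => dpsi ((f x + g y - c x y) / eps).
have F0 z y : 0 <= F z y by exact: dconj_ge0 reg _.
have iF z : A z -> nu.-integrable B (EFin \o F z).
  move=> Az; apply/integrableP; split.
    by apply/measurable_EFinP; exact: measurable_half_plan.
  rewrite (eq_integral (fun y => (F z y)%:E)); first by rewrite pot// ltry.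
  by move=> y _ /=; rewrite ger0_norm.
have Fle : {ae nu, forall y, B y -> F x' y <= F x y}.
  by apply: nearW => y By; apply: (dconj_nd reg); apply: ltW; exact: xi_lt.
have FF := eq_ae_integral_le mB (iF x' Ax') (iF x Ax) Fle
  (etrans (pot Ax') (esym (pot Ax))).
have [y [By Fy /(dconj_ge1 reg) xit]] := exists_ge1 mB nuB (measurable_half_plan Ax')
  (fun y _ => F0 x' y) (pot Ax') FF.
have := dconj_lt reg _ (xi_lt y By).
rewrite -/(F x' y) -/(F x y) Fy ltxx => h.
by have /h : t - delta <= (f x' + g y - c x' y) / eps by have := reg_delta_gt0 reg; lra.
Qed.

End half_potential.

Section potentials_bounds.
Context {R : realType} {d : nat}.
Local Notation E := 'rV[R]_d.
Context (phi : R -> R) (t delta : R).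
Hypothesis reg : regularizer phi t delta.
Local Notation dpsi := (derive1 (conjugate phi)).
Context (A B : set E) (c : E -> E -> R) (L eps : R).
Hypotheses (mA : measurable A) (mB : measurable B).
Hypotheses (cA : compact A) (cB : compact B).
Hypotheses (L0 : 0 < L) (eps0 : 0 < eps).
Hypothesis c_lip : lipschitz_cost L A B c.

Lemma measurable_cost_l x : A x -> measurable_fun B (c x).
Proof.
move=> Ax; have := measurable_comp (measurableX mA mB) _ (measurable_cost mA mB L0 c_lip)
  (measurable_funTS (@pair1_measurable _ _ E E x)) => /(_ B).
by apply => _ [y By <-].
Qed.

Lemma measurable_cost_r y : B y -> measurable_fun A (c^~ y).
Proof.
move=> By; have := measurable_comp (measurableX mA mB) _ (measurable_cost mA mB L0 c_lip)
  (measurable_funTS (@pair2_measurable _ _ E E y)) => /(_ A).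
by apply => _ [x Ax <-].
Qed.

Context (mu nu : {measure set E -> \bar R}) (f g : E -> R).
Hypotheses (muA : mu A = 1%E) (nuB : nu B = 1%E).
Hypothesis pot : potentials A B c dpsi eps mu nu f g.

Lemma potentials_flip y : B y ->
  (\int[mu]_(x in A) (dpsi ((g y + f x - c x y) / eps))%:E = 1)%E.
Proof.
by move=> By; rewrite -(pot_eqr pot By); apply: eq_integral => x _; rewrite (addrC (g y)).
Qed.

Let C := sup_norm_on A B c.

Let shiftl := half_potential_shift reg mB nuB eps0 (pot_measr pot) measurable_cost_l (pot_eql pot).
Let shiftr := half_potential_shift reg mA muA eps0 (pot_measl pot) measurable_cost_r potentials_flip.

Lemma potentials_lipl x x' : A x -> A x' -> f x <= f x' + L * enorm (x - x').
Proof.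
move=> Ax Ax'; apply: shiftl => // y By.
by have := lipschitz_cost_l c_lip Ax Ax' By; rewrite ler_norml => /andP[]; lra.
Qed.

Lemma potentials_lipr y y' : B y -> B y' -> g y <= g y' + L * enorm (y - y').
Proof.
move=> By By'; apply: shiftr => // x Ax.
by have := lipschitz_cost_r c_lip Ax By By'; rewrite ler_norml => /andP[]; lra.
Qed.

Let oscr y y' : B y -> B y' -> g y <= g y' + 2 * C.
Proof.
move=> By By'; apply: shiftr => // x Ax.
have := le_sup_norm cA cB L0 c_lip Ax By; have := le_sup_norm cA cB L0 c_lip Ax By'.
by rewrite -/C !ler_norml => /andP[? ?] /andP[? ?]; lra.
Qed.

(** For each [x] the exponent is at least [t] at some point of [B] and at most [t] at another. From
    there, [C] bounds the cost and [2 C] the oscillation of [g]; the resulting [3 C] is relaxed to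
    the [5 C] that occurs in [kappa]. *)
Lemma potentials_bound x y : A x -> B y -> `|f x + g y - eps * t| <= 5 * C.
Proof.
move=> Ax By; rewrite ler_norml; apply/andP; split.
  have [y' By'] := half_potential_ge reg mB nuB (pot_measr pot) measurable_cost_l (pot_eql pot) Ax.
  rewrite ler_pdivlMr// mulrC => h; have := oscr By' By.
  have := le_sup_norm cA cB L0 c_lip Ax By'; rewrite -/C ler_norml => /andP[h1 h2].
  have : 0 <= C by apply: le_trans (le_sup_norm cA cB L0 c_lip Ax By); exact: normr_ge0.
  lra.
have [y' By'] := half_potential_le reg mB nuB (pot_measr pot) measurable_cost_l (pot_eql pot) Ax.
rewrite ler_pdivrMr// mulrC => h; have := oscr By By'.
have := le_sup_norm cA cB L0 c_lip Ax By'; rewrite -/C ler_norml => /andP[h1 h2].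
have : 0 <= C by apply: le_trans (le_sup_norm cA cB L0 c_lip Ax By); exact: normr_ge0.
lra.
Qed.

(** The potentials and the cost contribute [L / eps] each to the Lipschitz constant of the
    exponent. *)
Lemma potentials_slack x x' y y' : A x -> A x' -> B y -> B y' ->
  (f x + g y - c x y) / eps - 2 * L / eps * (enorm (x - x') + enorm (y - y'))
  <= (f x' + g y' - c x' y') / eps.
Proof.
move=> Ax Ax' By By'.
have -> : 2 * L / eps * (enorm (x - x') + enorm (y - y')) =
  (2 * L * (enorm (x - x') + enorm (y - y'))) / eps by ring.
rewrite -mulrBl ler_pM2r ?invr_gt0//.
have := potentials_lipl Ax Ax'; have := potentials_lipr By By'.
by have := lipschitz_cost_dist c_lip Ax Ax' By By'; rewrite ler_norml => /andP[]; lra.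
Qed.

End potentials_bounds.

(** * The density of the optimal plan *)

Section integral_off_null.
Context {d : measure_display} {T : measurableType d} {R : realType}.
Context (mu : {measure set T -> \bar R}) (N : set T).
Hypotheses (mN : measurable N) (N0 : mu N = 0%E).
Import HBNNSimple.

(* No measurability is assumed: [h] is replaced by [h] times the indicator of
   the complement of [N] in the supremum over simple functions. *)
Lemma ge0_le_integral_off_null (f g : T -> \bar R) :
  (forall x, 0 <= f x)%E -> (forall x, 0 <= g x)%E ->
  (forall x, ~ N x -> (f x <= g x)%E) ->
  (\int[mu]_x f x <= \int[mu]_x g x)%E.
Proof.
move=> f0 g0 fg; rewrite !ge0_integralTE//.
apply: ub_ereal_sup => _ [h hf <-].
pose h' := mul_nnsfun h (indic_nnsfun R (measurableC mN)).
apply: ereal_sup_ubound; exists h'.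
  move=> x; rewrite /h'/= /mindic indicE.
  have [Nx|Nx] := pselect (N x).
    by rewrite memNset ?mulr0//; apply.
  by rewrite mem_set// mulr1; apply: le_trans (fg x Nx); exact: hf.
rewrite -!integralT_nnsfun; apply: ae_eq_integral => //.
- by apply/measurable_EFinP.
- by apply/measurable_EFinP.
- exists N; split => // x /= /not_implyP[_]; apply: contra_notP => Nx.
  by rewrite /mindic indicE mem_set// mulr1.
Qed.

Lemma eq_integral_off_null (f g : T -> \bar R) :
  (forall x, ~ N x -> f x = g x) -> (\int[mu]_x f x = \int[mu]_x g x)%E.
Proof.
move=> fg; rewrite integralE [RHS]integralE.
by congr (_ - _)%E; apply/eqP; rewrite eq_le; apply/andP; split;
  (apply: ge0_le_integral_off_null => [y|y|x Nx];
    [exact: funepos_ge0 || exact: funeneg_ge0..|rewrite ?funeposE ?funenegE (fg _ Nx)]).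
Qed.

End integral_off_null.

Section density_probability.
Context {d : measure_display} {T : measurableType d} {R : realType}.
Context (mu : {measure set T -> \bar R}) (r : T -> R).

(** The three proofs are arguments of the definition so that its probability instance can be
    inferred. *)
Definition density_measure (mr : measurable_fun setT r) (r0 : forall x, 0 <= r x)
    (r1 : (\int[mu]_x (r x)%:E = 1)%E) (S : set T) : \bar R :=
  (\int[mu]_(x in S) (r x)%:E)%E.

Context (mr : measurable_fun setT r) (r0 : forall x, 0 <= r x).
Context (r1 : (\int[mu]_x (r x)%:E = 1)%E).
Local Notation m := (density_measure mr r0 r1).

Let m0 : m set0 = 0%E. Proof. by rewrite /density_measure integral_set0. Qed.
Let m_ge0 S : (0 <= m S)%E.
Proof. by apply: integral_ge0 => x _; rewrite lee_fin. Qed.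
Let m_additive : semi_sigma_additive m.
Proof.
by apply: semi_sigma_additive_nng_induced => [|x]; [exact/measurable_EFinP|rewrite lee_fin].
Qed.

HB.instance Definition _ := isMeasure.Build _ _ _ m m0 m_ge0 m_additive.

Let m1 : m setT = 1%E. Proof. exact: r1. Qed.

HB.instance Definition _ := Measure_isProbability.Build _ _ _ m m1.

End density_probability.

Section phi_measurable.
Context {R : realType} (phi : R -> R) (t delta : R).
Hypothesis reg : regularizer phi t delta.

Lemma regularizer_quasiconvex x y z : 0 <= x -> x <= z -> z <= y ->
  phi z <= Num.max (phi x) (phi y).
Proof.
move=> x0 xz zy; have [->|zx] := eqVneq z x; first by rewrite le_max lexx.
have [->|zy'] := eqVneq z y; first by rewrite le_max lexx orbT.
have xz' : x < z by rewrite lt_neqAle eq_sym zx.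
have zy'' : z < y by rewrite lt_neqAle zy'.
pose s := (y - z) / (y - x).
have yx : 0 < y - x by lra.
have s01 : 0 < s < 1 by rewrite divr_gt0//= ?ltr_pdivrMr//; lra.
have y0 : 0 <= y by lra.
have xy : x != y by rewrite lt_eqF//; lra.
have := reg_convex reg x0 y0 xy s01.
have -> : s * x + (1 - s) * y = z by rewrite /s; field; rewrite gt_eqF.
move=> /ltW h; apply: le_trans h _; case/andP: s01 => s0 s1.
set m := Num.max _ _.
have hx : phi x <= m by rewrite le_max lexx.
have hy : phi y <= m by rewrite le_max lexx orbT.
by nra.
Qed.

Lemma measurable_regularizer : measurable_fun [set: R] (fun x => phi (Num.max 0 x)).
Proof.
apply: (measurability _ (RGenInftyO.measurableE R)) => // _ [_ [a ->] <-].
rewrite setTI; apply: is_interval_measurable => x y /=; rewrite !in_itv/= => hx hy z /andP[xz zy].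
have := @regularizer_quasiconvex (Num.max 0 x) (Num.max 0 y) (Num.max 0 z).
rewrite le_max lexx => /(_ isT).
have h1 : Num.max 0 x <= Num.max 0 z by rewrite ge_max !le_max lexx xz orbT.
have h2 : Num.max 0 z <= Num.max 0 y by rewrite ge_max !le_max lexx zy orbT.
rewrite h1 h2 => /(_ isT isT) h; rewrite /= in_itv/=.
by apply: le_lt_trans h _; rewrite gt_max hx.
Qed.

End phi_measurable.

Section couplings.
Context {R : realType} {d : nat}.
Local Notation E := 'rV[R]_d.
Context (P Q : probability E R).
Local Notation A := (msupport P).
Local Notation B := (msupport Q).
Local Notation mu := (product_law P Q).

Lemma integral_msupport (F : E -> \bar R) :
  (\int[P]_(x in A) F x = \int[P]_x F x)%E.
Proof.
rewrite integral_mkcond; apply: (eq_integral_off_null (N := ~` A)).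
- exact: measurableC (measurable_msupport P).
- exact: msupport_setC0.
- by move=> x /contrapT Ax; rewrite patchE mem_set.
Qed.

Lemma coupling_support (pi : probability (E * E)%type R) :
  coupling P Q pi -> pi (~` (A `*` B)) = 0%E.
Proof.
move=> [pl pr]; have mA := measurable_msupport P; have mB := measurable_msupport Q.
apply/eqP; rewrite eq_le measure_ge0 andbT.
apply: (@le_trans _ _ (pi ((~` A `*` setT) `|` (setT `*` ~` B)))).
  apply: le_measure; rewrite ?inE.
  - by apply: measurableC; exact: measurableX.
  - by apply: measurableU; apply: measurableX => //; exact: measurableC.
  - move=> [x y] /= nAB; have [Ax|nA] := pselect (A x); last by left.
    by right; split => // By; apply: nAB.
apply: le_trans (measureU2 _ _ _) _; try by apply: measurableX => //; exact: measurableC.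
have h1 : pi (~` A `*` setT) = 0%E by rewrite pl ?msupport_setC0//; exact: measurableC.
have h2 : pi (setT `*` ~` B) = 0%E by rewrite pr ?msupport_setC0//; exact: measurableC.
by rewrite [X in (X + _)%E]h1 [X in (_ + X)%E]h2 adde0.
Qed.

Lemma coupling_integral_fst (pi : probability (E * E)%type R) (F : E -> R) (M : R) :
  coupling P Q pi -> measurable_fun setT F -> (forall x, `|F x| <= M) ->
  (\int[pi]_z (F z.1)%:E = \int[P]_x (F x)%:E)%E.
Proof.
move=> [pl _] mF FM.
have mfst : measurable_fun [set: E * E] fst by exact: measurable_fst.
transitivity (\int[measure_function_pushforward__canonical__measure_function_Measure
    pi mfst]_x (F x)%:E)%E.
  apply/esym; transitivity (\int[pi]_(z in fst @^-1` setT) ((EFin \o F) \o fst) z)%E.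
    apply: integral_pushforward => //; first exact/measurable_EFinP.
    rewrite preimage_setT; apply: (@probability_integrable _ _ _ pi (F \o fst) M) => //.
      exact: measurableT_comp mF mfst.
    by move=> z; exact: FM.
  by rewrite preimage_setT.
apply: eq_measure_integral => S mS _; transitivity (pi (S `*` setT)); last exact: pl.
by rewrite /pushforward/=; congr (pi _); apply/seteqP; split => z //= [].
Qed.

Lemma coupling_integral_snd (pi : probability (E * E)%type R) (F : E -> R) (M : R) :
  coupling P Q pi -> measurable_fun setT F -> (forall x, `|F x| <= M) ->
  (\int[pi]_z (F z.2)%:E = \int[Q]_x (F x)%:E)%E.
Proof.
move=> [_ pr] mF FM.
have msnd : measurable_fun [set: E * E] snd by exact: measurable_snd.
transitivity (\int[measure_function_pushforward__canonical__measure_function_Measure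
    pi msnd]_x (F x)%:E)%E.
  apply/esym; transitivity (\int[pi]_(z in snd @^-1` setT) ((EFin \o F) \o snd) z)%E.
    apply: integral_pushforward => //; first exact/measurable_EFinP.
    rewrite preimage_setT; apply: (@probability_integrable _ _ _ pi (F \o snd) M) => //.
      exact: measurableT_comp mF msnd.
    by move=> z; exact: FM.
  by rewrite preimage_setT.
apply: eq_measure_integral => S mS _; transitivity (pi (setT `*` S)); last exact: pr.
by rewrite /pushforward/=; congr (pi _); apply/seteqP; split => z //= [].
Qed.

Section density_coupling.
Context (r : E * E -> R).
Hypotheses (mr : measurable_fun setT r) (r0 : forall z, 0 <= r z).
Hypothesis rl : forall x, (\int[Q]_y (r (x, y))%:E = 1)%E.
Hypothesis rr : forall y, (\int[P]_x (r (x, y))%:E = 1)%E.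

Let restr_ge0 S z : (0 <= ((EFin \o r) \_ S) z)%E.
Proof. by rewrite patchE; case: ifP => //= _; rewrite lee_fin. Qed.

Let marg_l S : measurable S -> (\int[mu]_(z in S `*` setT) (r z)%:E = P S)%E.
Proof.
move=> mS; rewrite integral_mkcond.
have mSS : measurable (S `*` [set: E]) by exact: measurableX.
transitivity (\int[P]_x \int[Q]_y ((EFin \o r) \_ (S `*` setT)) (x, y))%E.
  apply: (fubini_tonelli1 (m1 := P) (m2 := Q)) => //.
  by apply/(measurable_restrictT _ mSS); apply: measurable_funTS; exact/measurable_EFinP.
transitivity (\int[P]_x (\1_S x)%:E)%E; last by rewrite integral_indic// setIT.
apply: eq_integral => x _; rewrite indicE.
have [Sx|Sx] := pselect (S x).
  rewrite mem_set// -(rl x); apply: eq_integral => y _.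
  by rewrite patchE mem_set.
rewrite memNset//; apply: integral0_eq => y _.
by rewrite patchE memNset// => -[].
Qed.

Let marg_r S : measurable S -> (\int[mu]_(z in setT `*` S) (r z)%:E = Q S)%E.
Proof.
move=> mS; rewrite integral_mkcond.
have mSS : measurable ([set: E] `*` S) by exact: measurableX.
have mrS : measurable_fun setT ((EFin \o r) \_ (setT `*` S)).
  by apply/(measurable_restrictT _ mSS); apply: measurable_funTS; exact/measurable_EFinP.
transitivity (\int[P]_x \int[Q]_y ((EFin \o r) \_ (setT `*` S)) (x, y))%E.
  exact: (fubini_tonelli1 (m1 := P) (m2 := Q)).
rewrite (fubini_tonelli (m1 := P) (m2 := Q))//.
transitivity (\int[Q]_x (\1_S x)%:E)%E; last by rewrite integral_indic// setIT.
apply: eq_integral => y _; rewrite indicE.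
have [Sy|Sy] := pselect (S y).
  rewrite mem_set// -(rr y); apply: eq_integral => x _.
  by rewrite patchE mem_set.
rewrite memNset//; apply: integral0_eq => x _.
by rewrite patchE memNset// => -[].
Qed.

Lemma density_total : (\int[mu]_z (r z)%:E = 1)%E.
Proof. by have := marg_l measurableT; rewrite setXTT probability_setT. Qed.

Lemma density_coupling : coupling P Q (density_measure mr r0 density_total).
Proof. by split => S mS; [exact: marg_l|exact: marg_r]. Qed.

End density_coupling.

Section radon_nikodym_density.
Context (pi : probability (E * E)%type R).
Hypothesis dom : pi `<< mu.
Local Notation rho := (coupling_density P Q pi).
Local Open Scope charge_scope.

Let rhoE z : (rho z)%:E = ('d (charge_of_finite_measure pi) '/d mu) z.
Proof. by rewrite /coupling_density/= fineK// Radon_Nikodym_fin_num. Qed.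

Lemma coupling_density_measurable : measurable_fun setT rho.
Proof.
apply/measurable_EFinP.
rewrite (_ : EFin \o rho = 'd (charge_of_finite_measure pi) '/d mu); last exact/funext.
by apply: measurable_int; exact: Radon_Nikodym_integrable.
Qed.

Lemma coupling_density_change (h : E * E -> R) (M : R) : measurable_fun setT h ->
  (forall z, `|h z| <= M) ->
  (\int[mu]_z (h z * rho z)%:E = \int[pi]_z (h z)%:E)%E.
Proof.
move=> mh hM.
rewrite -(@Radon_Nikodym_change_of_variables _ _ _ pi mu dom (EFin \o h) setT)//.
  by apply: eq_integral => z _; rewrite EFinM rhoE.
exact: probability_integrable hM.
Qed.

Lemma coupling_density_integral S : measurable S -> (\int[mu]_(z in S) (rho z)%:E = pi S)%E.
Proof.
move=> mS; have := @Radon_Nikodym_integral _ _ _ (charge_of_finite_measure pi) mu S dom mS.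
move=> piS; transitivity (\int[mu]_(z in S) ('d (charge_of_finite_measure pi) '/d mu) z)%E.
  by apply: eq_integral => z _; rewrite rhoE.
exact/esym.
Qed.

Lemma coupling_density_integrable : mu.-integrable setT (EFin \o rho).
Proof.
rewrite (_ : EFin \o rho = 'd (charge_of_finite_measure pi) '/d mu); last exact/funext.
exact: Radon_Nikodym_integrable.
Qed.

Lemma coupling_density_ge0 : {ae mu, forall z, 0 <= rho z}.
Proof.
have := @ae_eq_Radon_Nikodym_SigmaFinite _ _ _ pi mu dom setT measurableT.
apply: filterS => z h; have := h Logic.I; rewrite -rhoE => fz.
by rewrite -lee_fin -fz; exact: Radon_Nikodym_SigmaFinite.f_ge0.
Qed.

End radon_nikodym_density.

Lemma density_dominated (r : E * E -> R) (mr : measurable_fun setT r)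
    (r0 : forall z, 0 <= r z) (r1 : (\int[mu]_z (r z)%:E = 1)%E) :
  density_measure mr r0 r1 `<< mu.
Proof.
apply/null_content_dominatesP => S mS S0.
apply: null_set_integral => //.
by apply/measurable_EFinP; exact: measurable_funTS.
Qed.

Lemma coupling_density_density (r : E * E -> R) (mr : measurable_fun setT r)
    (r0 : forall z, 0 <= r z) (r1 : (\int[mu]_z (r z)%:E = 1)%E) :
  {ae mu, forall z, coupling_density P Q (density_measure mr r0 r1) z = r z}.
Proof.
have dom := density_dominated mr r0 r1.
have : ae_eq mu setT (EFin \o coupling_density P Q (density_measure mr r0 r1)) (EFin \o r).
  apply: integral_ae_eq => //.
  - exact: coupling_density_integrable.
  - exact/measurable_EFinP.
  - by move=> S _ mS; exact: (coupling_density_integral dom mS).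
by apply: filterS => z h; have := h Logic.I => -[].
Qed.

End couplings.

(** The Fenchel-Young gap of a coupling may have infinite integral. In that case the negative part
    of [a + b] is at most [|b|], and its positive part plus [|b|] dominates [a]. *)
Lemma ge0_integralD_integrable {d : measure_display} {T : measurableType d} {R : realType}
    (mu : {measure set T -> \bar R}) (a b : T -> R) :
  measurable_fun setT a -> (forall x, 0 <= a x) -> mu.-integrable setT (EFin \o b) ->
  (\int[mu]_x (a x + b x)%:E = \int[mu]_x (a x)%:E + \int[mu]_x (b x)%:E)%E.
Proof.
move=> ma a0 ib; have mb : measurable_fun setT b.
  by apply/measurable_EFinP; exact: measurable_int ib.
have aint0 : (0 <= \int[mu]_x (a x)%:E)%E by apply: integral_ge0 => x _; rewrite lee_fin.
have [aoo|aoo] := eqVneq (\int[mu]_x (a x)%:E)%E +oo%E; last first.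
  apply: (integralD_EFin measurableT) => //; apply/integrableP; split.
    exact/measurable_EFinP.
  rewrite (eq_integral (fun x => (a x)%:E)); first by rewrite ltey.
  by move=> x _ /=; rewrite ger0_norm.
have bfin : (\int[mu]_x (b x)%:E)%E \is a fin_num by exact: integrable_fin_num ib.
have babs : (\int[mu]_x `|b x|%:E < +oo)%E by have /integrableP[] := ib.
have mab : measurable_fun setT (fun x => (a x + b x)%:E).
  by apply/measurable_EFinP; exact: measurable_funD.
have mabs : measurable_fun setT (fun x => `|b x|%:E).
  by apply/measurable_EFinP; exact: measurableT_comp.
pose p := ((fun x => (a x + b x)%:E) ^\+)%E; pose m := ((fun x => (a x + b x)%:E) ^\-)%E.
have mp : measurable_fun setT p by exact: measurable_funepos.
have mm : measurable_fun setT m by exact: measurable_funeneg.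
have poo : (\int[mu]_x p x = +oo)%E.
  apply/eqP; rewrite -leye_eq -aoo.
  have H : (\int[mu]_x (a x)%:E <= \int[mu]_x p x + \int[mu]_x `|b x|%:E)%E.
    have p0 x : (0 <= p x)%E by exact: funepos_ge0.
    have <- : (\int[mu]_x (p x + `|b x|%:E) = \int[mu]_x p x + \int[mu]_x `|b x|%:E)%E.
      by apply: ge0_integralD => // x _; rewrite lee_fin.
    apply: ge0_le_integral => //.
    - by move=> x _; rewrite lee_fin.
    - exact/measurable_EFinP.
    - exact: emeasurable_funD.
    - move=> x _; rewrite /p funeposE -EFin_max -EFinD lee_fin.
      have := ler_norm (- b x); rewrite normrN => h.
      by rewrite -lerBlDr le_max; apply/orP; left; lra.
  have [->|pfin] := eqVneq (\int[mu]_x p x)%E +oo%E; first exact: leey.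
  move: H; rewrite aoo leye_eq => /eqP H.
  by have := lte_add_pinfty (_ : \int[mu]_x p x < +oo)%E babs; rewrite H ltxx ltey => /(_ pfin).
have mfin : (\int[mu]_x m x < +oo)%E.
  apply: le_lt_trans babs; apply: ge0_le_integral => // x _; first exact: funeneg_ge0.
  rewrite /m funenegE ge_max; apply/andP; split; last by rewrite lee_fin.
  rewrite -EFinN lee_fin.
  have := ler_norm (- b x); rewrite normrN; have := a0 x; lra.
have m0 : (0 <= \int[mu]_x m x)%E by apply: integral_ge0 => x _; exact: funeneg_ge0.
have mf : (\int[mu]_x m x)%E \is a fin_num by rewrite ge0_fin_numE.
by rewrite integralE -/p -/m poo aoo -(fineK mf) -(fineK bfin).
Qed.

(** * Duality and the identification of the optimal density *)

Section optimizer.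
Context {R : realType} {d : nat}.
Local Notation E := 'rV[R]_d.
Context (phi : R -> R) (t delta : R).
Hypothesis reg : regularizer phi t delta.
Local Notation psi := (conjugate phi).
Local Notation dpsi := (derive1 (conjugate phi)).
Context (P Q : probability E R).
Local Notation A := (msupport P).
Local Notation B := (msupport Q).
Local Notation mu := (product_law P Q).
Context (c : E -> E -> R) (L eps : R) (f g : E -> R).
Hypotheses (cA : compact A) (cB : compact B).
Hypotheses (L0 : 0 < L) (eps0 : 0 < eps).
Hypothesis c_lip : lipschitz_cost L A B c.
Hypothesis pot : potentials A B c dpsi eps P Q f g.

Let mA : measurable A. Proof. exact: measurable_msupport. Qed.
Let mB : measurable B. Proof. exact: measurable_msupport. Qed.
Let mAB : measurable (A `*` B). Proof. exact: measurableX. Qed.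

(* Outside the supports the exponent is set to [t], where [dpsi] is [1]: the
   plan then has conditional mass [1] at every point. *)
Definition plan_exponent (z : E * E) : R :=
  t + ((fun z => (f z.1 + g z.2 - c z.1 z.2) / eps - t) \_ (A `*` B)) z.

Definition plan_density (z : E * E) : R := dpsi (plan_exponent z).

Lemma plan_exponent_in x y : A x -> B y ->
  plan_exponent (x, y) = (f x + g y - c x y) / eps.
Proof. by move=> Ax By; rewrite /plan_exponent patchE mem_set// addrC subrK. Qed.

Lemma plan_exponent_out z : ~ (A z.1 /\ B z.2) -> plan_exponent z = t.
Proof. by move=> nAB; rewrite /plan_exponent patchE memNset//= addr0. Qed.

Lemma measurable_plan_exponent : measurable_fun setT plan_exponent.
Proof.
apply: measurable_funD => //; apply/(measurable_restrictT _ mAB).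
apply: measurable_funB => //; apply: measurable_funM => //.
apply: measurable_funB; last exact: measurable_cost mA mB L0 c_lip.
apply: measurable_funD.
  have := measurable_comp mA _ (pot_measl pot) (measurable_funTS (@measurable_fst _ _ E E)).
  by move=> /(_ (A `*` B)); apply => _ [z [Az _] <-].
have := measurable_comp mB _ (pot_measr pot) (measurable_funTS (@measurable_snd _ _ E E)).
by move=> /(_ (A `*` B)); apply => _ [z [_ Bz] <-].
Qed.

Lemma plan_exponent_bounded : exists2 M, 0 <= M & forall z, `|plan_exponent z - t| <= M.
Proof.
(* Five from [potentials_bound] and one from the cost. *)
exists (6 * sup_norm_on A B c / eps) => [|z].
  apply: divr_ge0; last exact: ltW.
  have [x Ax] := msupport_neq0 P; have [y By] := msupport_neq0 Q.
  by apply: mulr_ge0 => //; apply: le_trans (le_sup_norm cA cB L0 c_lip Ax By).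
have [[Az Bz]|nAB] := pselect (A z.1 /\ B z.2); last first.
  rewrite (plan_exponent_out nAB) subrr normr0; apply: divr_ge0; last exact: ltW.
  have [x Ax] := msupport_neq0 P; have [y By] := msupport_neq0 Q.
  by apply: mulr_ge0 => //; apply: le_trans (le_sup_norm cA cB L0 c_lip Ax By).
case: z Az Bz => x y /= Ax By; rewrite plan_exponent_in//.
have h1 := potentials_bound reg mA mB cA cB L0 eps0 c_lip (msupport1 P) (msupport1 Q) pot Ax By.
have h2 := le_sup_norm cA cB L0 c_lip Ax By.
have -> : (f x + g y - c x y) / eps - t = (f x + g y - eps * t - c x y) / eps.
  by field; rewrite gt_eqF.
rewrite normrM normfV (gtr0_norm eps0) ler_pM2r ?invr_gt0//.
by apply: le_trans (ler_normB _ _) _; lra.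
Qed.

Lemma measurable_plan_density : measurable_fun setT plan_density.
Proof. exact: measurableT_comp (measurable_dconj reg) measurable_plan_exponent. Qed.

Lemma plan_density_ge0 z : 0 <= plan_density z.
Proof. exact: dconj_ge0 reg _. Qed.

Lemma plan_density_bounded : exists2 M, 0 <= M & forall z, plan_density z <= M.
Proof.
have [M M0 HM] := plan_exponent_bounded.
exists (dpsi (t + M)) => [|z]; first exact: dconj_ge0 reg _.
by apply: (dconj_nd reg); have := HM z; rewrite ler_norml => /andP[]; lra.
Qed.

Lemma plan_density_l x : (\int[Q]_y (plan_density (x, y))%:E = 1)%E.
Proof.
have [Ax|nA] := pselect (A x).
  rewrite -(pot_eql pot Ax) -integral_msupport; apply: eq_integral => y /[!inE] By.
  by rewrite /plan_density plan_exponent_in.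
rewrite (eq_integral (cst 1%E)); first by rewrite integral_cst// mul1e; exact: probability_setT.
by move=> y _; rewrite /plan_density plan_exponent_out ?(reg_t reg)// => -[].
Qed.

Lemma plan_density_r y : (\int[P]_x (plan_density (x, y))%:E = 1)%E.
Proof.
have [By|nB] := pselect (B y).
  rewrite -(pot_eqr pot By) -integral_msupport; apply: eq_integral => x /[!inE] Ax.
  by rewrite /plan_density plan_exponent_in.
rewrite (eq_integral (cst 1%E)); first by rewrite integral_cst// mul1e; exact: probability_setT.
by move=> x _; rewrite /plan_density plan_exponent_out ?(reg_t reg)// => -[].
Qed.

Let fA : E -> R := f \_ A.
Let gB : E -> R := g \_ B.

Let mfA : measurable_fun setT fA.
Proof. by apply/(measurable_restrictT _ mA); exact: pot_measl pot. Qed.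

Let mgB : measurable_fun setT gB.
Proof. by apply/(measurable_restrictT _ mB); exact: pot_measr pot. Qed.

Let fA_bounded : exists M, forall x, `|fA x| <= M.
Proof.
have [M HM] := pot_bndl pot; exists `|M| => x; rewrite /fA patchE.
by case: ifPn => [/[!inE] /HM h|_]; [apply: le_trans h (ler_norm _)|rewrite normr0].
Qed.

Let gB_bounded : exists M, forall x, `|gB x| <= M.
Proof.
have [M HM] := pot_bndr pot; exists `|M| => x; rewrite /gB patchE.
by case: ifPn => [/[!inE] /HM h|_]; [apply: le_trans h (ler_norm _)|rewrite normr0].
Qed.

Let xi_bounded : exists M, forall z, `|plan_exponent z| <= M.
Proof.
have [M M0 HM] := plan_exponent_bounded; exists (M + `|t|) => z.
rewrite -[plan_exponent z](subrK t); apply: le_trans (ler_normD _ _) _.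
by rewrite lerD2r.
Qed.

Let K0 : R := fine (\int[P]_x (fA x)%:E + \int[Q]_y (gB y)%:E)%E.

Let psi_xi z := psi (plan_exponent z).

Let measurable_psi : measurable_fun [set: R] psi.
Proof.
apply: continuous_measurable_fun => x.
apply: differentiable_continuous; apply/derivable1_diffP.
exact: (@reg_derivable _ _ _ _ reg).
Qed.

Let mpsi_xi : measurable_fun setT psi_xi.
Proof. exact: measurableT_comp measurable_psi measurable_plan_exponent. Qed.

Let psi_xi_bounded : exists M, forall z, `|psi_xi z| <= M.
Proof.
have [M HM] := xi_bounded.
have psi_nd x y : x <= y -> psi x <= psi y.
  move=> xy; have := conjugate_tangent reg x y; have := dconj_ge0 reg x; nra.
exists (`|psi M| + `|psi (- M)|) => z; have := HM z; rewrite ler_norml => /andP[h1 h2].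
have p1 := psi_nd _ _ h1; have p2 := psi_nd _ _ h2.
have := ler_norm (psi M); have := ler_norm (- psi (- M)); rewrite normrN => n1 n2.
have := normr_ge0 (psi M); have := normr_ge0 (psi (- M)).
by rewrite ler_norml /psi_xi => ? ?; apply/andP; split; lra.
Qed.

(** On the supports, [c] is the sum of the potentials minus [eps] times the exponent, and the
    potentials integrate to a constant depending on the marginals only. *)
Let cost_coupling (pi : probability (E * E)%type R) : coupling P Q pi -> pi `<< mu ->
  (\int[pi]_(z in A `*` B) (c z.1 z.2)%:E =
   (K0 - eps * fine (\int[mu]_z (plan_exponent z * coupling_density P Q pi z)%:E))%:E)%E.
Proof.
move=> cpl dom.
have [Mf HMf] := fA_bounded; have [Mg HMg] := gB_bounded; have [Mx HMx] := xi_bounded.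
have i1 : pi.-integrable setT (EFin \o (fun z : E * E => fA z.1)).
  apply: (@probability_integrable _ _ _ pi _ Mf) => [|z]; last exact: HMf.
  exact: (measurableT_comp mfA measurable_fst).
have i2 : pi.-integrable setT (EFin \o (fun z : E * E => gB z.2)).
  apply: (@probability_integrable _ _ _ pi _ Mg) => [|z]; last exact: HMg.
  exact: (measurableT_comp mgB measurable_snd).
have i3 : pi.-integrable setT (EFin \o (fun z : E * E => eps * plan_exponent z)).
  apply: (@probability_integrable _ _ _ pi _ (eps * Mx)) => [|z].
    by apply: measurable_funM => //; exact: measurable_plan_exponent.
  by rewrite normrM (gtr0_norm eps0) ler_pM2l.
have i4 : pi.-integrable setT (EFin \o plan_exponent).
  apply: (@probability_integrable _ _ _ pi _ Mx) => //.
  exact: measurable_plan_exponent.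
transitivity (\int[pi]_z (fA z.1 + gB z.2 - eps * plan_exponent z)%:E)%E.
  rewrite integral_mkcond; apply: (eq_integral_off_null (N := ~` (A `*` B))).
  - exact: measurableC.
  - exact: coupling_support cpl.
  - move=> [x y] /contrapT [/= Ax By]; rewrite patchE mem_set//=; congr EFin.
    rewrite /fA /gB !patchE !mem_set// plan_exponent_in//.
    by field; rewrite gt_eqF.
have i12 : pi.-integrable setT (EFin \o (fun z : E * E => fA z.1 + gB z.2)).
  exact: (integrableD measurableT i1 i2).
rewrite (integralB_EFin measurableT i12 i3).
rewrite (integralD_EFin measurableT i1 i2).
rewrite (coupling_integral_fst cpl mfA HMf) (coupling_integral_snd cpl mgB HMg).
rewrite (eq_integral (fun z => eps%:E * (plan_exponent z)%:E)%E)//.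
rewrite (integralZl measurableT i4).
rewrite -(coupling_density_change dom measurable_plan_exponent HMx).
have fin1 : (\int[P]_x (fA x)%:E)%E \is a fin_num.
  apply: integrable_fin_num => //; exact: probability_integrable mfA HMf.
have fin2 : (\int[Q]_x (gB x)%:E)%E \is a fin_num.
  apply: integrable_fin_num => //; exact: probability_integrable mgB HMg.
have fin3 : (\int[mu]_z (plan_exponent z * coupling_density P Q pi z)%:E)%E \is a fin_num.
  rewrite (coupling_density_change dom measurable_plan_exponent HMx).
  exact: integrable_fin_num.
rewrite [RHS]EFinB; congr (_ - _)%E; first by rewrite /K0 fineK// fin_numD fin1.
by rewrite [RHS]EFinM; congr (_ * _)%E; rewrite fineK.
Qed.

(** Density of a mixture of the plan with the product coupling: the marginals are kept and the
    density is at least [s], as needed for [fenchel_mix]. *)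
Let mix (s : R) z := (1 - s) * plan_density z + s.

Section mix.
Variable s : R.
Hypothesis s01 : 0 < s < 1.

Let s0 : 0 < s. Proof. by case/andP: s01. Qed.
Let s1 : s < 1. Proof. by case/andP: s01. Qed.

Let mmix : measurable_fun setT (mix s).
Proof.
apply: measurable_funD => //; apply: measurable_funM => //.
exact: measurable_plan_density.
Qed.

Let mix_ge0 z : 0 <= mix s z.
Proof. by have := s0; have := s1; have := plan_density_ge0 z; rewrite /mix; nra. Qed.

Let mix_mass (nu : probability E R) (h : E -> R) (M : R) : measurable_fun setT h ->
  (forall y, `|h y| <= M) -> (\int[nu]_y (h y)%:E = 1)%E ->
  (\int[nu]_y ((1 - s) * h y + s)%:E = 1)%E.
Proof.
move=> mh hM h1.
have i1 : nu.-integrable setT (EFin \o h) by exact: probability_integrable hM.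
have i2 : nu.-integrable setT (EFin \o (fun y => (1 - s) * h y)).
  apply: (@probability_integrable _ _ _ nu _ ((1 - s) * M)) => [|y].
    exact: measurable_funM.
  have s1' : 0 <= 1 - s by have := s1; lra.
  by rewrite normrM ger0_norm// ler_wpM2l.
have i3 : nu.-integrable setT (EFin \o (fun=> s)).
  by apply: (@probability_integrable _ _ _ nu _ `|s|).
rewrite (integralD_EFin measurableT i2 i3).
rewrite (eq_integral (fun y => (1 - s)%:E * (h y)%:E)%E)//.
rewrite (integralZl measurableT i1) h1 mule1.
by rewrite integral_cst// [X in (_ + _ * X)%E](probability_setT nu) mule1 -EFinD subrK.
Qed.

Let mix_l x : (\int[Q]_y (mix s (x, y))%:E = 1)%E.
Proof.
have [M M0 HM] := plan_density_bounded.
apply: (mix_mass (h := fun y => plan_density (x, y)) (M := M)) => [|y|].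
- by apply: measurable_fun_pair2; exact: measurable_plan_density.
- by rewrite ger0_norm ?plan_density_ge0.
- exact: plan_density_l.
Qed.

Let mix_r y : (\int[P]_x (mix s (x, y))%:E = 1)%E.
Proof.
have [M M0 HM] := plan_density_bounded.
apply: (mix_mass (h := fun x => plan_density (x, y)) (M := M)) => [|x|].
- by apply: measurable_fun_pair1; exact: measurable_plan_density.
- by rewrite ger0_norm ?plan_density_ge0.
- exact: plan_density_r.
Qed.

Definition mix_law : probability (E * E)%type R :=
  density_measure mmix mix_ge0 (@density_total R d P Q (mix s) mmix mix_ge0 mix_l).

Lemma mix_law_coupling : coupling P Q mix_law.
Proof. exact: (@density_coupling R d P Q (mix s) mmix mix_ge0 mix_l mix_r). Qed.

Lemma mix_law_dominated : mix_law `<< mu.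
Proof. exact: density_dominated. Qed.

Lemma mix_law_density : {ae mu, forall z, coupling_density P Q mix_law z = mix s z}.
Proof. exact: coupling_density_density. Qed.

End mix.
(** The Fenchel-Young gap between the density [r] and the exponent. The maximum with 0 is there
    because a Radon-Nikodym density is nonnegative only almost everywhere. *)
Let lag (r : E * E -> R) z : R :=
  phi (Num.max 0 (r z)) - Num.max 0 (r z) * plan_exponent z + psi_xi z.

Let lag_ge0 r z : 0 <= lag r z.
Proof.
rewrite /lag /psi_xi; have := conjugate_ge reg (plan_exponent z) (x := Num.max 0 (r z)).
by rewrite le_max lexx => /(_ isT); lra.
Qed.

Let measurable_max0 (r : E * E -> R) : measurable_fun setT r ->
  measurable_fun setT (fun z => Num.max 0 (r z)).
Proof. by move=> mr; exact: measurable_maxr. Qed.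

Let measurable_lag r : measurable_fun setT r -> measurable_fun setT (lag r).
Proof.
move=> mr; apply: measurable_funD; last exact: mpsi_xi.
apply: measurable_funB; first exact: measurableT_comp (measurable_regularizer reg) mr.
apply: measurable_funM; last exact: measurable_plan_exponent.
exact: measurable_max0.
Qed.

Let Psi : R := fine (\int[mu]_z (psi_xi z)%:E)%E.

(** The constant is common to all dominated couplings, so that minimizing the cost amounts to
    minimizing the integral of the gap. *)
Let cost_lag (pi : probability (E * E)%type R) : coupling P Q pi -> pi `<< mu ->
  rot_cost A B c phi eps P Q pi = ((K0 - eps * Psi)%:E
    + eps%:E * \int[mu]_z (lag (coupling_density P Q pi) z)%:E)%E.
Proof.
move=> cpl dom; rewrite /rot_cost asboolT// (cost_coupling cpl dom).
set rho := coupling_density P Q pi.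
have mrho : measurable_fun setT rho by exact: coupling_density_measurable.
have [N [mN N0 rho0]] := coupling_density_ge0 dom.
have rho_ge0 z : ~ N z -> 0 <= rho z by move=> nN; apply: contrapT => h; exact: nN (rho0 z h).
have maxE z : ~ N z -> Num.max 0 (rho z) = rho z by move=> /rho_ge0 h; apply/max_idPr.
have [Mx HMx] := xi_bounded; have [Mp HMp] := psi_xi_bounded.
have irho : mu.-integrable setT (EFin \o rho) by exact: coupling_density_integrable.
have mxr : measurable_fun setT (fun z => plan_exponent z * rho z).
  by apply: measurable_funM => //; exact: measurable_plan_exponent.
have ixr : mu.-integrable setT (EFin \o (fun z => plan_exponent z * rho z)).
  apply: (@le_integrable _ _ _ mu setT measurableT _ (fun z => Mx%:E * (rho z)%:E)%E).
  - exact/measurable_EFinP.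
  - move=> z _ /=; rewrite lee_fin !normrM ler_wpM2r//.
    by apply: le_trans (HMx z) (ler_norm _).
  - exact: integrableZl.
have ipsi : mu.-integrable setT (EFin \o psi_xi) by exact: probability_integrable mpsi_xi HMp.
have -> : (\int[mu]_z (phi (rho z))%:E =
    \int[mu]_z (lag rho z + (plan_exponent z * rho z - psi_xi z))%:E)%E.
  apply: (eq_integral_off_null mN N0) => z nN; congr EFin.
  by rewrite /lag maxE//; ring.
have ib : mu.-integrable setT (EFin \o (fun z => plan_exponent z * rho z - psi_xi z)).
  exact: (integrableB measurableT ixr ipsi).
rewrite (ge0_integralD_integrable (measurable_lag mrho) (lag_ge0 rho) ib).
rewrite (integralB_EFin measurableT ixr ipsi).
have fxr : (\int[mu]_z (plan_exponent z * rho z)%:E)%E \is a fin_num.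
  exact: integrable_fin_num ixr.
have fpsi : (\int[mu]_z (psi_xi z)%:E)%E \is a fin_num by exact: integrable_fin_num ipsi.
rewrite -(fineK fxr) -[X in (_ - X)%E](fineK fpsi) -/Psi.
set I := fine _; set X := (\int[mu]_z (lag rho z)%:E)%E.
have X0 : (0 <= X)%E by apply: integral_ge0 => z _; rewrite lee_fin lag_ge0.
case: X X0 => [x|_|//]; last by rewrite /= !addye// gt0_muley ?lte_fin// !addey.
move=> _; rewrite -EFinB -EFinD; transitivity ((K0 - eps * Psi + eps * x)%:E) => //.
by congr EFin; rewrite /I; ring.
Qed.

Let lag_mix_le (s : R) (s01 : 0 < s < 1) : exists2 K, 0 <= K &
  forall s, 0 < s < 1 -> forall z, lag (mix s) z <= s * K.
Proof.
have [M M0 HM] := plan_density_bounded; have [M' M'0 HM'] := plan_exponent_bounded.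
exists ((1 + M) * M') => [|r r01 z]; first by rewrite mulr_ge0// addr_ge0.
have /andP[r0 r1] := r01.
have mix0 : 0 <= mix r z by have := plan_density_ge0 z; rewrite /mix; nra.
rewrite /lag (max_idPr mix0).
apply: le_trans (fenchel_mix reg (plan_exponent z) r01) _.
rewrite -mulrA ler_wpM2l ?(ltW r0)//; apply: ler_pM => //.
  apply: le_trans (ler_normB _ _) _; rewrite normr1 lerD2l ger0_norm ?HM//.
  exact: dconj_ge0 reg _.
by rewrite distrC.
Qed.

(** Comparison with the mixtures of parameter [s] bounds the integral of the gap of the optimizer by
    a multiple of [s]. Letting [s] tend to 0, the gap vanishes almost everywhere, and
    [conjugate_slope] turns equality in Fenchel's inequality into the formula for the density. *)
Theorem optimizer_density (pi : probability (E * E)%type R) :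
  rot_optimizer A B c phi eps P Q pi ->
  pi `<< mu /\ {ae mu, forall z, coupling_density P Q pi z = plan_density z}.
Proof.
move=> [cpl opt].
have half01 : 0 < (1 / 2 : R) < 1 by lra.
have [K Kge0 HK] := lag_mix_le half01.
have lag_mix s (s01 : 0 < s < 1) :
    (\int[mu]_z (lag (coupling_density P Q (mix_law s01)) z)%:E <= (s * K)%:E)%E.
  have [N [mN N0 HN]] := mix_law_density s01.
  rewrite (eq_integral_off_null mN N0 (g := fun z => (lag (mix s) z)%:E)); last first.
    move=> z nN; congr EFin; rewrite /lag.
    have -> // : coupling_density P Q (mix_law s01) z = mix s z.
    by apply: contrapT => h; exact: nN (HN z h).
  apply: (@le_trans _ _ (\int[mu]_z (cst (s * K)%:E z))%E).
    apply: ge0_le_integral => //.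
    - by move=> z _; rewrite lee_fin lag_ge0.
    - apply/measurable_EFinP; apply: measurable_lag.
      apply: measurable_funD => //; apply: measurable_funM => //.
      exact: measurable_plan_density.
    - by move=> z _; rewrite lee_fin HK.
  rewrite integral_cst// [X in (_ * X)%E](probability_setT mu) mule1.
  exact: lexx.
have cost_mix s (s01 : 0 < s < 1) :
    (rot_cost A B c phi eps P Q (mix_law s01) <= (K0 - eps * Psi + eps * (s * K))%:E)%E.
  rewrite (cost_lag (mix_law_coupling s01) (mix_law_dominated s01)) [leRHS]EFinD.
  apply: leeD2l; rewrite [leRHS]EFinM; apply: lee_wpmul2l; last exact: lag_mix.
  by rewrite lee_fin ltW.
have dom : pi `<< mu.
  apply: contrapT => ndom; have := opt _ (mix_law_coupling half01).
  rewrite {1}/rot_cost asboolF// => /le_trans/(_ (cost_mix _ half01)).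
  by rewrite leye_eq.
split => //.
set rho := coupling_density P Q pi.
have mrho : measurable_fun setT rho by exact: coupling_density_measurable.
have X0 : (0 <= \int[mu]_z (lag rho z)%:E)%E.
  by apply: integral_ge0 => z _; rewrite lee_fin lag_ge0.
have Xle s : 0 < s < 1 -> (\int[mu]_z (lag rho z)%:E <= (s * K)%:E)%E.
  move=> s01; have := le_trans (opt _ (mix_law_coupling s01)) (cost_mix _ s01).
  rewrite (cost_lag cpl dom) -/rho [leRHS]EFinD leeD2lE// [leRHS]EFinM lee_pmul2l ?lte_fin//.
have lag0 : (\int[mu]_z (lag rho z)%:E = 0)%E.
  apply/eqP; rewrite eq_le X0 andbT; apply/lee_addgt0Pr => e e_gt0; rewrite add0e.
  pose s := Num.min (1 / 2) (e / (K + 1)).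
  have K1 : 0 < K + 1 by lra.
  have s0 : 0 < s by rewrite lt_min; apply/andP; split; [lra|exact: divr_gt0].
  have s1 : s < 1 by rewrite gt_min; apply/orP; left; lra.
  have s01 : 0 < s < 1 by rewrite s0.
  apply: le_trans (Xle s s01) _; rewrite lee_fin.
  have : s <= e / (K + 1) by rewrite ge_min lexx orbT.
  rewrite ler_pdivlMr// => h; nra.
have mlag : measurable_fun setT (EFin \o lag rho).
  by apply/measurable_EFinP; exact: measurable_lag.
have : ae_eq mu setT (EFin \o lag rho) (cst 0%E).
  apply/(ae_eq_integral_abs mu measurableT mlag).
  rewrite -[RHS]lag0; apply: eq_integral => z _ /=.
  by rewrite ger0_norm// lag_ge0.
have := coupling_density_ge0 dom; apply: filterS2 => z r0 h.
have [lz] := h Logic.I; have E0 : Num.max 0 (rho z) = rho z by exact/max_idPr.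
apply/esym; apply: (conjugate_slope reg) => //.
move: lz; rewrite /lag E0 /psi_xi; lra.
Qed.

Lemma optimizer_variance (pi : probability (E * E)%type R) :
  rot_optimizer A B c phi eps P Q pi ->
  ('V_mu[coupling_density P Q pi] = \int[mu]_z ((plan_density z - 1) ^+ 2)%:E)%E.
Proof.
move=> opt; have [dom rhoE] := optimizer_density opt.
set rho := coupling_density P Q pi.
have mrho : measurable_fun setT rho by exact: coupling_density_measurable.
have rho1 : (\int[mu]_z (rho z)%:E = 1)%E.
  by rewrite (coupling_density_integral dom measurableT); exact: probability_setT.
rewrite /variance unlock /covariance unlock /expectation.
rewrite rho1 /=; apply: ae_eq_integral => //.
- apply/measurable_EFinP; apply: measurable_funM; apply: measurable_funB => //.
- apply/measurable_EFinP; apply: measurable_funX; apply: measurable_funB => //.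
  exact: measurable_plan_density.
- by apply: filterS rhoE => z h _; congr EFin; rewrite -h expr2.
Qed.

End optimizer.

(** * The estimate on a sample *)

Section counting.
Context {R : realType} {n : nat} {T : Type}.

Definition hits (x : 'I_n -> T) (S : set T) : R := \sum_i \1_S (x i).

Lemma le_hits (x : 'I_n -> T) (S S' : set T) : S `<=` S' -> hits x S <= hits x S'.
Proof.
move=> SS'; apply: ler_sum => i _; rewrite !indicE.
have [Sx|Sx] := pselect (S (x i)); last by rewrite memNset// ler0n.
by rewrite !mem_set//; exact: SS'.
Qed.

Lemma sum_weighted_hits (x : 'I_n -> T) (S : set T) (h : R) (w : 'I_n -> R) : 0 <= h ->
  (forall i, 0 <= w i) -> (forall i, S (x i) -> h <= w i) -> h * hits x S <= \sum_i w i.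
Proof.
move=> h0 w0 hw; rewrite mulr_sumr; apply: ler_sum => i _; rewrite indicE.
have [Sx|Sx] := pselect (S (x i)); last by rewrite memNset// mulr0.
by rewrite mem_set// mulr1; exact: hw.
Qed.

End counting.

Section sample_poincare.
Context {R : realType} {T : Type} {n N : nat}.
Context (cell : T -> 'I_N) (near : rel 'I_N) (p : 'I_N -> R) (C : R) (x : 'I_n -> T).
Hypothesis near_sym : symmetric near.
Hypothesis near_refl : reflexive near.
Hypothesis p0 : forall k, 0 <= p k.
Hypothesis C1 : 1 <= C.
Hypothesis cells : forall w : 'I_N -> R,
  \sum_k \sum_l p k * p l * (w k - w l) ^+ 2 <=
  C * \sum_k \sum_(l | near k l) p k * p l * (w k - w l) ^+ 2.
Local Notation cnt k := (hits x [set y | cell y = k]).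
Hypothesis ratio : forall k,
  2 / 3 * (n%:R * p k) <= cnt k <= 4 / 3 * (n%:R * p k).

Let sum_cells (F : 'I_N -> 'I_N -> R) :
  \sum_i \sum_j F (cell (x i)) (cell (x j)) = \sum_k \sum_l cnt k * cnt l * F k l.
Proof.
have E (G : 'I_N -> R) : \sum_(i < n) G (cell (x i)) = \sum_k cnt k * G k.
  under [RHS]eq_bigr do rewrite mulr_suml.
  rewrite exchange_big/=; apply: eq_bigr => i _.
  rewrite (bigD1 (cell (x i)))//= indicE mem_set//= mul1r big1 ?addr0// => k ki.
  by rewrite indicE memNset ?mul0r//= => h; move: ki; rewrite h eqxx.
rewrite (E (fun k => \sum_j F k (cell (x j)))); apply: eq_bigr => k _.
rewrite (E (F k)) mulr_sumr.
by apply: eq_bigr => l _; rewrite mulrA.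
Qed.

(** The frequencies lose [(4/3)^2] on one side and [(2/3)^2] on the other, whence the factor 4. As
    the difference of both sides is a form with weights [4 C near - 1], nonnegative on the diagonal,
    [poincare_blowup] reduces it to functions of the cell. *)
Lemma sample_poincare (u : 'I_n -> R) :
  \sum_i \sum_j (u i - u j) ^+ 2 <=
  4 * C * \sum_i \sum_(j | near (cell (x i)) (cell (x j))) (u i - u j) ^+ 2.
Proof.
pose q k l : R := 4 * C * (near k l)%:R - 1.
have qC k l : q k l = q l k by rewrite /q near_sym.
have q0 k : 0 <= q k k by have := C1; rewrite /q near_refl mulr1; lra.
have cnt_ge0 k : 0 <= cnt k.
  by apply: sumr_ge0 => i _; rewrite indicE ler0n.
have H (w : 'I_N -> R) :
    0 <= \sum_i \sum_j q (cell (x i)) (cell (x j)) * (w (cell (x i)) - w (cell (x j))) ^+ 2.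
  rewrite (sum_cells (fun k l => q k l * (w k - w l) ^+ 2)).
  have -> : \sum_k \sum_l cnt k * cnt l * (q k l * (w k - w l) ^+ 2) =
      4 * C * (\sum_k \sum_(l | near k l) cnt k * cnt l * (w k - w l) ^+ 2)
      - \sum_k \sum_l cnt k * cnt l * (w k - w l) ^+ 2.
    rewrite mulr_sumr -sumrB; apply: eq_bigr => k _.
    rewrite [X in _ * X]big_mkcond mulr_sumr -sumrB; apply: eq_bigr => l _.
    by rewrite /q; case: (near k l) => /=; ring.
  rewrite subr_ge0.
  apply: (@le_trans _ _ ((4 / 3 * n%:R) ^+ 2 *
      \sum_k \sum_l p k * p l * (w k - w l) ^+ 2)).
    rewrite mulr_sumr; apply: ler_sum => k _; rewrite mulr_sumr; apply: ler_sum => l _.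
    rewrite [leRHS]mulrA ler_wpM2r ?sqr_ge0//.
    have -> : (4 / 3 * n%:R) ^+ 2 * (p k * p l) =
      (4 / 3 * (n%:R * p k)) * (4 / 3 * (n%:R * p l)) by ring.
    by have [/andP[_ ?] /andP[_ ?]] := (ratio k, ratio l); apply: ler_pM => //; exact: cnt_ge0.
  apply: (@le_trans _ _ ((4 / 3 * n%:R) ^+ 2 *
      (C * \sum_k \sum_(l | near k l) p k * p l * (w k - w l) ^+ 2))).
    by apply: ler_wpM2l; rewrite ?sqr_ge0.
  have -> : (4 / 3 * n%:R) ^+ 2 *
      (C * \sum_k \sum_(l | near k l) p k * p l * (w k - w l) ^+ 2) =
    4 * C * ((2 / 3 * n%:R) ^+ 2 *
      \sum_k \sum_(l | near k l) p k * p l * (w k - w l) ^+ 2) by field.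
  apply: ler_wpM2l; first by have := C1; lra.
  rewrite mulr_sumr; apply: ler_sum => k _; rewrite mulr_sumr; apply: ler_sum => l _.
  rewrite [leLHS]mulrA ler_wpM2r ?sqr_ge0//.
  have -> : (2 / 3 * n%:R) ^+ 2 * (p k * p l) =
      (2 / 3 * (n%:R * p k)) * (2 / 3 * (n%:R * p l)) by ring.
  have p_ge0 m : 0 <= 2 / 3 * (n%:R * p m).
    by apply: mulr_ge0; [lra|apply: mulr_ge0].
  by have [/andP[? _] /andP[? _]] := (ratio k, ratio l); apply: ler_pM => //; exact: p_ge0.
have := poincare_blowup (cell := cell \o x) u qC q0 H.
have -> : \sum_i \sum_j q ((cell \o x) i) ((cell \o x) j) * (u i - u j) ^+ 2 =
    4 * C * (\sum_i \sum_(j | near (cell (x i)) (cell (x j))) (u i - u j) ^+ 2)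
    - \sum_i \sum_j (u i - u j) ^+ 2.
  rewrite mulr_sumr -sumrB; apply: eq_bigr => k _.
  rewrite [X in _ * X]big_mkcond mulr_sumr -sumrB; apply: eq_bigr => l _.
  by rewrite /q/=; case: (near _ _) => /=; ring.
by rewrite subr_ge0.
Qed.

End sample_poincare.

(** * The deterministic estimate under typical frequencies *)

Section good_sample.
Context {R : realType} {d n : nat} (n0 : (0 < n)%N).
Local Notation E := 'rV[R]_d.
Context (phi : R -> R) (t delta : R).
Hypothesis reg : regularizer phi t delta.
Local Notation dpsi := (derive1 (conjugate phi)).
Context (ddpsi : R -> R).
Hypothesis C11 : C11loc_with (conjugate phi) ddpsi.
Local Notation h := (ddpsi (t - delta)).
Hypothesis h0 : 0 < h.
Context (L eps r kappa gam mP mQ C : R) (x y : 'I_n -> E).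
Hypotheses (L0 : 0 < L) (eps0 : 0 < eps) (eps1 : eps <= 1).
Hypothesis rE : 2 * L / eps * r = delta / 4.
Hypotheses (gam0 : 0 < gam) (mP0 : 0 < mP) (mQ0 : 0 < mQ) (C0 : 0 < C).
Hypothesis kappa0 : 0 <= kappa.
(* [xih] and [xi] are the exponents of the empirical and of the population plan. *)
Context (xih xi : 'I_n -> 'I_n -> R) (u v : 'I_n -> R).
Hypothesis uvE : forall i j, xih i j - xi i j = (u i + v j) / eps.
Hypothesis uv_bnd : forall i j, `|u i + v j| <= 2 * kappa.
Hypothesis slack : forall i i' j j',
  xih i j - 2 * L / eps * (enorm (x i - x i') + enorm (y j - y j')) <= xih i' j'.
Hypothesis row1 : forall i, \sum_j dpsi (xih i j) = n%:R.
Hypothesis col1 : forall j, \sum_i dpsi (xih i j) = n%:R.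
Hypothesis gam_col : forall j, n%:R^-1 * \sum_i ddpsi (xih i j + delta / 4) <= gam.
Hypothesis gam_row : forall i, n%:R^-1 * \sum_j ddpsi (xih i j + delta / 4) <= gam.
Hypothesis ballP : forall i, n%:R * mP / 2 <= hits x (eball (x i) (2 * r)).
Hypothesis ballQ : forall j, n%:R * mQ / 2 <= hits y (eball (y j) (2 * r)).
Context (S : rel 'I_n).
Hypothesis S_near : forall i i', S i i' -> enorm (x i - x i') <= r.
Hypothesis S_poincare : forall u : 'I_n -> R,
  \sum_i \sum_i' (u i - u i') ^+ 2 <=
  C * \sum_i \sum_(i' | S i i') (u i - u i') ^+ 2.

Let nR : 0 < n%:R :> R. Proof. by rewrite ltr0n. Qed.
Let delta0 : 0 < delta. Proof. exact: reg_delta_gt0 reg. Qed.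

(** The threshold leaves a margin of [delta / 4] above [t - delta], spent in [slope] on the way to
    the population exponent. *)
Let w i j : R := if t - 3 / 4 * delta <= xih i j then h else 0.

Let w0 i j : 0 <= w i j. Proof. by rewrite /w; case: ifP => // _; exact: ltW. Qed.

Let w_le i j : w i j <= ddpsi (xih i j + delta / 4).
Proof.
have := delta0 => dl; rewrite /w; case: ifPn => [h1|_]; last exact: (ddpsi_ge0 reg C11).
by apply: (C11_monotone C11); lra.
Qed.

Let sum_gam (F G : 'I_n -> R) : (forall i, F i <= G i) ->
  n%:R^-1 * \sum_i G i <= gam -> \sum_i F i <= n%:R * gam.
Proof.
move=> FG; rewrite ler_pdivrMl// => Gg; apply: le_trans Gg.
exact: ler_sum.
Qed.

Let high (F : 'I_n -> R) : \sum_i dpsi (F i) = n%:R -> exists i, t <= F i.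
Proof.
move=> Fn; apply: contrapT => /forallNP H.
have : \sum_i dpsi (F i) < \sum_(i < n) 1.
  apply: ltr_sum; first by apply/hasP; exists (Ordinal n0) => //; rewrite mem_index_enum.
  move=> i _; rewrite ltNge; apply/negP => /(dconj_ge1 reg); exact: H.
by rewrite Fn sumr_const card_ord ltxx.
Qed.

Let r0 : 0 <= r.
Proof.
have Le : 0 < 2 * L / eps by rewrite divr_gt0// mulr_gt0.
by rewrite -(pmulr_rge0 _ Le) rE; have := delta0; lra.
Qed.

(** From an entry of row [i] with exponent at least [t], moving the row by [r] and the column by
    [2 r] lowers the exponent by at most [3 delta / 4]: both weights equal [h] on a whole ball of
    columns. *)
Let overlap i i' : S i i' -> n%:R * (h ^+ 2 * mQ / 2) <= \sum_j w i j * w i' j.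
Proof.
move=> Sii; have [j0 hj0] := high (row1 i).
have Le : 0 < 2 * L / eps by rewrite divr_gt0// mulr_gt0.
have wE i'' : enorm (x i - x i'') <= r -> forall j, eball (y j0) (2 * r) (y j) -> w i'' j = h.
  move=> xi'' j; rewrite /eball/= => yj; rewrite /w ifT//.
  have := slack i i'' j0 j; rewrite (enormB (y j0)) => sl.
  have : 2 * L / eps * (enorm (x i - x i'') + enorm (y j - y j0)) <= 2 * L / eps * (r + 2 * r).
    by rewrite ler_pM2l//; lra.
  have -> : 2 * L / eps * (r + 2 * r) = 3 * (2 * L / eps * r) by ring.
  by rewrite rE; lra.
apply: (@le_trans _ _ (h ^+ 2 * hits y (eball (y j0) (2 * r)))).
  have := ballQ j0; have : 0 < h ^+ 2 by rewrite exprn_gt0.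
  by move=> h2 b; have := ler_wpM2l (ltW h2) b; lra.
apply: sum_weighted_hits => [|j|j yj]; first exact: sqr_ge0.
  exact: mulr_ge0.
rewrite !wE//; first exact: S_near.
by rewrite subrr enorm0.
Qed.

Let col_om j : n%:R * (h * mP / 2) <= \sum_i w i j.
Proof.
have [i0 hi0] := high (col1 j).
have Le : 0 < 2 * L / eps by rewrite divr_gt0// mulr_gt0.
apply: (@le_trans _ _ (h * hits x (eball (x i0) (2 * r)))).
  by have := ler_wpM2l (ltW h0) (ballP i0); lra.
apply: sum_weighted_hits => [|i|i]; [exact: ltW|exact: w0|].
rewrite /eball/= => xi0; rewrite /w ifT//.
have := slack i0 i j j; rewrite subrr enorm0 addr0 (enormB (x i0)) => sl.
have : 2 * L / eps * enorm (x i - x i0) <= 2 * L / eps * (2 * r).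
  by rewrite ler_pM2l// ltW.
have -> : 2 * L / eps * (2 * r) = 2 * (2 * L / eps * r) by ring.
by have := delta0; rewrite rE; lra.
Qed.

Let M0 := Num.max (2 ^+ 6 * kappa ^+ 2 / delta ^+ 2) 1.
Let alpha := h ^+ 2 * mQ / (2 * gam * C).
Let beta := Num.min (4 * alpha * h * mP / (h * mP + 8 * gam)) (1 / 2 * h * mP).

Let M0_ge1 : 1 <= M0. Proof. by rewrite /M0 le_max lexx orbT. Qed.

(** The largest factor, capped at 1, for which [theta * (2 kappa)] is at most [delta / 4]. *)
Let theta := (Num.sqrt M0)^-1.

Let theta0 : 0 < theta.
Proof. by rewrite invr_gt0 sqrtr_gt0; apply: lt_le_trans M0_ge1. Qed.

Let thetaE : theta ^+ 2 = M0^-1.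
Proof. by rewrite exprVn sqr_sqrtr//; apply: le_trans M0_ge1. Qed.

Let theta1 : theta <= 1.
Proof.
rewrite invf_le1 ?sqrtr_gt0; last by apply: lt_le_trans M0_ge1.
by rewrite -[X in X <= _]sqrtr1 ler_wsqrtr.
Qed.

Let theta_kappa : theta * (2 * kappa) <= delta / 4.
Proof.
have d4 : 0 <= delta / 4 by have := delta0; lra.
have k2 : 0 <= theta * (2 * kappa) by rewrite mulr_ge0 ?(ltW theta0)// mulr_ge0.
rewrite -(@ler_pXn2r _ 2)// ?nnegrE// exprMn thetaE.
have M0p : 0 < M0 by apply: lt_le_trans M0_ge1.
rewrite mulrC ler_pdivrMr//.
have : 2 ^+ 6 * kappa ^+ 2 / delta ^+ 2 <= M0 by rewrite /M0 le_max lexx.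
have d2 : 0 < delta ^+ 2 by rewrite exprn_gt0// delta0.
rewrite ler_pdivrMr// => H.
by nra.
Qed.

(** Where the weight is 0 this is monotonicity. Elsewhere [dconj_slope_frac] is used with the
    fraction [eps * theta], at most 1 since [eps <= 1]; the exponents differ by [(u i + v j) / eps],
    so the part of the segment used has length at most [delta / 4]. *)
Let slope i j : theta * w i j * (u i + v j) ^+ 2 <=
  (dpsi (xih i j) - dpsi (xi i j)) * (u i + v j).
Proof.
have uv : u i + v j = eps * (xih i j - xi i j).
  by rewrite uvE mulrCA divff ?mulr1// gt_eqF.
rewrite /w; case: ifPn => [hx|_].
  have s0 : 0 < eps * theta by rewrite mulr_gt0.
  have s1 : eps * theta <= 1 by rewrite mulr_ile1// ?(ltW eps0)// ltW.
  have ha : t - delta + eps * theta * `|xih i j - xi i j| <= xih i j.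
    have -> : eps * theta * `|xih i j - xi i j| = theta * `|u i + v j|.
      by rewrite uv normrM (gtr0_norm eps0); ring.
    have : theta * `|u i + v j| <= theta * (2 * kappa) by rewrite ler_pM2l.
    by have := theta_kappa; have := delta0; lra.
  have := dconj_slope_frac reg C11 s0 s1 ha; rewrite uv => H.
  have -> : theta * h * (eps * (xih i j - xi i j)) ^+ 2 =
     eps * (eps * theta * h * (xih i j - xi i j) ^+ 2) by ring.
  by rewrite [leRHS]mulrCA ler_pM2l.
rewrite mulr0 mul0r uv mulrCA mulr_ge0 ?(ltW eps0)//.
have [le|lt] := leP (xi i j) (xih i j).
  by rewrite mulr_ge0// subr_ge0// (dconj_nd reg).
by rewrite mulr_le0// subr_le0 ?(dconj_nd reg)// ltW.
Qed.

(** The two entries of the minimum in [beta] bound the two terms into which [gap_const] is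
    regrouped, by [4 / beta] and [2 / beta]. *)
Let gap_beta : 0 < beta /\
  gap_const n (n%:R * gam) (n%:R * (h ^+ 2 * mQ / 2)) (n%:R * (h * mP / 2)) C <= 6 / beta.
Proof.
have h20 : 0 < h ^+ 2 by rewrite exprn_gt0.
have hP : 0 < h * mP by rewrite mulr_gt0.
have alpha0 : 0 < alpha.
  by apply: divr_gt0; [exact: mulr_gt0|apply: mulr_gt0 => //; exact: mulr_gt0].
have D0 : 0 < h * mP + 8 * gam by apply: addr_gt0 => //; exact: mulr_gt0.
have N0 : 0 < 4 * alpha * h * mP.
  by apply: mulr_gt0 => //; apply: mulr_gt0 => //; exact: mulr_gt0.
have b0 : 0 < beta.
  rewrite /beta lt_min; apply/andP; split; first exact: divr_gt0.
  by rewrite -mulrA mulr_gt0.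
split => //.
have b1 : beta^-1 >= (h * mP + 8 * gam) / (4 * alpha * h * mP).
  rewrite -[leLHS]invrK lef_pV2 ?posrE// ?invr_gt0 ?divr_gt0//.
  by rewrite invf_div /beta ge_min lexx.
have b2 : beta^-1 >= 2 / (h * mP).
  rewrite -[leLHS]invrK lef_pV2 ?posrE// ?invr_gt0 ?divr_gt0//.
  by rewrite invf_div /beta ge_min (_ : 1 / 2 * h * mP = h * mP / 2) ?lexx ?orbT//; ring.
have -> : gap_const n (n%:R * gam) (n%:R * (h ^+ 2 * mQ / 2)) (n%:R * (h * mP / 2)) C =
    (h * mP + 4 * gam) / (alpha * (h * mP)) + 2 * (2 / (h * mP)).
  by rewrite /gap_const /alpha; field; rewrite !gt_eqF.
apply: (@le_trans _ _ (4 * ((h * mP + 8 * gam) / (4 * alpha * h * mP)) + 2 * (2 / (h * mP)))).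
  rewrite lerD2r.
  have -> : 4 * ((h * mP + 8 * gam) / (4 * alpha * h * mP)) =
    (h * mP + 8 * gam) / (alpha * (h * mP)) by field; rewrite !gt_eqF.
  have aP : 0 < alpha * (h * mP) by exact: mulr_gt0.
  by rewrite ler_pM2r ?invr_gt0//; have := gam0; lra.
lra.
Qed.

Lemma good_sample_bound :
  (n%:R ^+ 2)^-1 * \sum_i \sum_j (u i + v j) ^+ 2 <=
  36 * M0 / beta ^+ 2 * (n%:R^-1 *
    (\sum_i (n%:R^-1 * \sum_j (dpsi (xi i j) - 1)) ^+ 2
     + \sum_j (n%:R^-1 * \sum_i (dpsi (xi i j) - 1)) ^+ 2)).
Proof.
have [b0 gb] := gap_beta.
have bb0 : 0 < n%:R * (h ^+ 2 * mQ / 2) by rewrite !mulr_gt0// exprn_gt0.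
have om0 : 0 < n%:R * (h * mP / 2) by rewrite !mulr_gt0.
have G0 : 0 <= n%:R * gam by rewrite mulr_ge0// ltW.
have := monotone_gap_estimate n0 w0 bb0 om0 (ltW C0) G0
  (fun j => sum_gam (fun i => w_le i j) (gam_col j))
  (fun i => sum_gam (fun j => w_le i j) (gam_row i))
  col_om overlap S_poincare theta0 slope.
set gc := gap_const _ _ _ _ _ in gb *.
set X := \sum_i \sum_j (u i + v j) ^+ 2.
(* The empirical rows sum to [n] exactly, so only the defect of the population plan remains, up to
   sign. *)
have rowE i : (\sum_j (dpsi (xih i j) - dpsi (xi i j))) ^+ 2 =
    n%:R ^+ 2 * (n%:R^-1 * \sum_j (dpsi (xi i j) - 1)) ^+ 2.
  rewrite !sumrB row1 sumr_const card_ord -exprMn mulrA divff ?gt_eqF// mul1r.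
  by rewrite -sqrrN opprB.
have colE j : (\sum_i (dpsi (xih i j) - dpsi (xi i j))) ^+ 2 =
    n%:R ^+ 2 * (n%:R^-1 * \sum_i (dpsi (xi i j) - 1)) ^+ 2.
  rewrite !sumrB col1 sumr_const card_ord -exprMn mulrA divff ?gt_eqF// mul1r.
  by rewrite -sqrrN opprB.
rewrite (eq_bigr _ (fun i _ => rowE i)) (eq_bigr _ (fun j _ => colE j)) -!mulr_sumr -mulrDr.
set Y := _ + _ => H.
have Y0 : 0 <= Y by apply: addr_ge0; apply: sumr_ge0 => i _; exact: sqr_ge0.
have M0p : 0 < M0 by apply: lt_le_trans M0_ge1.
have gc0 : 0 <= gc.
  rewrite /gc /gap_const; apply: addr_ge0.
    by apply: divr_ge0; [apply: mulr_ge0 => //; exact: ltW|exact: ltW].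
  apply: mulr_ge0; first by apply: divr_ge0; exact: ltW.
  apply: addr_ge0 => //; apply: mulr_ge0; first by rewrite mulr_ge0.
  by apply: divr_ge0; [apply: mulr_ge0 => //; exact: ltW|rewrite mulr_ge0// ltW].
have gc2 : gc ^+ 2 <= 36 / beta ^+ 2.
  have -> : 36 / beta ^+ 2 = (6 / beta) ^+ 2 by field; rewrite gt_eqF.
  by rewrite ler_sqr ?nnegrE// divr_ge0// ltW.
move: H; rewrite thetaE ler_pdivrMl// => H.
rewrite ler_pdivrMl ?exprn_gt0//.
apply: le_trans H _.
have -> : M0 * (gc ^+ 2 / n%:R * (n%:R ^+ 2 * Y)) = gc ^+ 2 * (M0 * n%:R * Y).
  by field; rewrite gt_eqF.
have -> : n%:R ^+ 2 * (36 * M0 / beta ^+ 2 * (n%:R^-1 * Y)) =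
    36 / beta ^+ 2 * (M0 * n%:R * Y) by field; rewrite !gt_eqF.
by apply: ler_wpM2r => //; rewrite !mulr_ge0// ltW.
Qed.

End good_sample.

Section empirical_integral.
Context {R : realType} {d n : nat}.
Local Notation E := 'rV[R]_d.
Implicit Types (s : n.-tuple E) (A B : set E).

Lemma integral_empirical s B (F : E -> R) : measurable B ->
  (forall y, B y -> 0 <= F y) -> measurable_fun B F -> (forall i, B (tnth s i)) ->
  (\int[empirical s]_(y in B) (F y)%:E = (n%:R^-1 * \sum_i F (tnth s i))%:E)%E.
Proof.
move=> mB F0 mF sB.
have mF' : measurable_fun B (fun y => (F y)%:E) by exact/measurable_EFinP.
rewrite /empirical (ge0_integral_mscale _ mB)//.
rewrite ge0_integral_measure_sum//.
rewrite EFinM -sumEFin; congr (_ * _)%E.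
apply: eq_bigr => i _; rewrite integral_dirac//.
by rewrite -tnth_nth diracE mem_set// mul1e.
Qed.

Lemma empirical_carrier s B : (0 < n)%N -> (forall i, B (tnth s i)) -> empirical s B = 1%E.
Proof.
move=> n0 sB; rewrite /empirical /mscale/= /msum.
rewrite (eq_bigr (fun=> 1%E)) => [|i _]; last first.
  by rewrite -tnth_nth /= /dirac indicE mem_set.
rewrite sumEFin sumr_const card_ord -EFinM mulVf// pnatr_eq0 -lt0n//.
Qed.

Lemma integral_empirical_prod (s : n.-tuple E * n.-tuple E) A B (F : E * E -> R) :
  measurable A -> measurable B ->
  (forall z, (A `*` B) z -> 0 <= F z) -> measurable_fun (A `*` B) F ->
  (forall i, A (tnth s.1 i)) -> (forall j, B (tnth s.2 j)) ->
  (\int[empirical s.1 \x empirical s.2]_(z in A `*` B) (F z)%:E =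
   ((n%:R ^+ 2)^-1 * \sum_i \sum_j F (tnth s.1 i, tnth s.2 j))%:E)%E.
Proof.
move=> mA mB F0 mF sA sB.
have mAB : measurable (A `*` B) by exact: measurableX.
pose G := F \_ (A `*` B).
have G0 z : 0 <= G z.
by rewrite /G patchE; case: ifPn => // /set_mem; exact: F0.
have mG : measurable_fun setT G by apply/(measurable_restrictT _ mAB).
transitivity (\int[empirical s.1 \x empirical s.2]_z (G z)%:E)%E.
  rewrite integral_mkcond; apply: eq_integral => z _.
  by rewrite /G !patchE; case: ifP.
rewrite (fubini_tonelli1 (m1 := empirical s.1) (m2 := empirical s.2) (EFin \o G)).
- rewrite /fubini_F; under eq_integral => x _.
    rewrite /= (integral_empirical (s := s.2) measurableT (F := fun y => G (x, y)))//; last first.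
      exact: measurableT_comp mG (pair1_measurable _).
    over.
  rewrite (integral_empirical (s := s.1) measurableT).
  + congr (_%:E); rewrite -mulr_sumr mulrA -invfM -expr2.
    congr (_ * _); apply: eq_bigr => i _; apply: eq_bigr => j _.
    by rewrite /G patchE mem_set//; split => /=.
  + by move=> x _; rewrite mulr_ge0// sumr_ge0.
  + apply: measurable_funM => //; apply: measurable_sum => j.
    exact: measurableT_comp mG (pair2_measurable _).
  + by [].
- by apply/measurable_EFinP.
- by move=> z; rewrite lee_fin.
Qed.

End empirical_integral.

Section net_family.
Context {R : realType} {d : nat} (d0 : (0 < d)%N) (mu : probability 'rV[R]_d R).
Hypothesis cA : compact (msupport mu).
Local Notation E := 'rV[R]_d.

(** The constant has to serve every radius, hence every [eps]; bounding [r] by [r1] makes the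
    packing bound uniform. *)
Lemma exists_net (r1 : R) : 0 < r1 -> exists2 C : R, 0 <= C &
  forall r, 0 < r <= r1 -> exists N (x : 'I_N -> E),
  [/\ forall k, msupport mu (x k),
      forall y, msupport mu y -> exists k, enorm (y - x k) < r
    & N%:R <= C * r ^- d].
Proof.
move=> r10; have [M M1 HM] := compact_enorm_bounded cA.
exists ((4 * d%:R * (M + r1)) ^+ d).
  by rewrite exprn_ge0// mulr_ge0 ?mulr_ge0// addr_ge0// ltW.
move=> r /andP[r0 rr1].
have [N [x [sx cx Nx]]] := maximal_net d0 r0 M1 HM.
exists N, x; split => //; first exact: (sx.1).
apply: le_trans Nx _; rewrite -exprVn -exprMn.
apply: lerXn2r; rewrite ?nnegrE.
- by rewrite !mulr_ge0 ?invr_ge0 ?addr_ge0// ltW.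
- by rewrite !mulr_ge0 ?invr_ge0 ?addr_ge0// ltW.
rewrite ler_wpM2r ?invr_ge0 ?(ltW r0)//.
by rewrite ler_wpM2l ?mulr_ge0// lerD2l.
Qed.

(** The ball of radius [2 r] around a sample point contains the ball of radius [r] around a nearby
    net point, so that finitely many fixed balls control all the random ones. *)
Lemma net_hits (n N : nat) (r : R) (x : 'I_N -> E) (s : 'I_n -> E) :
  (forall k, msupport mu (x k)) ->
  (forall y, msupport mu y -> exists k, enorm (y - x k) < r) ->
  (forall i, msupport mu (s i)) ->
  (forall k, 2 / 3 * (n%:R * fine (mu (eball (x k) r))) <= hits s (eball (x k) r)) ->
  forall i, n%:R * min_ball_mass mu (msupport mu) r / 2 <= hits s (eball (s i) (2 * r)).
Proof.
move=> xA cx sA Hs i; have [k ik] := cx _ (sA i).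
apply: le_trans (le_hits s (_ : eball (x k) r `<=` _)); last first.
  move=> y; rewrite /eball/= => yk.
  have := enorm_dist (x k) y (s i); rewrite (enormB (x k)); lra.
apply: le_trans (Hs k).
have := le_min_ball_mass r (xA k); rewrite -(probability_fineK mu (measurable_eball _ _)) lee_fin.
set m := min_ball_mass _ _ _; set p := fine _ => mp.
have p0 : 0 <= p by rewrite fine_ge0.
have := ler_wpM2l (ler0n R n) mp; have : 0 <= n%:R * p by rewrite mulr_ge0.
rewrite [fine p%:E]/=; lra.
Qed.

End net_family.

Section cell_family.
Context {R : realType} {d : nat} (d0 : (0 < d)%N) (P : probability 'rV[R]_d R).
Local Notation E := 'rV[R]_d.
Local Notation A := (msupport P).
Context (dens : E -> R) (lam Lam : R).
Hypothesis cA : compact A.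
Hypothesis convA : convex_set A.
Hypothesis densP : has_lebesgue_density P dens.
Hypothesis lam0 : 0 < lam.
Hypothesis dens_bnd : forall x, A x -> lam <= dens x <= Lam.

(** Cells are built at scale [r / 16]: their trace on the support has diameter at most [r / 4], and
    each contains a ball of radius [r / 16], of mass at least a multiple of [r^d] by
    [ball_mass_ge]. *)
Lemma exists_fine_cells (r1 : R) : 0 < r1 -> exists C c : R, [/\ 0 <= C, 0 < c &
  forall r, 0 < r <= r1 -> exists N (cell : E -> 'I_N),
  [/\ forall k, measurable [set x | cell x = k],
      forall x y, A x -> A y -> cell x = cell y -> enorm (x - y) <= r / 4,
      forall k, exists2 x, A x & cell x = k,
      forall k, c * r ^+ d <= cell_mass P cell k
    & N%:R <= C * r ^- d]].
Proof.
move=> r10; have [M M1 HM] := compact_enorm_bounded cA.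
have A0 : exists x, A x by exact: msupport_neq0.
have diam0 : 0 <= ediam A.
  by have [x Ax] := A0; apply: le_trans (enorm_le_ediam cA Ax Ax); rewrite subrr enorm0.
pose D := ediam A + 1 + r1.
have D0 : 0 < D by rewrite /D; lra.
have Lam0 := Lam_gt0 lam0 dens_bnd.
exists ((4 * d%:R * (M + r1) * 8) ^+ d), (lam / Lam * (16 * D) ^- d); split.
- by rewrite exprn_ge0// !mulr_ge0// addr_ge0// ltW.
- by apply: mulr_gt0; [exact: divr_gt0|rewrite invr_gt0 exprn_gt0// mulr_gt0].
move=> r /andP[r0 rr1].
have rho0 : 0 < r / 16 by lra.
have [N [cell [mcell diamc ballc Nc]]] := exists_cells d0 rho0 M1 A0 HM.
exists N, cell; split => //.
- by move=> x y Ax Ay xy; apply: le_trans (diamc x y Ax Ay xy) _; lra.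
- move=> k; have [x Ax xk] := ballc k; exists x => //.
  by apply: xk; exact: eball_center.
- move=> k; have [x Ax xk] := ballc k.
  rewrite -lee_fin /cell_mass probability_fineK//.
  apply: (@le_trans _ _ (P (eball x (r / 16)))); last first.
    by apply: le_measure; rewrite ?inE//; exact: measurable_eball.
  have -> : lam / Lam * (16 * D) ^- d * r ^+ d = lam / Lam * ((r / 16) / D) ^+ d.
    by rewrite -mulrA -exprVn -exprMn; congr (_ * _ ^+ _); field; rewrite gt_eqF.
  apply: (ball_mass_ge cA convA densP lam0 dens_bnd) => //; rewrite /D; lra.
apply: le_trans Nc _; rewrite -exprVn -exprMn.
apply: lerXn2r; rewrite ?nnegrE.
- by rewrite !mulr_ge0 ?invr_ge0// ?addr_ge0// ?mulr_ge0// ltW.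
- by rewrite !mulr_ge0 ?invr_ge0 ?addr_ge0// ltW.
have -> : 4 * d%:R * (M + 2 * (r / 16)) / (2 * (r / 16)) =
   4 * d%:R * (M + r / 8) * 8 / r by field; rewrite gt_eqF.
rewrite ler_wpM2r ?invr_ge0 ?(ltW r0)// ler_wpM2r//.
rewrite ler_wpM2l ?mulr_ge0// lerD2l; lra.
Qed.

(** Sample points in near cells are at distance at most [r / 4 + r / 2 + r / 4]. *)
Lemma near_cells_sample_poincare (n N K : nat) (r : R) (cell : E -> 'I_N) (s : 'I_n -> E) :
  (0 < K)%N -> ediam A / K%:R <= r / 2 ->
  (forall k, measurable [set x | cell x = k]) ->
  (forall x y, A x -> A y -> cell x = cell y -> enorm (x - y) <= r / 4) ->
  (forall k, exists2 x, A x & cell x = k) ->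
  (forall i, A (s i)) ->
  (forall k, 2 / 3 * (n%:R * cell_mass P cell k) <= hits s [set x | cell x = k]
     <= 4 / 3 * (n%:R * cell_mass P cell k)) ->
  exists2 S : rel 'I_n, (forall i j, S i j -> enorm (s i - s j) <= r) &
  forall u : 'I_n -> R, \sum_i \sum_j (u i - u j) ^+ 2 <=
    4 * (Lam ^+ 2 / lam ^+ 2 * K%:R ^+ (d + 2)) * \sum_i \sum_(j | S i j) (u i - u j) ^+ 2.
Proof.
move=> K0 Kr mcell diamc ex sA ratio.
pose near := near_cells P cell (ediam A / K%:R).
exists (fun i j => near (cell (s i)) (cell (s j))).
  move=> i j /asboolP[x [y [Ax Ay xi yj xy]]].
  have h1 := diamc _ _ (sA i) Ax (esym xi).
  have h2 := diamc _ _ Ay (sA j) yj.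
  have := enorm_dist x (s i) (s j); have := enorm_dist y x (s j); lra.
apply: (sample_poincare (p := cell_mass P cell)) => //.
- move=> k l; apply/asboolP/asboolP => -[x [y [Ax Ay xi yj xy]]].
    by exists y, x; split => //; rewrite enormB.
  by exists y, x; split => //; rewrite enormB.
- move=> k; have [x Ax xk] := ex k; apply/asboolP; exists x, x; split => //.
  rewrite subrr enorm0 divr_ge0//.
  by apply: le_trans (enorm_le_ediam cA Ax Ax); rewrite subrr enorm0.
- by move=> k; rewrite /cell_mass fine_ge0.
- have lL := lam_le_Lam dens_bnd.
  have l1 : 1 <= Lam ^+ 2 / lam ^+ 2.
    rewrite ler_pdivlMr ?exprn_gt0// mul1r lerXn2r ?nnegrE ?(ltW lam0)//.
    exact: le_trans (ltW lam0) lL.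
  by apply: mulr_ege1 => //; apply: exprn_ege1; rewrite ler1n.
- move=> w; exact: (cell_poincare cA convA densP lam0 dens_bnd mcell w K0).
Qed.

End cell_family.

Section relative_deviation.
Context {R : realType} {T : Type} {n : nat}.

(* The factor 9 makes it at least 1 as soon as the number of hits is off by a
   third of its expected value. *)
Definition relative_deviation (p : R) (s : 'I_n -> T) (S : set T) : R :=
  9 * (hits s S - n%:R * p) ^+ 2 / (n%:R * p) ^+ 2.

Lemma relative_deviation_ge0 p s S : 0 <= relative_deviation p s S.
Proof. by apply: divr_ge0; [apply: mulr_ge0 => //|]; exact: sqr_ge0. Qed.

Lemma relative_deviation_lt1 p s S : 0 < n%:R * p -> relative_deviation p s S < 1 ->
  2 / 3 * (n%:R * p) <= hits s S <= 4 / 3 * (n%:R * p).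
Proof.
move=> np; rewrite /relative_deviation ltr_pdivrMr ?exprn_gt0// mul1r.
set a := n%:R * p in np *; set b := hits s S => h.
have h2 : (3 * (b - a)) ^+ 2 < a ^+ 2.
  by have -> : (3 * (b - a)) ^+ 2 = 9 * (b - a) ^+ 2 by ring.
have : `|3 * (b - a)| < a.
  by rewrite -(@ltr_pXn2r _ 2)// ?nnegrE ?(ltW np)// (real_normK (num_real _)).
by rewrite ltr_norml => /andP[h3 h4]; apply/andP; split; lra.
Qed.

End relative_deviation.

Section sample_estimate.
Context {R : realType} {d n : nat} (n0 : (0 < n)%N).
Local Notation E := 'rV[R]_d.
Context (phi : R -> R) (t delta : R).
Hypothesis reg : regularizer phi t delta.
Local Notation dpsi := (derive1 (conjugate phi)).
Context (ddpsi : R -> R).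
Hypothesis C11 : C11loc_with (conjugate phi) ddpsi.
Local Notation h := (ddpsi (t - delta)).
Hypothesis h0 : 0 < h.
Context (P Q : probability E R).
Local Notation A := (msupport P).
Local Notation B := (msupport Q).
Hypotheses (cA : compact A) (cB : compact B).
Context (c : E -> E -> R) (L eps r gam : R).
Hypothesis c_lip : lipschitz_cost L A B c.
Hypotheses (L0 : 0 < L) (eps0 : 0 < eps) (eps1 : eps <= 1).
Hypothesis rE : 2 * L / eps * r = delta / 4.
Hypothesis gam0 : 0 < gam.
Context (f g fh gh : E -> R) (s : n.-tuple E * n.-tuple E).
Hypothesis sAB : samples_in A B s.
Hypothesis pot : potentials A B c dpsi eps P Q f g.
Hypothesis poth : potentials A B c dpsi eps (empirical s.1) (empirical s.2) fh gh.
Local Notation x := (tnth s.1).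
Local Notation y := (tnth s.2).
Local Notation kappa := (5 * sup_norm_on A B c + eps * derive1 phi 1).
Local Notation mP := (min_ball_mass P A r).
Local Notation mQ := (min_ball_mass Q B r).
Let xih i j := (fh (x i) + gh (y j) - c (x i) (y j)) / eps.
Hypothesis gam_col : forall j, n%:R^-1 * \sum_i ddpsi (xih i j + delta / 4) <= gam.
Hypothesis gam_row : forall i, n%:R^-1 * \sum_j ddpsi (xih i j + delta / 4) <= gam.
Hypotheses (mP0 : 0 < mP) (mQ0 : 0 < mQ).
Context (C : R) (C0 : 0 < C).
Context (NP NQ NC : nat) (zP : 'I_NP -> E) (zQ : 'I_NQ -> E) (cell : E -> 'I_NC).
Hypotheses (zPA : forall k, A (zP k)) (zQB : forall k, B (zQ k)).
Hypothesis netP : forall x, A x -> exists k, enorm (x - zP k) < r.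
Hypothesis netQ : forall y, B y -> exists k, enorm (y - zQ k) < r.
Hypothesis cell0 : forall k, 0 < cell_mass P cell k.
Hypothesis cells_poincare : (forall k,
    2 / 3 * (n%:R * cell_mass P cell k) <= hits x [set x | cell x = k]
    <= 4 / 3 * (n%:R * cell_mass P cell k)) ->
  exists2 S : rel 'I_n, (forall i j, S i j -> enorm (x i - x j) <= r) &
  forall u : 'I_n -> R, \sum_i \sum_j (u i - u j) ^+ 2 <=
    C * \sum_i \sum_(j | S i j) (u i - u j) ^+ 2.

Let xA i : A (x i). Proof. exact: (sAB i).1. Qed.
Let yB j : B (y j). Proof. exact: (sAB j).2. Qed.
Let mA := measurable_msupport P.
Let mB := measurable_msupport Q.
Let nR : 0 < n%:R :> R. Proof. by rewrite ltr0n. Qed.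

Definition total_deviation : R :=
  \sum_k relative_deviation (fine (P (eball (zP k) r))) x (eball (zP k) r)
  + \sum_k relative_deviation (fine (Q (eball (zQ k) r))) y (eball (zQ k) r)
  + \sum_k relative_deviation (cell_mass P cell k) x [set z | cell z = k].

Let kappa_ge : 5 * sup_norm_on A B c <= kappa.
Proof. by rewrite lerDl mulr_ge0 ?(ltW eps0)// (derive1_phi1_ge0 reg). Qed.

Let x_mass : empirical s.1 A = 1%E. Proof. exact: empirical_carrier. Qed.
Let y_mass : empirical s.2 B = 1%E. Proof. exact: empirical_carrier. Qed.

(** Both sums of potentials are close to the same value [eps * t], which cancels. *)
Let uv_bnd i j : `|fh (x i) - f (x i) + (gh (y j) - g (y j))| <= 2 * kappa.
Proof.
have := potentials_bound reg mA mB cA cB L0 eps0 c_lip x_mass y_mass poth (@xA i) (@yB j).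
have := potentials_bound reg mA mB cA cB L0 eps0 c_lip (msupport1 P) (msupport1 Q) pot
  (@xA i) (@yB j).
have := kappa_ge; rewrite !ler_norml => ? /andP[? ?] /andP[? ?].
by apply/andP; split; lra.
Qed.

Let row1 i : \sum_j dpsi (xih i j) = n%:R.
Proof.
have := pot_eql poth (@xA i).
have mF := measurable_half_plan reg eps fh (pot_measr poth)
  (measurable_cost_l mA mB L0 c_lip) (@xA i).
rewrite (integral_empirical mB _ mF)//; last by move=> z _; exact: dconj_ge0 reg _.
by move=> /eqP; rewrite eqe => /eqP /(congr1 ( *%R n%:R)); rewrite mulrA divff ?gt_eqF// mul1r mulr1.
Qed.

Let col1 j : \sum_i dpsi (xih i j) = n%:R.
Proof.
have := pot_eqr poth (@yB j).
have mF : measurable_fun A (fun z => dpsi ((fh z + gh (y j) - c z (y j)) / eps)).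
  apply: (measurableT_comp (measurable_dconj reg)).
  apply: measurable_funM => //; apply: measurable_funB.
    apply: measurable_funD => //; exact: pot_measl poth.
  exact: (measurable_cost_r mA mB L0 c_lip (@yB j)).
rewrite (integral_empirical mA _ mF)//; last by move=> z _; exact: dconj_ge0 reg _.
by move=> /eqP; rewrite eqe => /eqP /(congr1 ( *%R n%:R)); rewrite mulrA divff ?gt_eqF// mul1r mulr1.
Qed.

Let M0 := Num.max (2 ^+ 6 * kappa ^+ 2 / delta ^+ 2) 1.
Let alpha := h ^+ 2 * mQ / (2 * gam * C).
Let beta := Num.min (4 * alpha * h * mP / (h * mP + 8 * gam)) (1 / 2 * h * mP).

Let q z := plan_density phi t P Q c eps f g z - 1.

(** One inequality valid on every sample, in place of a split into events: if the total deviation is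
    at least 1, the last term exceeds the trivial bound [(2 kappa)^2]; otherwise every single
    deviation is below 1 and the frequencies are typical. *)
Lemma sample_estimate :
  (n%:R ^+ 2)^-1 * \sum_i \sum_j (fh (x i) - f (x i) + (gh (y j) - g (y j))) ^+ 2 <=
  36 * M0 / beta ^+ 2 * (n%:R^-1 *
    (\sum_i (n%:R^-1 * \sum_j q (x i, y j)) ^+ 2
     + \sum_j (n%:R^-1 * \sum_i q (x i, y j)) ^+ 2))
  + 4 * kappa ^+ 2 * total_deviation.
Proof.
have kappa0 : 0 <= kappa.
  apply: le_trans kappa_ge; rewrite mulr_ge0//.
  by apply: le_trans (le_sup_norm cA cB L0 c_lip (@xA (Ordinal n0)) (@yB (Ordinal n0))).
have D0 (I : finType) (p : I -> R) sS (z : 'I_n -> E) : 0 <= \sum_(k : I) relative_deviation (p k) z (sS k).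
  by apply: sumr_ge0 => k _; exact: relative_deviation_ge0.
have M00 : 0 <= M0 by rewrite /M0 le_max ler01 orbT.
have [D1|D1] := leP 1 total_deviation.
  apply: (@le_trans _ _ (4 * kappa ^+ 2 * total_deviation)); last first.
    rewrite lerDr mulr_ge0//; first by apply: divr_ge0; [apply: mulr_ge0|exact: sqr_ge0].
    by rewrite mulr_ge0// addr_ge0// sumr_ge0// => i _; exact: sqr_ge0.
  rewrite ler_pdivrMl ?exprn_gt0//.
  apply: (@le_trans _ _ (\sum_(i < n) \sum_(j < n) (2 * kappa) ^+ 2)).
    apply: ler_sum => i _; apply: ler_sum => j _.
    by rewrite -(real_normK (num_real _)) lerXn2r ?nnegrE// mulr_ge0.
  rewrite !sumr_const !card_ord -mulrnA -[leLHS]mulr_natl natrM -expr2 ler_wpM2l ?sqr_ge0//.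
  have -> : (2 * kappa) ^+ 2 = 4 * kappa ^+ 2 by ring.
  by rewrite -[leLHS]mulr1 ler_wpM2l// mulr_ge0// sqr_ge0.
have small (I : finType) (p : I -> R) sS (z : 'I_n -> E) (k : I) :
    \sum_(k : I) relative_deviation (p k) z (sS k) < 1 -> 0 < p k ->
    2 / 3 * (n%:R * p k) <= hits z (sS k) <= 4 / 3 * (n%:R * p k).
  move=> S1 pk; apply: relative_deviation_lt1; first by rewrite mulr_gt0.
  apply: le_lt_trans S1; rewrite (bigD1 k)//= lerDl; apply: sumr_ge0 => l _.
  exact: relative_deviation_ge0.
move: D1; rewrite /total_deviation.
set DP := \sum_k relative_deviation _ _ _; set DQ := \sum_k relative_deviation _ _ _;
  set DC := \sum_k relative_deviation _ _ _ => D1.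
have DP0 : 0 <= DP by exact: D0.
have DQ0 : 0 <= DQ by exact: D0.
have DC0 : 0 <= DC by exact: D0.
have DP1 : DP < 1 by lra.
have DQ1 : DQ < 1 by lra.
have DC1 : DC < 1 by lra.
have massP k : 0 < fine (P (eball (zP k) r)).
  rewrite -lte_fin probability_fineK; last exact: measurable_eball.
  by apply: (lt_le_trans _ (le_min_ball_mass r (@zPA k))); rewrite lte_fin.
have massQ k : 0 < fine (Q (eball (zQ k) r)).
  rewrite -lte_fin probability_fineK; last exact: measurable_eball.
  by apply: (lt_le_trans _ (le_min_ball_mass r (@zQB k))); rewrite lte_fin.
have ballP := net_hits (@zPA) netP (@xA) (fun k => (andP (small _ _ _ _ k DP1 (massP k))).1).
have ballQ := net_hits (@zQB) netQ (@yB) (fun k => (andP (small _ _ _ _ k DQ1 (massQ k))).1).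
have [S S_near S_poincare] := cells_poincare (fun k => small _ _ _ _ k DC1 (cell0 k)).
apply: ler_wpDr; first by rewrite mulr_ge0 ?addr_ge0// mulr_ge0// sqr_ge0.
have qE i j : q (x i, y j) = dpsi ((f (x i) + g (y j) - c (x i) (y j)) / eps) - 1.
  by rewrite /q /plan_density plan_exponent_in.
under [X in _ <= _ * (_ * (X + _))]eq_bigr do under eq_bigr do rewrite qE.
under [X in _ <= _ * (_ * (_ + X))]eq_bigr do under eq_bigr do rewrite qE.
apply: (good_sample_bound n0 reg C11 h0 (x := x) (y := y) (xih := xih) L0 eps0 eps1 rE gam0
  mP0 mQ0 C0 kappa0 _ uv_bnd _ row1 col1 gam_col gam_row ballP ballQ S_near S_poincare).
  by move=> i j; rewrite /xih -mulrBl; congr (_ / _); ring.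
move=> i i' j j'.
exact: (potentials_slack reg mA mB L0 eps0 c_lip x_mass y_mass poth).
Qed.

End sample_estimate.

(** * Expectations *)

Section expectation.
Context {R : realType} {d : nat}.
Local Notation E := 'rV[R]_d.
Context {d' : measure_display} {W : measurableType d'} {Pr : probability W R}.

Lemma ge0_expect_sum (I : finType) (F : I -> W -> R) :
  (forall i, measurable_fun setT (F i)) -> (forall i w, 0 <= F i w) ->
  (\int[Pr]_w (\sum_i F i w)%:E = \sum_i \int[Pr]_w (F i w)%:E)%E.
Proof.
move=> mF F0; rewrite -ge0_integral_sum//.
- by apply: eq_integral => w _; rewrite sumEFin.
- by move=> i; apply/measurable_EFinP.
- by move=> i w _; rewrite lee_fin.
Qed.

Lemma ge0_expect_scale (k : R) (F : W -> R) : 0 <= k ->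
  measurable_fun setT F -> (forall w, 0 <= F w) ->
  (\int[Pr]_w (k * F w)%:E = k%:E * \int[Pr]_w (F w)%:E)%E.
Proof.
move=> k0 mF F0; rewrite -ge0_integralZl_EFin//; first by move=> w _; rewrite lee_fin.
exact/measurable_EFinP.
Qed.

Lemma ge0_expect_add (F G : W -> R) :
  measurable_fun setT F -> measurable_fun setT G ->
  (forall w, 0 <= F w) -> (forall w, 0 <= G w) ->
  (\int[Pr]_w (F w + G w)%:E = \int[Pr]_w (F w)%:E + \int[Pr]_w (G w)%:E)%E.
Proof.
move=> mF mG F0 G0; rewrite -ge0_integralD//.
- by move=> w _; rewrite lee_fin.
- exact/measurable_EFinP.
- by move=> w _; rewrite lee_fin.
- exact/measurable_EFinP.
Qed.

Context {P Q : probability E R} {X Y : nat -> {mfun W >-> E}}.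
Hypothesis XY : independent_samples Pr P Q X Y.

Lemma measurable_hits n (S : set E) : measurable S ->
  measurable_fun setT (fun w => hits (fun i : 'I_n => Y i w) S : R).
Proof.
move=> mS; apply: measurable_sum => i.
apply: (measurableT_comp (f := \1_S : E -> R)) => //; exact: measurable_indic.
Qed.

Lemma measurable_relative_deviation n (p : R) (S : set E) : measurable S ->
  measurable_fun setT (fun w => relative_deviation p (fun i : 'I_n => Y i w) S).
Proof.
move=> mS; apply: measurable_funM => //; apply: measurable_funM => //.
by apply: measurable_funX; apply: measurable_funB => //; exact: measurable_hits.
Qed.

Lemma expected_relative_deviation n (S : set E) : (0 < n)%N -> measurable S ->
  0 < fine (Q S) ->
  (\int[Pr]_w (relative_deviation (fine (Q S)) (fun i : 'I_n => Y i w) S)%:E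
   <= (9 / (n%:R * fine (Q S)))%:E)%E.
Proof.
move=> n0 mS p0; set p := fine (Q S) in p0 *.
have nR : 0 < n%:R :> R by rewrite ltr0n.
have np : 0 < n%:R * p by rewrite mulr_gt0.
have c0 : 0 <= 9 / (n%:R * p) ^+ 2 by apply: divr_ge0 => //; exact: sqr_ge0.
rewrite (eq_integral (fun w => (9 / (n%:R * p) ^+ 2 *
    (\sum_(j < n) (\1_S (Y j w) - p)) ^+ 2)%:E)); last first.
  move=> w _; congr EFin; rewrite /relative_deviation /hits sumrB sumr_const card_ord.
  by rewrite -[p *+ n]mulr_natl mulrAC.
rewrite ge0_expect_scale//; last by move=> w; exact: sqr_ge0.
  apply: (@le_trans _ _ ((9 / (n%:R * p) ^+ 2)%:E * (n%:R%:E * Q S))%E).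
    by apply: lee_wpmul2l; [rewrite lee_fin|exact: deviation_second_moment XY n _ mS].
  rewrite -probability_fineK// -/p -!EFinM lee_fin le_eqVlt; apply/orP; left; apply/eqP.
  by field; rewrite !gt_eqF.
apply: measurable_funX; apply: measurable_sum => j; apply: measurable_funB => //.
apply: (measurableT_comp (f := \1_S : E -> R)) => //; exact: measurable_indic.
Qed.

Context (q : E * E -> R) (M v : R).
Hypothesis mq : measurable_fun setT q.
Hypothesis qM : forall z, `|q z| <= M.
Hypothesis ql : forall x, (\int[Q]_y (q (x, y))%:E = 0)%E.
Hypothesis qr : forall y, (\int[P]_x (q (x, y))%:E = 0)%E.
Hypothesis qv : (\int[P \x Q]_z (q z ^+ 2)%:E = v%:E)%E.

Let mqXY i j : measurable_fun setT (fun w => q (X i w, Y j w)).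
Proof.
have mf : measurable_fun setT (fun w => (X i w, Y j w)) by exact: measurable_fun_pair.
exact: (measurableT_comp mq mf).
Qed.

Let swap_v : (\int[Q \x P]_z (q (z.2, z.1) ^+ 2)%:E = v%:E)%E.
Proof.
have mq2 : measurable_fun setT (fun z => (q z ^+ 2)%:E).
  by apply/measurable_EFinP; exact: measurable_funX.
have mq2' : measurable_fun setT (fun z : E * E => (q (z.2, z.1) ^+ 2)%:E).
  apply: (measurableT_comp mq2); exact: measurable_fun_pair.
rewrite -qv (fubini_tonelli1 (m1 := Q) (m2 := P))//; last first.
  by move=> z; rewrite lee_fin sqr_ge0.
rewrite (fubini_tonelli2 (m1 := P) (m2 := Q))//.
by move=> z; rewrite lee_fin sqr_ge0.
Qed.

Let row n i : (\int[Pr]_w ((n.+1%:R^-1 * \sum_(j < n.+1) q (X i w, Y j w)) ^+ 2)%:E =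
  (v / n.+1%:R)%:E)%E.
Proof.
under eq_integral do rewrite exprMn.
rewrite ge0_expect_scale ?sqr_ge0//; last by move=> w; exact: sqr_ge0.
  rewrite (second_moment XY mq qM ql) qv -!EFinM; congr EFin.
  by field.
by apply: measurable_funX; apply: measurable_sum => j.
Qed.

Let col n j : (\int[Pr]_w ((n.+1%:R^-1 * \sum_(i < n.+1) q (X i w, Y j w)) ^+ 2)%:E =
  (v / n.+1%:R)%:E)%E.
Proof.
under eq_integral do rewrite exprMn.
rewrite ge0_expect_scale ?sqr_ge0//; last by move=> w; exact: sqr_ge0.
  have mq' : measurable_fun setT (fun z : E * E => q (z.2, z.1)).
    by apply: (measurableT_comp mq); exact: measurable_fun_pair.
  rewrite (second_moment (independent_samplesC XY) mq' (fun z => qM (z.2, z.1)) qr).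
  rewrite swap_v -!EFinM; congr EFin.
  by field.
by apply: measurable_funX; apply: measurable_sum => i.
Qed.

(** Each of the [n] rows and [n] columns contributes [v / n], and the sum is divided by [n]. *)
Lemma expected_marginal_defect n : (0 < n)%N ->
  (\int[Pr]_w (n%:R^-1 *
    (\sum_(i < n) (n%:R^-1 * \sum_(j < n) q (X i w, Y j w)) ^+ 2
     + \sum_(j < n) (n%:R^-1 * \sum_(i < n) q (X i w, Y j w)) ^+ 2))%:E
   = (2 * v / n%:R)%:E)%E.
Proof.
case: n => // n _.
have msq (F : W -> R) : measurable_fun setT F -> measurable_fun setT (fun w => F w ^+ 2).
  by move=> mF; exact: measurable_funX.
have mrow i : measurable_fun setT (fun w => (n.+1%:R^-1 * \sum_(j < n.+1) q (X i w, Y j w)) ^+ 2).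
  by apply: msq; apply: measurable_funM => //; apply: measurable_sum.
have mcol j : measurable_fun setT (fun w => (n.+1%:R^-1 * \sum_(i < n.+1) q (X i w, Y j w)) ^+ 2).
  by apply: msq; apply: measurable_funM => //; apply: measurable_sum.
have s0 (F : 'I_n.+1 -> R) : 0 <= \sum_i F i ^+ 2.
  by apply: sumr_ge0 => i _; exact: sqr_ge0.
rewrite ge0_expect_scale//; last first.
- by move=> w; rewrite addr_ge0.
- by apply: measurable_funD; apply: measurable_sum => i; [exact: mrow|exact: mcol].
rewrite ge0_expect_add//.
- rewrite !ge0_expect_sum//; try by move=> *; exact: sqr_ge0.
  under eq_bigr do rewrite row; under [X in (_ + X)%E]eq_bigr do rewrite col.
  rewrite !sumEFin -EFinD -EFinM; congr EFin.
  by rewrite !sumr_const card_ord -!(mulr_natl (v / n.+1%:R)); field.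
- exact: measurable_sum.
- exact: measurable_sum.
Qed.

End expectation.

Section expected_error.
Context {R : realType} {d n : nat} (d0 : (0 < d)%N) (n0 : (0 < n)%N).
Local Notation E := 'rV[R]_d.
Context (phi : R -> R) (t delta : R).
Hypothesis reg : regularizer phi t delta.
Local Notation dpsi := (derive1 (conjugate phi)).
Context (ddpsi : R -> R).
Hypothesis C11 : C11loc_with (conjugate phi) ddpsi.
Local Notation h := (ddpsi (t - delta)).
Hypothesis h0 : 0 < h.
Context (P Q : probability E R).
Local Notation A := (msupport P).
Local Notation B := (msupport Q).
Hypotheses (cA : compact A) (cB : compact B).
Context (c : E -> E -> R) (L eps r gam : R).
Hypothesis c_lip : lipschitz_cost L A B c.
Hypotheses (L0 : 0 < L) (eps0 : 0 < eps) (eps1 : eps <= 1) (r0 : 0 < r).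
Hypothesis rE : 2 * L / eps * r = delta / 4.
Hypothesis gam0 : 0 < gam.
Context (f g : E -> R) (pi : probability (E * E)%type R).
Hypothesis pi_opt : rot_optimizer A B c phi eps P Q pi.
Hypothesis pot : potentials A B c dpsi eps P Q f g.
Context {d' : measure_display} {W : measurableType d'} {Pr : probability W R}.
Context {X Y : nat -> {mfun W >-> E}}.
Hypothesis XY : independent_samples Pr P Q X Y.
Local Notation sample w := ([tuple X k w | k < n], [tuple Y k w | k < n]).
Context (fh gh : n.-tuple E * n.-tuple E -> E -> R).
Hypothesis poth : forall s, samples_in A B s ->
  potentials A B c dpsi eps (empirical s.1) (empirical s.2) (fh s) (gh s).
Let plan w (i j : 'I_n) := ddpsi
  ((fh (sample w) (X i w) + gh (sample w) (Y j w) - c (X i w) (Y j w)) / eps + delta / 4).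
Hypothesis gam_col :
  {ae Pr, forall w, forall j, n%:R^-1 * \sum_i plan w i j <= gam}.
Hypothesis gam_row :
  {ae Pr, forall w, forall i, n%:R^-1 * \sum_j plan w i j <= gam}.
Local Notation kappa := (5 * sup_norm_on A B c + eps * derive1 phi 1).
Local Notation mP := (min_ball_mass P A r).
Local Notation mQ := (min_ball_mass Q B r).
Context (C : R) (C0 : 0 < C).
Context (NP NQ NC : nat) (zP : 'I_NP -> E) (zQ : 'I_NQ -> E) (cell : E -> 'I_NC).
Hypotheses (zPA : forall k, A (zP k)) (zQB : forall k, B (zQ k)).
Hypothesis netP : forall x, A x -> exists k, enorm (x - zP k) < r.
Hypothesis netQ : forall y, B y -> exists k, enorm (y - zQ k) < r.
Hypothesis mcell : forall k, measurable [set x | cell x = k].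
Hypothesis cell0 : forall k, 0 < cell_mass P cell k.
Hypothesis cells_poincare : forall x : 'I_n -> E, (forall i, A (x i)) ->
  (forall k, 2 / 3 * (n%:R * cell_mass P cell k) <= hits x [set x | cell x = k]
    <= 4 / 3 * (n%:R * cell_mass P cell k)) ->
  exists2 S : rel 'I_n, (forall i j, S i j -> enorm (x i - x j) <= r) &
  forall u : 'I_n -> R, \sum_i \sum_j (u i - u j) ^+ 2 <=
    C * \sum_i \sum_(j | S i j) (u i - u j) ^+ 2.

Let mA := measurable_msupport P.
Let mB := measurable_msupport Q.

Let ae_samples : {ae Pr, forall w, samples_in A B (sample w)}.
Proof.
case: XY => PX QY _.
have HX i : {ae Pr, forall w, A (X i w)}.
  exists (X i @^-1` (~` A)); split => //.
    by apply: measurable_preimage => //; exact: measurableC.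
  by rewrite PX; [exact: msupport_setC0|exact: measurableC].
have HY i : {ae Pr, forall w, B (Y i w)}.
  exists (Y i @^-1` (~` B)); split => //.
    by apply: measurable_preimage => //; exact: measurableC.
  by rewrite QY; [exact: msupport_setC0|exact: measurableC].
have := filter_forall (ae_filter_ringOfSetsType Pr) (fun i : 'I_n => HX i).
have := filter_forall (ae_filter_ringOfSetsType Pr) (fun i : 'I_n => HY i).
by apply: filterS2 => w Bw Aw i /=; rewrite !tnth_mktuple.
Qed.

Let M0 := Num.max (2 ^+ 6 * kappa ^+ 2 / delta ^+ 2) 1.
Let alpha := h ^+ 2 * mQ / (2 * gam * C).
Let beta := Num.min (4 * alpha * h * mP / (h * mP + 8 * gam)) (1 / 2 * h * mP).

Let mP0 : 0 < mP. Proof. exact: min_ball_mass_gt0. Qed.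
Let mQ0 : 0 < mQ. Proof. exact: min_ball_mass_gt0. Qed.

Let q z := plan_density phi t P Q c eps f g z - 1.

Let mpd : measurable_fun setT (plan_density phi t P Q c eps f g).
Proof. by have := measurable_plan_density reg L0 c_lip pot. Qed.

Let mq : measurable_fun setT q.
Proof. exact: measurable_funB. Qed.

Let q_bounded : exists M, forall z, `|q z| <= M.
Proof.
have [M _ HM] := plan_density_bounded reg cA cB L0 eps0 c_lip pot.
exists (M + 1) => z; rewrite /q ler_norml.
have := plan_density_ge0 reg P Q c eps f g z; have := HM z.
by move=> h1 h2; apply/andP; split; lra.
Qed.

Let pd_norm : exists M, forall z, `|plan_density phi t P Q c eps f g z| <= M.
Proof.
have [M _ HM] := plan_density_bounded reg cA cB L0 eps0 c_lip pot.
by exists M => z; rewrite ger0_norm// (plan_density_ge0 reg).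
Qed.

Let ql x : (\int[Q]_y (q (x, y))%:E = 0)%E.
Proof.
have [M HM] := pd_norm.
have i1 : Q.-integrable setT (EFin \o (fun y => plan_density phi t P Q c eps f g (x, y))).
  apply: (@probability_integrable _ _ _ Q _ M) => //.
  exact: measurable_fun_pair2.
have i2 : Q.-integrable setT (EFin \o (fun _ : E => 1 : R)).
  by apply: (@probability_integrable _ _ _ Q _ 1) => // y; rewrite normr1.
rewrite /q (integralB_EFin measurableT i1 i2) (plan_density_l reg pot).
by rewrite integral_cst// [X in (_ - _ * X)%E](probability_setT Q) mule1 subee.
Qed.

Let qr y : (\int[P]_x (q (x, y))%:E = 0)%E.
Proof.
have [M HM] := pd_norm.
have i1 : P.-integrable setT (EFin \o (fun x => plan_density phi t P Q c eps f g (x, y))).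
  apply: (@probability_integrable _ _ _ P _ M) => //.
  exact: measurable_fun_pair1.
have i2 : P.-integrable setT (EFin \o (fun _ : E => 1 : R)).
  by apply: (@probability_integrable _ _ _ P _ 1) => // x; rewrite normr1.
rewrite /q (integralB_EFin measurableT i1 i2) (plan_density_r reg pot).
by rewrite integral_cst// [X in (_ - _ * X)%E](probability_setT P) mule1 subee.
Qed.

Let v := fine (\int[product_law P Q]_z (q z ^+ 2)%:E)%E.

Let vE : (\int[product_law P Q]_z (q z ^+ 2)%:E)%E = v%:E.
Proof.
have [M HM] := q_bounded.
rewrite /v fineK//; apply: integrable_fin_num => //.
apply: (@probability_integrable _ _ _ (product_law P Q) _ (M ^+ 2)).
  exact: measurable_funX.
by move=> z; rewrite normrX lerXn2r ?nnegrE// (le_trans _ (HM z)).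
Qed.

Let inverse_masses : R :=
  \sum_k (fine (P (eball (zP k) r)))^-1 + \sum_k (fine (Q (eball (zQ k) r)))^-1
  + \sum_k (cell_mass P cell k)^-1.

Let dev w := total_deviation P Q r (sample w) zP zQ cell.

Let defect w := n%:R^-1 *
    (\sum_(i < n) (n%:R^-1 * \sum_(j < n) q (X i w, Y j w)) ^+ 2
     + \sum_(j < n) (n%:R^-1 * \sum_(i < n) q (X i w, Y j w)) ^+ 2).

Let bound w : R := 36 * M0 / beta ^+ 2 * defect w + 4 * kappa ^+ 2 * dev w.

Let tupleX w : tnth (sample w).1 = (fun i : 'I_n => X i w).
Proof. by apply/funext => i; rewrite tnth_mktuple. Qed.

Let tupleY w : tnth (sample w).2 = (fun i : 'I_n => Y i w).
Proof. by apply/funext => i; rewrite tnth_mktuple. Qed.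

Let loss w := (\int[empirical (sample w).1 \x empirical (sample w).2]_(z in A `*` B)
  (((fh (sample w) z.1 - f z.1) + (gh (sample w) z.2 - g z.2)) ^+ 2)%:E)%E.

(** A pointwise bound off a measurable null set is what [ge0_le_integral_off_null] takes, so that
    measurability of the loss in [w] is never at stake. *)
Let loss_le : exists N, [/\ measurable N, Pr N = 0%E &
  forall w, ~ N w -> (loss w <= (bound w)%:E)%E].
Proof.
have [N [mN N0 NG]] : Pr.-negligible (~` [set w | [/\ samples_in A B (sample w),
    forall j, n%:R^-1 * \sum_i plan w i j <= gam &
    forall i, n%:R^-1 * \sum_j plan w i j <= gam]]).
  by move: ae_samples gam_col gam_row; apply: filterS3 => w ? ? ?; split.
exists N; split => // w Nw.
have [sAB colw roww] : [/\ samples_in A B (sample w),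
    forall j, n%:R^-1 * \sum_i plan w i j <= gam &
    forall i, n%:R^-1 * \sum_j plan w i j <= gam].
  by apply: contrapT => nG; apply: Nw; exact: NG.
have ph := poth sAB.
rewrite /loss (integral_empirical_prod (s := sample w)
  (F := fun z => ((fh (sample w) z.1 - f z.1) + (gh (sample w) z.2 - g z.2)) ^+ 2) mA mB).
- rewrite lee_fin.
  have := sample_estimate n0 reg C11 h0 cA cB c_lip L0 eps0 eps1 rE gam0 sAB pot ph
    _ _ mP0 mQ0 C0 zPA zQB netP netQ cell0 _.
  rewrite -/(dev w) !tupleX !tupleY; apply.
  + exact: colw.
  + exact: roww.
  + by apply: cells_poincare => i; have := (sAB i).1; rewrite tupleX.
- by move=> z _; exact: sqr_ge0.
- apply: measurable_funX; apply: measurable_funD.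
    have mf : measurable_fun A (fun x => fh (sample w) x - f x).
      by apply: measurable_funB; [exact: pot_measl ph|exact: pot_measl pot].
    apply: (measurable_comp mA _ mf (measurable_funTS measurable_fst)).
    by move=> _ [z [Az _] <-].
  have mg : measurable_fun B (fun y => gh (sample w) y - g y).
    by apply: measurable_funB; [exact: pot_measr ph|exact: pot_measr pot].
  apply: (measurable_comp mB _ mg (measurable_funTS measurable_snd)).
  by move=> _ [z [_ Bz] <-].
- by move=> i; exact: (sAB i).1.
- by move=> j; exact: (sAB j).2.
Qed.

Let massP k : 0 < fine (P (eball (zP k) r)).
Proof.
rewrite -lte_fin probability_fineK; last exact: measurable_eball.
by apply: (lt_le_trans _ (le_min_ball_mass r (@zPA k))); rewrite lte_fin.
Qed.

Let massQ k : 0 < fine (Q (eball (zQ k) r)).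
Proof.
rewrite -lte_fin probability_fineK; last exact: measurable_eball.
by apply: (lt_le_trans _ (le_min_ball_mass r (@zQB k))); rewrite lte_fin.
Qed.


Let devE w : dev w =
  \sum_k relative_deviation (fine (P (eball (zP k) r))) (fun i : 'I_n => X i w) (eball (zP k) r)
  + \sum_k relative_deviation (fine (Q (eball (zQ k) r))) (fun i : 'I_n => Y i w) (eball (zQ k) r)
  + \sum_k relative_deviation (cell_mass P cell k) (fun i : 'I_n => X i w) [set z | cell z = k].
Proof. by rewrite /dev /total_deviation tupleX tupleY. Qed.

Let mdevX N (p : 'I_N -> R) (S : 'I_N -> set E) : (forall k, measurable (S k)) ->
  measurable_fun setT
    (fun w => \sum_k relative_deviation (p k) (fun i : 'I_n => X i w) (S k)).
Proof. by move=> mS; apply: measurable_sum => k; exact: measurable_relative_deviation. Qed.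

Let mdevY N (p : 'I_N -> R) (S : 'I_N -> set E) : (forall k, measurable (S k)) ->
  measurable_fun setT
    (fun w => \sum_k relative_deviation (p k) (fun i : 'I_n => Y i w) (S k)).
Proof. by move=> mS; apply: measurable_sum => k; exact: measurable_relative_deviation. Qed.

Let dev_sum_ge0 N (p : 'I_N -> R) (S : 'I_N -> set E) (x : 'I_n -> E) :
  0 <= \sum_k relative_deviation (p k) x (S k).
Proof. by apply: sumr_ge0 => k _; exact: relative_deviation_ge0. Qed.

Let expected_family (mu nu : probability E R) (Z Z' : nat -> {mfun W >-> E})
    (ind : independent_samples Pr nu mu Z' Z) N (S : 'I_N -> set E) :
  (forall k, measurable (S k)) -> (forall k, 0 < fine (mu (S k))) ->
  (\int[Pr]_w (\sum_k relative_deviation (fine (mu (S k))) (fun i : 'I_n => Z i w) (S k))%:E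
   <= (9 / n%:R * \sum_k (fine (mu (S k)))^-1)%:E)%E.
Proof.
move=> mS S0; rewrite ge0_expect_sum.
- rewrite mulr_sumr -sumEFin; apply: lee_sum => k _.
  apply: le_trans (expected_relative_deviation ind n0 (mS k) (S0 k)) _.
  by rewrite lee_fin invfM mulrA.
- by move=> k; exact: measurable_relative_deviation.
- by move=> k w; exact: relative_deviation_ge0.
Qed.

Let expected_dev : (\int[Pr]_w (dev w)%:E <= (9 / n%:R * inverse_masses)%:E)%E.
Proof.
under eq_integral do rewrite devE.
have meb (z : E) : measurable (eball z r) by exact: measurable_eball.
rewrite ge0_expect_add//.
- rewrite ge0_expect_add//.
  + rewrite /inverse_masses 2!mulrDr 2!EFinD; apply: leeD; first apply: leeD.
    * exact: (expected_family (independent_samplesC XY)).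
    * exact: (expected_family XY).
    * exact: (expected_family (independent_samplesC XY) (S := fun k => [set z | cell z = k])).
  + exact: mdevX.
  + exact: mdevY.
- by apply: measurable_funD; [exact: mdevX|exact: mdevY].
- exact: mdevX.
- by move=> w; rewrite addr_ge0.
Qed.

Let mdev : measurable_fun setT dev.
Proof.
have meb (z : E) : measurable (eball z r) by exact: measurable_eball.
rewrite (funext devE).
by apply: measurable_funD; [apply: measurable_funD|]; [exact: mdevX|exact: mdevY|exact: mdevX].
Qed.

Let mdefect : measurable_fun setT defect.
Proof.
have mqXY i j : measurable_fun setT (fun w => q (X i w, Y j w)).
  have mf : measurable_fun setT (fun w => (X i w, Y j w)) by exact: measurable_fun_pair.
  exact: (measurableT_comp mq mf).
apply: measurable_funM => //; apply: measurable_funD; apply: measurable_sum => i;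
  by apply: measurable_funX; apply: measurable_funM => //; apply: measurable_sum => j.
Qed.

(** 72 is 36 times the two families of marginal defects; 36 is the 4 of the trivial bound times the
    9 of [relative_deviation]. *)
Lemma expected_error : (\int[Pr]_w loss w <=
  (72 * M0 / beta ^+ 2)%:E * ('V_(product_law P Q)[coupling_density P Q pi] * n%:R^-1%:E)
  + (36 * kappa ^+ 2 / n%:R * inverse_masses)%:E)%E.
Proof.
rewrite (optimizer_variance reg cA cB L0 eps0 c_lip pot pi_opt) vE -!EFinM -EFinD.
have [N [mN N0 HN]] := loss_le.
have defect0 w : 0 <= defect w.
  by rewrite mulr_ge0// addr_ge0// sumr_ge0// => i _; exact: sqr_ge0.
have dev0 w : 0 <= dev w by rewrite devE !addr_ge0.
have c1 : 0 <= 36 * M0 / beta ^+ 2.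
  apply: divr_ge0; last exact: sqr_ge0.
  by rewrite mulr_ge0// /M0 le_max ler01 orbT.
have c2 : 0 <= 4 * kappa ^+ 2 by rewrite mulr_ge0// sqr_ge0.
apply: (@le_trans _ _ (\int[Pr]_w (bound w)%:E)%E).
  apply: (ge0_le_integral_off_null mN N0) => //.
    by move=> w; apply: integral_ge0 => z _; rewrite lee_fin sqr_ge0.
  by move=> w; rewrite lee_fin /bound addr_ge0// mulr_ge0.
rewrite /bound ge0_expect_add.
- rewrite (ge0_expect_scale (F := defect))// (ge0_expect_scale (F := dev))//.
  have [M HM] := q_bounded.
  have dE : (\int[Pr]_w (defect w)%:E = (2 * v / n%:R)%:E)%E.
    exact: (expected_marginal_defect XY mq HM ql qr vE n0).
  rewrite dE EFinD; apply: leeD.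
    rewrite -EFinM lee_fin le_eqVlt; apply/orP; left; apply/eqP; ring.
  apply: le_trans (lee_wpmul2l _ expected_dev) _; first by rewrite lee_fin.
  rewrite -EFinM lee_fin le_eqVlt; apply/orP; left; apply/eqP; ring.
- exact: measurable_funM.
- exact: measurable_funM.
- by move=> w; rewrite mulr_ge0.
- by move=> w; rewrite mulr_ge0.
Qed.

End expected_error.

(** * Nondegeneracy of the support, and the final choice of constants *)

Section diameter.
Context {R : realType} {d : nat} (d0 : (0 < d)%N) (P : probability 'rV[R]_d R).
Local Notation A := (msupport P).
Context (dens : 'rV[R]_d -> R) (lam Lam : R).
Hypothesis cA : compact A.
Hypothesis densP : has_lebesgue_density P dens.
Hypothesis lam0 : 0 < lam.
Hypothesis dens_bnd : forall x, A x -> lam <= dens x <= Lam.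

(** Otherwise the support, of mass 1, would lie in a ball too small for a density bounded by [Lam].
    This makes the number of steps [K] positive. *)
Lemma ediam_msupport_gt0 : 0 < ediam A.
Proof.
rewrite ltNge; apply/negP => diam0; have [x Ax] := msupport_neq0 P.
have Lam0 := Lam_gt0 lam0 dens_bnd.
pose r := (4 * (Lam + 1))^-1.
have r0 : 0 < r by rewrite invr_gt0 mulr_gt0// addr_gt0.
have rL : 4 * (r * (Lam + 1)) = 1.
  by rewrite /r; field; rewrite gt_eqF// addr_gt0.
have Ar : A `<=` eball x r.
  move=> y Ay; rewrite /eball/=; apply: le_lt_trans r0.
  exact: le_trans (enorm_le_ediam cA Ay Ax) diam0.
have : (P A <= P (eball x r))%E.
  apply: le_measure; rewrite ?inE//; [exact: measurable_msupport|exact: measurable_eball].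
rewrite msupport1 => /le_trans /(_ (ball_mass_le densP lam0 dens_bnd x (ltW r0))).
rewrite lee_fin leNgt => /negP; apply.
have r2 : 2 * r <= 1 by have := mulr_gt0 r0 Lam0; lra.
apply: (@le_lt_trans _ _ (Lam * (2 * r))).
  by rewrite ler_wpM2l ?(ltW Lam0)// ler_iXnr// mulr_ge0// ltW.
by have := mulr_gt0 r0 Lam0; lra.
Qed.

End diameter.

Theorem theorem4p5 (R : realType) (d : nat) (d_gt0 : (0 < d)%N)
  (P Q : probability 'rV[R]_d R)
  (compactP : compact (msupport P)) (compactQ : compact (msupport Q))
  (c : 'rV[R]_d -> 'rV[R]_d -> R) (L : R) (L_gt0 : 0 < L)
  (c_lip : lipschitz_cost L (msupport P) (msupport Q) c)
  (phi : R -> R) (t_psi delta_psi : R)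
  (phi_reg : regularizer phi t_psi delta_psi)
  (ddpsi : R -> R) (psi_C11 : C11loc_with (conjugate phi) ddpsi)
  (ddpsi_gt0 : 0 < ddpsi (t_psi - delta_psi))
  (convexP : convex_set (msupport P))
  (dens : 'rV[R]_d -> R) (lamP LamP : R)
  (P_dens : has_lebesgue_density P dens) (lamP_gt0 : 0 < lamP)
  (dens_bnd : forall x, msupport P x -> lamP <= dens x <= LamP)
  (pi : R -> probability ('rV[R]_d * 'rV[R]_d)%type R)
  (pi_opt : forall eps, 0 < eps ->
    rot_optimizer (msupport P) (msupport Q) c phi eps P Q (pi eps))
  (f g : R -> 'rV[R]_d -> R)
  (fg_pot : forall eps, 0 < eps ->
    potentials (msupport P) (msupport Q) c (derive1 (conjugate phi)) eps
      P Q (f eps) (g eps))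
  (d' : measure_display) (W : measurableType d') (Pr : probability W R)
  (X Y : nat -> {mfun W >-> 'rV[R]_d})
  (XY_indep : independent_samples Pr P Q X Y)
  (fhat ghat : forall n : nat, R ->
    n.-tuple 'rV[R]_d * n.-tuple 'rV[R]_d -> 'rV[R]_d -> R)
  (fghat_pot : forall n eps (s : n.-tuple 'rV[R]_d * n.-tuple 'rV[R]_d),
    (0 < n)%N -> 0 < eps -> samples_in (msupport P) (msupport Q) s ->
    potentials (msupport P) (msupport Q) c (derive1 (conjugate phi)) eps
      (empirical s.1) (empirical s.2) (fhat n eps s) (ghat n eps s))
  (fhat_meas : forall n eps x, (0 < n)%N -> 0 < eps -> msupport P x ->
    measurable_fun (samples_in (n := n) (msupport P) (msupport Q))
      (fun s => fhat n eps s x))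
  (ghat_meas : forall n eps y, (0 < n)%N -> 0 < eps -> msupport Q y ->
    measurable_fun (samples_in (n := n) (msupport P) (msupport Q))
      (fun s => ghat n eps s y))
  (gamma : nat -> R -> R)
  (gamma_gt0 : forall n eps, (0 < n)%N -> 0 < eps -> 0 < gamma n eps)
  (gamma_bnd : forall n eps, (0 < n)%N -> 0 < eps ->
    let plan w (i j : 'I_n) :=
      let s := ([tuple X k w | k < n], [tuple Y k w | k < n]) in
      ddpsi ((fhat n eps s (X i w) + ghat n eps s (Y j w) - c (X i w) (Y j w))
               / eps + delta_psi / 4) in
    {ae Pr, forall w, forall j, n%:R^-1 * \sum_i plan w i j <= gamma n eps} /\
    {ae Pr, forall w, forall i, n%:R^-1 * \sum_j plan w i j <= gamma n eps})
  (u : R) (u_gt : Num.max d%:R 2 < u) :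
  exists (C : R) (n0 : nat), forall n eps, (n0 <= n)%N -> 0 < eps <= 1 ->
    let kappa := 5 * sup_norm_on (msupport P) (msupport Q) c
                 + eps * derive1 phi 1 in
    let r := delta_psi * eps / (8 * L) in
    let mP := min_ball_mass P (msupport P) r in
    let mQ := min_ball_mass Q (msupport Q) r in
    let h := ddpsi (t_psi - delta_psi) in
    let alpha :=
      lamP ^+ 2 * h ^+ 2 * mQ /
      (8 * LamP ^+ 2 * gamma n eps *
       (Num.ceil (16 * L * ediam (msupport P) / (delta_psi * eps)))%:~R
         ^+ (d + 2)) in
    let beta :=
      Num.min (4 * alpha * h * mP / (h * mP + 8 * gamma n eps))
              (1 / 2 * h * mP) in
    (\int[Pr]_w
       (let s := ([tuple X k w | k < n], [tuple Y k w | k < n]) in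
        \int[empirical s.1 \x empirical s.2]_(z in msupport P `*` msupport Q)
          (((fhat n eps s z.1 - f eps z.1)
            + (ghat n eps s z.2 - g eps z.2)) ^+ 2)%:E)
     <= (2 ^+ 8 * Num.max (2 ^+ 6 * kappa ^+ 2 / delta_psi ^+ 2) 1
           / beta ^+ 2)%:E
          * ('V_(product_law P Q)[coupling_density P Q (pi eps)] * n%:R^-1%:E)
        + (8 * kappa ^+ 2 / n%:R
           * (1 / (eps `^ u) + C / mP ^+ 2 + C / mQ ^+ 2))%:E)%E.

Proof.
have Lam0 := Lam_gt0 lamP_gt0 dens_bnd.
have delta0 := reg_delta_gt0 phi_reg.
have diam0 := ediam_msupport_gt0 d_gt0 compactP P_dens lamP_gt0 dens_bnd.
have r10 : 0 < delta_psi / (8 * L) by rewrite divr_gt0// mulr_gt0.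
have [CP CP0 HP] := exists_net d_gt0 compactP r10.
have [CQ CQ0 HQ] := exists_net d_gt0 compactQ r10.
have [CC [cc [CC0 cc0 HC]]] :=
  exists_fine_cells d_gt0 compactP convexP P_dens lamP_gt0 dens_bnd r10.
pose D := LamP * 2 ^+ d.
have D0 : 0 < D by rewrite mulr_gt0// exprn_gt0.
(* The three terms bound the sums of inverse masses over the two nets and the cells; the factor 5
   makes [8 * 5] exceed the 36 of [expected_error]. *)
exists (5 * (CP * D + CQ * D + CC / cc * D ^+ 2)), 1%N => n eps n0 /andP[eps0 eps1].
cbv zeta; set kappa := 5 * _ + _; set r := delta_psi * eps / (8 * L).
set mP := min_ball_mass P _ _; set mQ := min_ball_mass Q _ _; set h := ddpsi _.
set alpha := lamP ^+ 2 * h ^+ 2 * mQ / _; set beta := Num.min (_ / _) _.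
have r0 : 0 < r by rewrite /r divr_gt0 ?mulr_gt0.
have rr1 : 0 < r <= delta_psi / (8 * L).
  by rewrite r0 /r -mulrA ler_pM2l// ler_pdivrMr ?mulr_gt0// mulVf ?gt_eqF ?mulr_gt0.
have rE : 2 * L / eps * r = delta_psi / 4.
  by rewrite /r; field; rewrite !gt_eqF.
have [NP [zP [zPA netP NPb]]] := HP r rr1.
have [NQ [zQ [zQB netQ NQb]]] := HQ r rr1.
have [NC [cell [mcell diamc exc massc NCb]]] := HC r rr1.
have g0 := gamma_gt0 n eps n0 eps0.
have [gc gr] := gamma_bnd n eps n0 eps0.
pose K := `|Num.ceil (16 * L * ediam (msupport P) / (delta_psi * eps))|%N.
have x0 : 0 < 16 * L * ediam (msupport P) / (delta_psi * eps).
  by rewrite divr_gt0 ?mulr_gt0.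
have ceil0 : 0 < Num.ceil (16 * L * ediam (msupport P) / (delta_psi * eps)).
  by rewrite -(ltr_int R); apply: lt_le_trans x0 (Num.Theory.ceil_ge _).
have KE : K%:R = (Num.ceil (16 * L * ediam (msupport P) / (delta_psi * eps)))%:~R :> R.
  by rewrite /K -[in RHS](gtz0_abs ceil0).
have K0 : (0 < K)%N by rewrite absz_gt0 gt_eqF.
have KR : 0 < K%:R :> R by rewrite ltr0n.
(* The argument of the ceiling is [2 / r] times the diameter. *)
have Kr : ediam (msupport P) / K%:R <= r / 2.
  have r20 : 0 < r / 2 by rewrite divr_gt0.
  rewrite ler_pdivrMr// -ler_pdivrMl// KE.
  apply: le_trans (Num.Theory.ceil_ge _).
  by rewrite le_eqVlt; apply/orP; left; apply/eqP; rewrite /r; field; rewrite !gt_eqF.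
(* With this Poincare constant, the [alpha] of [expected_error] becomes the one announced. *)
pose C := 4 * (LamP ^+ 2 / lamP ^+ 2 * K%:R ^+ (d + 2)).
have C0 : 0 < C by rewrite !mulr_gt0 ?invr_gt0 ?exprn_gt0.
have cell0 k : 0 < cell_mass P cell k.
  by apply: lt_le_trans (massc k); rewrite mulr_gt0// exprn_gt0.
have := expected_error d_gt0 n0 phi_reg psi_C11 ddpsi_gt0 compactP compactQ c_lip L_gt0 eps0
  eps1 r0 rE g0 (pi_opt eps eps0) (fg_pot eps eps0) XY_indep
  (fun s => fghat_pot n eps s n0 eps0) gc gr C0 zPA zQB netP netQ mcell cell0
  (fun x xA => near_cells_sample_poincare compactP convexP P_dens lamP_gt0 dens_bnd
     K0 Kr mcell diamc exc xA).
cbv zeta.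
have -> : h ^+ 2 * mQ / (2 * gamma n eps * C) = alpha.
  by rewrite /alpha /C -KE; field; rewrite expf_neq0 ?gt_eqF.
rewrite -/kappa -/beta => /le_trans; apply; apply: leeD.
  apply: lee_wpmul2r.
    rewrite mule_ge0 ?lee_fin ?invr_ge0//; exact: variance_ge0.
  (* What is left is [72 <= 2 ^+ 8]. *)
  rewrite lee_fin ler_wpM2r ?invr_ge0 ?sqr_ge0// ler_wpM2r ?le_max ?ler01 ?orbT//.
  by rewrite -natrX ler_nat.
rewrite lee_fin.
have mP0 : 0 < mP by exact: min_ball_mass_gt0.
have mQ0 : 0 < mQ by exact: min_ball_mass_gt0.
have rd0 : 0 < r ^+ d by rewrite exprn_gt0.
(* As the density is bounded, a ball of radius [r] has [P]-mass at most [D * r ^+ d]. All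
   cardinalities, that of the net for [Q] included, are thus expressed by [mP]. *)
have rdE : r ^- d <= D / mP.
  have [x Ax] := msupport_neq0 P.
  have := le_trans (le_min_ball_mass r Ax)
    (ball_mass_le P_dens lamP_gt0 dens_bnd x (ltW r0)).
  rewrite lee_fin exprMn mulrA -/D -/mP => mPle.
  by rewrite ler_pdivlMr// mulrC ler_pdivrMr.
have massP k : (fine (P (eball (zP k) r)))^-1 <= mP^-1.
  have := le_min_ball_mass r (zPA k); rewrite -probability_fineK; last exact: measurable_eball.
  rewrite lee_fin => le; rewrite lef_pV2 ?posrE//; exact: lt_le_trans le.
have massQ k : (fine (Q (eball (zQ k) r)))^-1 <= mQ^-1.
  have := le_min_ball_mass r (zQB k); rewrite -probability_fineK; last exact: measurable_eball.
  rewrite lee_fin => le; rewrite lef_pV2 ?posrE//; exact: lt_le_trans le.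
have massC k : (cell_mass P cell k)^-1 <= (cc * r ^+ d)^-1.
  by rewrite lef_pV2 ?posrE ?mulr_gt0.
have sum_le N (F : 'I_N -> R) b : (forall k, F k <= b) -> \sum_k F k <= N%:R * b.
  move=> Fb; apply: le_trans (ler_sum _ (fun k _ => Fb k)) _.
  by rewrite sumr_const card_ord mulr_natl.
set p := mP^-1; set q := mQ^-1.
have p0 : 0 < p by rewrite invr_gt0.
have q0 : 0 < q by rewrite invr_gt0.
have NPp : NP%:R <= CP * (D * p) by apply: le_trans NPb _; rewrite ler_wpM2l.
have NQp : NQ%:R <= CQ * (D * p) by apply: le_trans NQb _; rewrite ler_wpM2l.
have NCp : NC%:R <= CC * (D * p) by apply: le_trans NCb _; rewrite ler_wpM2l.
have SP := le_trans (sum_le _ _ _ massP) (ler_wpM2r (ltW p0) NPp).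
have SQ := le_trans (sum_le _ _ _ massQ) (ler_wpM2r (ltW q0) NQp).
have SC : \sum_k (cell_mass P cell k)^-1 <= CC * (D * p) * (cc^-1 * (D * p)).
  apply: le_trans (sum_le _ _ _ massC) _; apply: ler_pM => //.
    by rewrite invr_ge0 mulr_ge0 ?ltW.
  by rewrite invfM ler_pM2l ?invr_gt0.
have p2 := sqr_ge0 p; have q2 := sqr_ge0 q.
(* The net for [Q] produces the mixed product: its cardinality is of order [p] and the inverse
   masses of its balls are at most [q]. *)
have pq : p * q <= p ^+ 2 + q ^+ 2.
  rewrite -subr_ge0.
  have -> : p ^+ 2 + q ^+ 2 - p * q = ((p - q) ^+ 2 + (p ^+ 2 + q ^+ 2)) / 2 by field.
  by rewrite divr_ge0// addr_ge0 ?sqr_ge0// addr_ge0.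
have CPD : 0 <= CP * D by exact: mulr_ge0 CP0 (ltW D0).
have CQD : 0 <= CQ * D by exact: mulr_ge0 CQ0 (ltW D0).
have CCD : 0 <= CC / cc * D ^+ 2.
  by apply: mulr_ge0; [exact: divr_ge0 CC0 (ltW cc0)|exact: sqr_ge0].
set S := (X in _ * X <= _).
have S_le : S <= (CP * D + CQ * D + CC / cc * D ^+ 2) * (p ^+ 2 + q ^+ 2).
  apply: le_trans (lerD (lerD SP SQ) SC) _.
  have -> : CP * (D * p) * p + CQ * (D * p) * q + CC * (D * p) * (cc^-1 * (D * p)) =
    CP * D * p ^+ 2 + CQ * D * (p * q) + CC / cc * D ^+ 2 * p ^+ 2 by ring.
  rewrite !mulrDl; apply: lerD; first apply: lerD.
  - by rewrite ler_wpM2l// lerDl.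
  - by rewrite ler_wpM2l.
  - by rewrite ler_wpM2l// lerDl.
set C' := (X in S <= X * _) in S_le *.
have C'0 : 0 <= C' by apply: addr_ge0 => //; exact: addr_ge0.
have eu : 0 <= 1 / eps `^ u by rewrite divr_ge0// powR_ge0.
have k0 : 0 <= kappa ^+ 2 / n%:R by rewrite divr_ge0// sqr_ge0.
have -> : 36 * kappa ^+ 2 / n%:R * S = kappa ^+ 2 / n%:R * (36 * S) by ring.
have -> : 8 * kappa ^+ 2 / n%:R * (1 / eps `^ u + 5 * C' / mP ^+ 2 + 5 * C' / mQ ^+ 2) =
  kappa ^+ 2 / n%:R * (8 * (1 / eps `^ u) + 40 * (C' * (p ^+ 2 + q ^+ 2))).
  by rewrite /p /q !exprVn; ring.
rewrite ler_wpM2l//.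
have Z0 : 0 <= C' * (p ^+ 2 + q ^+ 2) by rewrite mulr_ge0// addr_ge0.
apply: (@le_trans _ _ (36 * (C' * (p ^+ 2 + q ^+ 2)))); first by rewrite ler_wpM2l.
apply: (@le_trans _ _ (40 * (C' * (p ^+ 2 + q ^+ 2)))); first by rewrite ler_wpM2r// ler_nat.
by rewrite lerDr mulr_ge0.
Qed.
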